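(* Let $G$ be a locally compact group, let $H$ be a compact subgroup of $G$, and let $m$ be the normalized $G$-invariant measure on the coset space $G/H$. Suppose that the Young function $\varphi$ satisfies the $\Delta_2$-condition. Then the convolution $*_{G/H}:\mathcal{C}_c(G/H)\times\mathcal{C}_c(G/H)\to\mathcal{C}_c(G/H)$ given by $$f*_{G/H}g(xH)=\int_{G/H} f(yH)\,Jg(y^{-1}xH)\,dm(yH)$$ can be extended to a convolution $*^{\varphi}_{G/H}: L^1(G/H,m)\times L^\varphi(G/H,m)\to L^\varphi(G/H,m)$ such that $L^\varphi(G/H,m)$ is a Banach left $L^1(G/H,m)$-module with respect to this extended convolution.
   Context: Young functions and Orlicz spaces: A Young function is a non-zero convex function $\varphi:\mathbb{R}\to[0,\infty]$ that is even and left continuous with $\varphi(0)=0$ and $\lim_{x\to\infty}\varphi(x)=\infty$. Let $\Omega$ be a locally compact Hausdorff space with a positive Radon measure $\mu$. $\varphi$ satisfies the $\Delta_2$-condition if there exist $C>0$ and $x_0>0$ such that $\varphi(2x)\le C\varphi(x)$ for all $x\ge x_0$ if $\mu(\Omega)<\infty$, and $\varphi(2x)\le C\varphi(x)$ for all $x\ge 0$ otherwise. For a ($\mu$-a.e. equivalence class of) measurable function $f$ on $\Omega$ put $\rho_\varphi(f)=\int_\Omega\varphi(|f|)\,d\mu$. The Orlicz space $L^\varphi(\Omega,\mu)$ is the set of all such $f$ with $\rho_\varphi(af)<\infty$ for some $a>0$; it is a Banach space for the Luxemburg norm $\|f\|^0_\varphi=\inf\{k>0:\int_\Omega\varphi(|f|/k)\,d\mu\le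 1\}$, also written $\|f\|^0_{L^\varphi(\Omega,\mu)}$. Homogeneous space: $G$ is a locally compact group with Haar measure $dx$, $H$ a compact subgroup with normalized Haar measure $dh$, $G/H$ the space of left cosets on which $G$ acts by left multiplication. For $f\in\mathcal{C}_c(G)$ (continuous functions with compact support), $T_H(f)(xH)=\int_H f(xh)\,dh$. The normalized $G$-invariant measure $m$ on $G/H$ is the unique $G$-invariant positive Radon measure satisfying Weil's formula $\int_{G/H}T_H(f)(xH)\,dm(xH)=\int_G f(x)\,dx$. The operator $J:\mathcal{C}_c(G/H)\to\mathcal{C}_c(G/H)$ is $Jg(xH)=\int_H g(hxH)\,dh$. $(\mathcal{C}_c(G/H),*_{G/H})$ is an algebra; the algebra structure on $L^1(G/H,m)$ is the continuous extension of $*_{G/H}$ to $L^1(G/H,m)\times L^1(G/H,m)$. A Banach left $L^1(G/H,m)$-module structure on $L^\varphi(G/H,m)$ is a left module structure $(f,g)\mapsto f*g$ with $\|f*g\|^0_{L^\varphi(G/H,m)}\le\|f\|_{L^1(G/H,m)}\|g\|^0_{L^\varphi(G/H,m)}$. *)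

(* Defs.v *)
From HB Require Import structures.
From mathcomp Require Import all_boot all_order all_algebra generic_quotient.
From mathcomp Require Import all_classical all_reals all_analysis.
From mathcomp Require Import complex.

Set Implicit Arguments.
Unset Strict Implicit.
Unset Printing Implicit Defensive.

Import Order.TTheory GRing.Theory Num.Theory.
Import numFieldNormedType.Exports.
Import ComplexField.Normc.

Local Open Scope classical_set_scope.
Local Open Scope ring_scope.
Local Open Scope quotient_scope.
Local Open Scope complex_scope.

(* The base point is only there because measurableType requires one; a group is
   inhabited, so this is no restriction. *)
HB.mixin Record Group_isTopologicalGroup G
    & monoid.Group G & PointedTopological G := {
  mulg_continuous : continuous (fun p : G * G => (p.1 * p.2)%g : G) ;
  invg_continuous : continuous (fun x : G => (x^-1)%g : G)
}.

#[short(type="topologicalGroupType")]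
HB.structure Definition TopologicalGroup :=
  {G of monoid.Group G & PointedTopological G & Group_isTopologicalGroup G}.

Section subgroup_type.
Context {G : topologicalGroupType} (H : groupClosed G).

Definition subgroup_type : Type := {x : G | x \in H}.

HB.instance Definition _ := SubChoice.on subgroup_type.

Lemma groupClosed_closed : group_closed (H : {pred G}).
Proof. by split; [exact: gpred1 | exact: gpredF]. Qed.

HB.instance Definition _ :=
  SubChoice_isSubGroup.Build G _ subgroup_type groupClosed_closed.

HB.instance Definition _ :=
  Topological.copy subgroup_type (initial_topology (val : subgroup_type -> G)).
HB.instance Definition _ := isPointed.Build subgroup_type (1%g : subgroup_type).

Lemma subgroup_val_continuous : continuous (val : subgroup_type -> G).
Proof. exact: (@initial_continuous subgroup_type G val). Qed.

Lemma subgroup_mulg_continuous : continuous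
  (fun p : subgroup_type * subgroup_type => (p.1 * p.2)%g : subgroup_type).
Proof.
apply: (continuous_comp_initial (w := val : subgroup_type -> G)) => -[x y].
apply: (@continuous_comp (subgroup_type * subgroup_type)%type (G * G)%type G
  (fun p => (val p.1, val p.2)) (fun p => (p.1 * p.2)%g)).
  apply: cvg_pair.
    apply: (@cvg_comp _ _ _ fst (val : subgroup_type -> G) _ (nbhs x)).
      exact: cvg_fst.
    exact: subgroup_val_continuous.
  apply: (@cvg_comp _ _ _ snd (val : subgroup_type -> G) _ (nbhs y)).
    exact: cvg_snd.
  exact: subgroup_val_continuous.
exact: mulg_continuous.
Qed.

Lemma subgroup_invg_continuous :
  continuous (fun x : subgroup_type => (x^-1)%g : subgroup_type).
Proof.
apply: (continuous_comp_initial (w := val : subgroup_type -> G)) => x.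
apply: (@continuous_comp _ _ _ (val : subgroup_type -> G) (fun y => (y^-1)%g)).
  exact: subgroup_val_continuous.
exact: invg_continuous.
Qed.

HB.instance Definition _ := Group_isTopologicalGroup.Build subgroup_type
  subgroup_mulg_continuous subgroup_invg_continuous.

End subgroup_type.

Section coset_space.
Context {G : topologicalGroupType} (H : groupClosed G).

Definition coset_rel : rel G := fun x y => (x^-1 * y)%g \in H.

Lemma coset_rel_refl : reflexive coset_rel.
Proof. by move=> x; rewrite /coset_rel mulVg gpred1. Qed.

Lemma coset_rel_sym : symmetric coset_rel.
Proof. by move=> x y; rewrite /coset_rel -(gpredV H) invgM invgK. Qed.

Lemma coset_rel_trans : transitive coset_rel.
Proof.
move=> y x z xy yz; have := gpredM _ _ xy yz.
by rewrite /coset_rel -mulgA mulVKg.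
Qed.

Canonical coset_equiv :=
  EquivRel coset_rel coset_rel_refl coset_rel_sym coset_rel_trans.

Definition coset_space : Type := quotient_topology {eq_quot coset_equiv}.

HB.instance Definition _ := Quotient.on coset_space.
HB.instance Definition _ := PointedTopological.on coset_space.

Definition coset (x : G) : coset_space := \pi x.

(* The action x . (yH) = xyH; see coset_actE. *)
Definition coset_act (x : G) (p : coset_space) : coset_space :=
  coset (x * repr p)%g.

Lemma coset_eqP (x y : G) : reflect (coset x = coset y) ((x^-1 * y)%g \in H).
Proof. exact: (@eqmodP _ _ _ _). Qed.

Lemma coset_actE (x y : G) : coset_act x (coset y) = coset (x * y)%g.
Proof.
apply/coset_eqP; rewrite invgM -mulgA mulKg.
by apply/coset_eqP; rewrite /coset reprK.
Qed.

End coset_space.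

Notation borel T := (g_sigma_algebraType (@open T)).

Section radon.
Context {R : realType}.
Local Open Scope ereal_scope.

(* Outer regular on Borel sets, inner regular on open sets: the Radon measures
   representing positive functionals on Cc. *)
Record radon_measure (T : ptopologicalType)
    (mu : {measure set (borel T) -> \bar R}) : Prop := {
  radon_compact : forall K : set T, compact K -> mu K < +oo ;
  radon_outer : forall A : set (borel T), measurable A ->
    mu A = ereal_inf [set mu U | U in [set U : set T | open U /\ A `<=` U]] ;
  radon_inner : forall U : set T, open U ->
    mu U = ereal_sup [set mu K | K in [set K : set T | compact K /\ K `<=` U]]
}.

Record haar_measure (G : topologicalGroupType)
    (mu : {measure set (borel G) -> \bar R}) : Prop := {
  haar_radon : radon_measure mu ;
  haar_neq0 : mu setT != 0 ;
  haar_invariant : forall (x : G) (A : set (borel G)), measurable A ->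
    mu [set (x * y)%g | y in A] = mu A
}.

End radon.

Section complex_functions.
Context {R : realType}.

(* R[i]^o carries the topology of the norm of R[i]. *)
Definition compactly_supported_continuous (T : topologicalType)
    (f : T -> R[i]) : Prop :=
  continuous (f : T -> R[i]^o) /\ compact (closure [set x | f x != 0]).

Context {d} {T : measurableType d}.
Implicit Types (mu : {measure set T -> \bar R}) (f : T -> R[i]).

Definition cmeasurable f : Prop :=
  measurable_fun setT (fun x => complex.Re (f x)) /\
  measurable_fun setT (fun x => complex.Im (f x)).

Definition cintegral mu f : R[i] :=
  Rintegral mu setT (fun x => complex.Re (f x)) +i*
  Rintegral mu setT (fun x => complex.Im (f x)).

End complex_functions.

Notation Cc := compactly_supported_continuous.

Section orlicz.
Context {R : realType}.
Local Open Scope ereal_scope.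

(* Left continuity is required at every point of the real line, so by evenness
   phi cannot jump to +oo, although it may reach +oo continuously. *)
Record young_function (phi : R -> \bar R) : Prop := {
  young_ge0 : forall x, 0 <= phi x ;
  young_neq0 : exists x, phi x != 0 ;
  young_convex : forall x y t : R, (0 <= t <= 1)%R ->
    phi (t * x + (1 - t) * y)%R <= t%:E * phi x + (1 - t)%:E * phi y ;
  young_even : forall x, phi (- x)%R = phi x ;
  young_left_continuous : forall x, phi y @[y --> x^'-] --> phi x ;
  young0 : phi 0%R = 0 ;
  young_infty : phi x @[x --> +oo%R] --> +oo
}.

Context {d} {T : measurableType d}.
Variables (mu : {measure set T -> \bar R}) (phi : R -> \bar R).
Implicit Types f g : T -> R[i].

Definition delta2 : Prop :=
  exists2 C : R, (0 < C)%R &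
    if mu setT < +oo then
      exists2 x0 : R, (0 < x0)%R &
        forall x, (x0 <= x)%R -> phi (2 * x)%R <= C%:E * phi x
    else forall x, (0 <= x)%R -> phi (2 * x)%R <= C%:E * phi x.

Definition modular f : \bar R := \int[mu]_x phi (normc (f x)).

Definition orlicz_space : set (T -> R[i]) :=
  [set f | cmeasurable f /\
    exists2 a : R, (0 < a)%R & modular (fun x => a%:C * f x)%R < +oo].

Definition luxemburg_norm f : \bar R :=
  ereal_inf [set k%:E | k in
    [set k : R | (0 < k)%R /\ \int[mu]_x phi (normc (f x) / k)%R <= 1]].

Definition L1_norm f : \bar R := \int[mu]_x (normc (f x))%:E.

Definition L1_space : set (T -> R[i]) :=
  [set f | cmeasurable f /\ L1_norm f < +oo].

End orlicz.

Section homogeneous_space.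
Context {R : realType} {G : topologicalGroupType} {H : groupClosed G}.
Variables (dx : {measure set (borel G) -> \bar R})
  (dh : {measure set (borel (subgroup_type H)) -> \bar R})
  (m : {measure set (borel (coset_space H)) -> \bar R}).

(* The operator T_H; by invariance of dh the value does not depend on the
   representative of the coset. *)
Definition weil_operator (f : G -> R[i]) (p : coset_space H) : R[i] :=
  cintegral dh (fun h => f (repr p * val h)%g).

Record normalized_invariant_measure : Prop := {
  nim_radon : radon_measure m ;
  nim_invariant : forall (x : G) (A : set (borel (coset_space H))),
    measurable A -> m [set coset_act x p | p in A] = m A ;
  nim_weil : forall f : G -> R[i], Cc f ->
    cintegral m (weil_operator f) = cintegral dx f
}.

Definition J_operator (g : coset_space H -> R[i]) (p : coset_space H) : R[i] :=
  cintegral dh (fun h => g (coset_act (val h) p)).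

(* J_operator g is invariant under the action of H, so that the integrand does
   not depend on the representative of p. *)
Definition coset_convolution (f g : coset_space H -> R[i])
    (q : coset_space H) : R[i] :=
  cintegral m (fun p => f p * J_operator g (coset_act (repr p)^-1%g q)).

End homogeneous_space.

(* Elements of L^1 and L^phi are represented by functions, and operations on
   them are considered up to almost everywhere equality. *)
Section banach_module.
Context {R : realType} {d} {T : measurableType d}.
Variables (mu : {measure set T -> \bar R}) (phi : R -> \bar R).
Local Notation L1 := (L1_space mu).
Local Notation Lphi := (orlicz_space mu phi).
Local Notation binop := ((T -> R[i]) -> (T -> R[i]) -> (T -> R[i])).

(* Joint continuity; it also forces compatibility with a.e. equality. *)
Record continuous_L1_product (mul1 : binop) : Prop := {
  L1_product_closed : forall f g, L1 f -> L1 g -> L1 (mul1 f g) ;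
  L1_product_continuous : forall f g, L1 f -> L1 g -> forall e : R, 0 < e ->
    exists2 delta : R, 0 < delta & forall f' g', L1 f' -> L1 g' ->
      (L1_norm mu (f' \- f)%R < delta%:E)%E ->
      (L1_norm mu (g' \- g)%R < delta%:E)%E ->
      (L1_norm mu (mul1 f' g' \- mul1 f g)%R < e%:E)%E
}.

Record banach_left_L1_module (mul1 act : binop) : Prop := {
  module_closed : forall f g, L1 f -> Lphi g -> Lphi (act f g) ;
  module_ae : forall f f' g g', L1 f -> L1 f' -> Lphi g -> Lphi g' ->
    f = f' %[ae mu] -> g = g' %[ae mu] -> act f g = act f' g' %[ae mu] ;
  module_addl : forall f f' g, L1 f -> L1 f' -> Lphi g ->
    act (f \+ f') g = act f g \+ act f' g %[ae mu] ;
  module_addr : forall f g g', L1 f -> Lphi g -> Lphi g' ->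
    act f (g \+ g') = act f g \+ act f g' %[ae mu] ;
  module_scalel : forall (c : R[i]) f g, L1 f -> Lphi g ->
    act (fun x => c * f x) g = (fun x => c * act f g x) %[ae mu] ;
  module_scaler : forall (c : R[i]) f g, L1 f -> Lphi g ->
    act f (fun x => c * g x) = (fun x => c * act f g x) %[ae mu] ;
  module_assoc : forall f f' g, L1 f -> L1 f' -> Lphi g ->
    act (mul1 f f') g = act f (act f' g) %[ae mu] ;
  module_norm : forall f g, L1 f -> Lphi g ->
    (luxemburg_norm mu phi (act f g) <=
     L1_norm mu f * luxemburg_norm mu phi g)%E
}.

End banach_module.

(* Main.v *)
Require Import Defs.
From HB Require Import structures.
From mathcomp Require Import all_boot all_order all_algebra.
From mathcomp Require Import all_classical all_reals all_analysis.
From mathcomp Require Import measurable_realfun complex.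
From mathcomp Require Import ring lra.
Set Implicit Arguments.
Unset Strict Implicit.
Unset Printing Implicit Defensive.
Import Order.TTheory GRing.Theory Num.Theory.
Import numFieldNormedType.Exports.
Import ComplexField.Normc.
Local Open Scope classical_set_scope.
Local Open Scope ring_scope.

(** Write [X] for the coset space and [k_g p q = Jg (p^-1 q)] for the kernel of the
convolution, so that [f * g (q)] is the integral of [f p * k_g p q] against [m].

On compactly supported continuous functions everything is a computation with
iterated integrals. Since [J g] is invariant under [H], the kernel is a
continuous function of two cosets, invariant under the diagonal action of [G];
together with the invariance of [m] this gives associativity ([conv_assoc]) and
the contraction property [|f * g|_1 <= |f|_1 |g|_1] ([conv_norm]), while
[|f * g| <= |f|_1 sup |g|] is immediate ([conv_bound]). The measures need not
be sigma-finite and the Borel sets of a product need not be generated by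
rectangles, so the order of integration is exchanged by hand ([fubini_Cc]): on
a small piece of a compact set the integrand is uniformly close to a function
of the other variable alone. Compactly supported continuous functions are dense
in [L^1], boundedly so on bounded functions ([Cc_dense], [Cc_dense_bound]), and
the product of [L^1] is continuous; hence it inherits all these identities and
bounds ([contractive_of_core]).

The passage to [L^phi] is an interpolation between the two bounds. For [g] in
[L^1 + L^oo] which is, up to arbitrarily small uniform errors, integrable, the
products of [f] with integrable uniform approximations of [g] converge uniformly
off a null set, because of the sup bound. Their limit [f . g] is characterised
by [|f . g - f * g1| <= |f|_1 s] whenever [g1] is integrable and
[|g - g1| <= s] ([is_action]), and the module laws are read off from it.

Taking for [g1] the part of [g] that exceeds the level [t] gives
[\int (|f . g| - t |f|_1)_+ <= |f|_1 \int (|g| - t)_+] ([L1_action_hinge]).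
A Young function is a pointwise limit of minorants [\sum_i c_i (x - t_i)_+]
with [c_i >= 0] ([hinge_approx_cvg]), so by Fatou's lemma
[\int phi (|f . g| / |f|_1) <= \int phi |g|] ([L1_action_modular]), which is
the norm inequality after rescaling. The growth condition on [phi] guarantees
that [L^phi] consists of functions on which the action is defined
([orlicz_small]). *)

(** * Complex functions and their [L^1] norm *)

Lemma ler_add_invn {R : realType} (x a b : R) : 0 <= b ->
  (forall n, x <= a + b * n.+1%:R^-1) -> x <= a.
Proof.
move=> b0 h; apply/ler_addgt0Pr => e e0; pose n := Num.truncn (b / e).
rewrite (le_trans (h n))// lerD2l ler_pdivrMr//.
by rewrite mulrC -ler_pdivrMr// ltW// truncnS_gt.
Qed.

Section normc_theory.
Context {R : realType}.
Implicit Types z w : R[i].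

Lemma cReD z w : complex.Re (z + w) = complex.Re z + complex.Re w.
Proof. by case: z w => a b []. Qed.

Lemma cImD z w : complex.Im (z + w) = complex.Im z + complex.Im w.
Proof. by case: z w => a b []. Qed.

Lemma cReN z : complex.Re (- z) = - complex.Re z.
Proof. by case: z. Qed.

Lemma cImN z : complex.Im (- z) = - complex.Im z.
Proof. by case: z. Qed.

Lemma cReM z w :
  complex.Re (z * w) = complex.Re z * complex.Re w - complex.Im z * complex.Im w.
Proof. by case: z w => a b []. Qed.

Lemma cImM z w :
  complex.Im (z * w) = complex.Re z * complex.Im w + complex.Im z * complex.Re w.
Proof. by case: z w => a b []. Qed.

Lemma normcRI z :
  normc z = Num.sqrt (complex.Re z ^+ 2 + complex.Im z ^+ 2).
Proof. by case: z. Qed.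

Lemma normc_nneg z : 0 <= normc z.
Proof. by rewrite normcRI sqrtr_ge0. Qed.

Lemma ler_Re_normc z : `|complex.Re z| <= normc z.
Proof. by rewrite normcRI -sqrtr_sqr ler_wsqrtr// lerDl sqr_ge0. Qed.

Lemma ler_Im_normc z : `|complex.Im z| <= normc z.
Proof. by rewrite normcRI -sqrtr_sqr ler_wsqrtr// lerDr sqr_ge0. Qed.

Lemma normc_le_ReIm z : normc z <= `|complex.Re z| + `|complex.Im z|.
Proof.
rewrite normcRI -[leRHS]ger0_norm ?addr_ge0// -sqrtr_sqr ler_wsqrtr//.
rewrite sqrrD !real_normK ?num_real//.
by rewrite addrAC lerDl mulrn_wge0 // mulr_ge0 // normr_ge0.
Qed.

Lemma normc_eq0P z : normc z = 0 <-> z = 0.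
Proof. by split=> [/eq0_normc //|->]; rewrite normc0. Qed.

Lemma ler_normcD z w : normc (z + w) <= normc z + normc w.
Proof. exact: le_normcD. Qed.

Lemma normc_distC z w : normc (z - w) = normc (w - z).
Proof. by rewrite -normcN opprB. Qed.

Lemma ler_dist_normc z w : `|normc z - normc w| <= normc (z - w).
Proof.
rewrite ler_norml lerBrDr addrC lerBlDr; apply/andP; split.
  by rewrite normc_distC addrC -{1}(subrK z w) ler_normcD.
by rewrite lerBlDr -{1}(subrK w z) ler_normcD.
Qed.

Lemma normc_real (r : R) : normc r%:C%C = `|r|.
Proof. by rewrite normcRI /= expr0n addr0 sqrtr_sqr. Qed.

Lemma ler_cauchy_schwarz (a b c d' : R) :
  a * c + b * d' <= normc (a +i* b)%C * normc (c +i* d')%C.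
Proof.
have -> : a * c + b * d' = complex.Re ((a -i* b)%C * (c +i* d')%C).
  by rewrite /= mulNr opprK.
rewrite (le_trans (ler_norm _))// (le_trans (ler_Re_normc _))// normcM.
by rewrite /= sqrrN.
Qed.

End normc_theory.

Section cmeasurable_theory.
Context {R : realType} {d} {T : measurableType d}.
Implicit Types (f g : T -> R[i]) (c : R[i]).

Lemma cmeasurableD f g : cmeasurable f -> cmeasurable g -> cmeasurable (f \+ g).
Proof.
move=> [f1 f2] [g1 g2]; split.
  by under eq_fun do rewrite /= cReD; exact: measurable_funD.
by under eq_fun do rewrite /= cImD; exact: measurable_funD.
Qed.

Lemma cmeasurable_cst c : cmeasurable (fun _ : T => c).
Proof. by split; exact: measurable_cst. Qed.

Lemma cmeasurableM f g :
  cmeasurable f -> cmeasurable g -> cmeasurable (fun x => f x * g x).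
Proof.
move=> [f1 f2] [g1 g2]; split.
  by under eq_fun do rewrite cReM; apply: measurable_funB; exact: measurable_funM.
by under eq_fun do rewrite cImM; apply: measurable_funD; exact: measurable_funM.
Qed.

Lemma cmeasurableZ c f : cmeasurable f -> cmeasurable (fun x => c * f x).
Proof. by move=> mf; apply: cmeasurableM => //; exact: cmeasurable_cst. Qed.

Lemma cmeasurableB f g : cmeasurable f -> cmeasurable g -> cmeasurable (f \- g).
Proof.
move=> [f1 f2] [g1 g2]; split.
  by under eq_fun do rewrite /= cReD cReN; exact: measurable_funB.
by under eq_fun do rewrite /= cImD cImN; exact: measurable_funB.
Qed.

Lemma cmeasurable_real (r : T -> R) :
  measurable_fun setT r -> cmeasurable (fun x => (r x)%:C%C).
Proof. by move=> mr; split => //; exact: measurable_cst. Qed.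

Lemma measurable_normc f :
  cmeasurable f -> measurable_fun setT (fun x => normc (f x)).
Proof.
move=> [f1 f2]; under eq_fun do rewrite normcRI.
apply: (measurableT_comp (f := @Num.sqrt R)).
  by apply: continuous_measurable_fun; exact: sqrt_continuous.
by apply: measurable_funD; exact: measurable_funX.
Qed.

Lemma measurable_normcE f :
  cmeasurable f -> measurable_fun setT (fun x => (normc (f x))%:E : \bar R).
Proof. by move=> mf; apply/measurable_EFinP; exact: measurable_normc. Qed.

End cmeasurable_theory.

Section L1_theory.
Context {R : realType} {d} {T : measurableType d}.
Variable mu : {measure set T -> \bar R}.
Implicit Types (f g : T -> R[i]) (c : R[i]) (u : nat -> T -> R[i]).
Local Notation L1 := (L1_space mu).

(** Equal to [L1_norm] where that is finite ([L1_normE]), and to the default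
    value [0] where it is infinite. *)
Definition nL1 f : R := fine (L1_norm mu f).

Lemma L1_norm_ge0 f : (0 <= L1_norm mu f)%E.
Proof. by apply: integral_ge0 => x _; rewrite lee_fin normc_nneg. Qed.

Lemma nL1_ge0 f : 0 <= nL1 f.
Proof. by rewrite fine_ge0// L1_norm_ge0. Qed.

Lemma L1_normE f : L1 f -> L1_norm mu f = (nL1 f)%:E.
Proof. by move=> [_ ?]; rewrite fineK// ge0_fin_numE// L1_norm_ge0. Qed.

Lemma L1_norm_le f g : cmeasurable f -> cmeasurable g ->
  {ae mu, forall x, normc (f x) <= normc (g x)} ->
  (L1_norm mu f <= L1_norm mu g)%E.
Proof.
move=> mf mg fg; apply: ae_ge0_le_integral => //.
- by move=> x _; rewrite lee_fin normc_nneg.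
- exact: measurable_normcE.
- by move=> x _; rewrite lee_fin normc_nneg.
- exact: measurable_normcE.
- by apply: filterS fg => x fgx _; rewrite lee_fin.
Qed.

Lemma L1_normD f g : cmeasurable f -> cmeasurable g ->
  (L1_norm mu (f \+ g)%R <= L1_norm mu f + L1_norm mu g)%E.
Proof.
move=> mf mg; rewrite /L1_norm -ge0_integralD//; first last.
- exact: measurable_normcE.
- by move=> x _; rewrite lee_fin normc_nneg.
- exact: measurable_normcE.
- by move=> x _; rewrite lee_fin normc_nneg.
apply: ge0_le_integral => //.
- by move=> x _; rewrite lee_fin normc_nneg.
- by apply: measurable_normcE; exact: cmeasurableD.
- by apply: emeasurable_funD; exact: measurable_normcE.
- by move=> x _; rewrite -EFinD lee_fin ler_normcD.
Qed.

Lemma L1_normZ c f : cmeasurable f ->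
  (L1_norm mu (fun x => c * f x)%R = (normc c)%:E * L1_norm mu f)%E.
Proof.
move=> mf; rewrite /L1_norm -ge0_integralZl//; first last.
- by rewrite lee_fin normc_nneg.
- by move=> x _; rewrite lee_fin normc_nneg.
- exact: measurable_normcE.
by apply: eq_integral => x _; rewrite normcM EFinM.
Qed.

Lemma L1D f g : L1 f -> L1 g -> L1 (f \+ g).
Proof.
move=> [mf f1] [mg g1]; split; first exact: cmeasurableD.
by rewrite (le_lt_trans (L1_normD _ _))// lte_add_pinfty.
Qed.

Lemma L1Z c f : L1 f -> L1 (fun x => c * f x).
Proof.
move=> [mf f1]; split; first exact: cmeasurableZ.
by rewrite L1_normZ// lte_mul_pinfty// lee_fin normc_nneg.
Qed.

Lemma L1B f g : L1 f -> L1 g -> L1 (f \- g).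
Proof.
move=> Lf Lg; rewrite (_ : f \- g = f \+ (fun x => -1 * g x)).
  by apply: L1D => //; exact: L1Z.
by apply/funext => x /=; rewrite mulN1r.
Qed.

Lemma nL1_le f g : L1 f -> L1 g ->
  {ae mu, forall x, normc (f x) <= normc (g x)} -> nL1 f <= nL1 g.
Proof.
move=> Lf Lg fg; rewrite -lee_fin -!L1_normE//.
by apply: L1_norm_le => //; [case: Lf|case: Lg].
Qed.

Lemma nL1D f g : L1 f -> L1 g -> nL1 (f \+ g) <= nL1 f + nL1 g.
Proof.
move=> Lf Lg; rewrite -lee_fin EFinD -!L1_normE//; last exact: L1D.
by apply: L1_normD; [case: Lf|case: Lg].
Qed.

Lemma nL1Z c f : L1 f -> nL1 (fun x => c * f x) = normc c * nL1 f.
Proof.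
move=> Lf; apply/(@EFin_inj R); rewrite EFinM -!L1_normE//; last exact: L1Z.
by apply: L1_normZ; case: Lf.
Qed.

Lemma nL1_distC f g : nL1 (f \- g) = nL1 (g \- f).
Proof.
by congr fine; apply: eq_integral => x _; rewrite /= normc_distC.
Qed.

Lemma nL1_eq0 f : L1 f -> nL1 f = 0 -> {ae mu, forall x, f x = 0}.
Proof.
move=> Lf f0; have [mf _] := Lf.
have : (\int[mu]_x `|(normc (f x))%:E| = 0)%E.
  under eq_integral do rewrite gee0_abs ?lee_fin ?normc_nneg//.
  by rewrite -/(L1_norm mu f) L1_normE// f0.
have /(ae_eq_integral_abs mu (measurableT)) h := measurable_normcE mf.
move=> /h; apply: filterS => x /(_ I) /= [] /normc_eq0P //.
Qed.

Lemma nL1_ae0 f : cmeasurable f -> {ae mu, forall x, f x = 0} -> L1_norm mu f = 0%E.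
Proof.
move=> mf f0; apply/eqP; rewrite eq_le L1_norm_ge0 andbT.
have <- : L1_norm mu (fun=> 0) = 0%E.
  by rewrite /L1_norm normc0 integral0_eq.
by apply: L1_norm_le => //; apply: filterS f0 => x ->.
Qed.

Definition L1cvg u f := (fun n => nL1 (u n \- f)) @ \oo --> 0.

Lemma L1cvg_norm u f : (forall n, L1 (u n)) -> L1 f -> L1cvg u f ->
  (fun n => nL1 (u n)) @ \oo --> nL1 f.
Proof.
move=> Lu Lf uf; apply/cvgrPdist_le => e e0.
move/cvgrPdist_le : uf => /(_ e e0); apply: filterS => n /=.
rewrite sub0r normrN ger0_norm ?nL1_ge0// => ue.
apply: le_trans ue.
rewrite ler_norml lerBrDr addrC !lerBlDr; apply/andP; split.
  have := nL1D (L1B (Lu n) Lf) Lf; rewrite addrC => h.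
  apply: le_trans h; apply: nL1_le => //; first by apply: L1D => //; exact: L1B.
  by apply: aeW => x /=; rewrite subrK.
rewrite nL1_distC.
have := nL1D (L1B Lf (Lu n)) (Lu n) => h.
apply: le_trans h; apply: nL1_le => //; first by apply: L1D => //; exact: L1B.
by apply: aeW => x /=; rewrite subrK.
Qed.

Lemma L1cvg_cst f : L1cvg (fun=> f) f.
Proof.
rewrite /L1cvg (_ : (fun n => _) = fun=> 0); first exact: cvg_cst.
apply/funext => _; rewrite /nL1 /L1_norm.
by rewrite integral0_eq// => x _; rewrite /= subrr normc0.
Qed.

Lemma L1cvg_le u f (b : nat -> R) : (forall n, nL1 (u n \- f) <= b n) ->
  b @ \oo --> 0 -> L1cvg u f.
Proof.
move=> ub b0; apply: (squeeze_cvgr _ (@cvg_cst _ _ _ _ _) b0).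
by apply: nearW => n; rewrite nL1_ge0 ub.
Qed.

Lemma L1cvgD u v f g : (forall n, L1 (u n)) -> L1 f -> (forall n, L1 (v n)) ->
  L1 g -> L1cvg u f -> L1cvg v g -> L1cvg (fun n => u n \+ v n) (f \+ g).
Proof.
move=> Lu Lf Lv Lg uf vg.
apply: (@L1cvg_le _ _ (fun n => nL1 (u n \- f) + nL1 (v n \- g))); last first.
  by rewrite -[X in _ --> X]addr0; exact: cvgD.
move=> n; rewrite (_ : _ \- _ = (u n \- f) \+ (v n \- g)).
  by apply: nL1D; exact: L1B.
by apply/funext => x /=; rewrite opprD addrACA.
Qed.

Lemma L1cvgZ u f c : (forall n, L1 (u n)) -> L1 f -> L1cvg u f ->
  L1cvg (fun n x => c * u n x) (fun x => c * f x).
Proof.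
move=> Lu Lf uf; apply: (@L1cvg_le _ _ (fun n => normc c * nL1 (u n \- f))).
  move=> n; rewrite -nL1Z; last exact: L1B.
  by rewrite (_ : _ \- _ = (fun x => c * (u n \- f) x))//; apply/funext => x /=;
    rewrite mulrBr.
by rewrite -[X in _ --> X](mulr0 (normc c)); exact: cvgMl_tmp.
Qed.

Lemma L1cvg_unique u v f g : (forall n, L1 (u n)) -> L1 f -> L1 g ->
  (forall n, L1 (v n)) ->
  (forall n, {ae mu, forall x, u n x = v n x}) ->
  L1cvg u f -> L1cvg v g -> {ae mu, forall x, f x = g x}.
Proof.
move=> Lu Lf Lg Lv uv uf vg.
have fg0 : nL1 (f \- g) = 0.
  apply/eqP; rewrite eq_le nL1_ge0 andbT.
  have h : (fun n => nL1 (u n \- f) + nL1 (v n \- g)) @ \oo --> 0.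
    by rewrite -[X in _ --> X]addr0; exact: cvgD.
  apply: (cvgr_to_ge h); apply: nearW => n; rewrite (nL1_distC (u n)).
  have := nL1D (L1B Lf (Lu n)) (L1B (Lv n) Lg); apply: le_trans.
  apply: nL1_le; [exact: L1B|by apply: L1D; exact: L1B|].
  by apply: filterS (uv n) => x /= ->; rewrite addrA subrK.
have := nL1_eq0 (L1B Lf Lg) fg0.
by apply: filterS => x /= /eqP; rewrite subr_eq0 => /eqP.
Qed.

(** An essential bound passes to an [L^1]-limit without extracting an almost
    everywhere convergent subsequence: [(|f| - s)_+ <= |f - u n|] as soon as
    [|u n| <= s]. *)
Lemma L1cvg_bound u f (s : nat -> R) (t : R) : (forall n, L1 (u n)) -> L1 f ->
  (forall n, {ae mu, forall x, normc (u n x) <= s n}) -> s @ \oo --> t ->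
  L1cvg u f -> {ae mu, forall x, normc (f x) <= t}.
Proof.
move=> Lu Lf us st uf.
have key (e : R) : 0 < e -> {ae mu, forall x, normc (f x) <= t + e}.
  move=> e0; pose r x := Num.max (normc (f x) - (t + e)) 0.
  have mf : cmeasurable f by case: Lf.
  have mr : cmeasurable (fun x => (r x)%:C%C).
    apply: cmeasurable_real; apply: measurable_maxr => //.
    by apply: measurable_funB => //; exact: measurable_normc.
  have r0 x : 0 <= r x by rewrite le_max lexx orbT.
  have h n : s n <= t + e ->
      {ae mu, forall x, normc (r x)%:C%C <= normc ((u n \- f) x)}.
    move=> sn; apply: filterS (us n) => x uns.
    rewrite normc_real ger0_norm// ge_max normc_nneg andbT.
    rewrite /= normc_distC (le_trans _ (le_trans (ler_norm _) (ler_dist_normc _ _)))//.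
    by rewrite lerB// (le_trans uns).
  have [N _ hN] : \forall n \near \oo, s n <= t + e.
    by apply: (cvgr_le _ st); rewrite ltrDl.
  have Lr : L1 (fun x => (r x)%:C%C).
    split=> //; apply: (@le_lt_trans _ _ (L1_norm mu (u N \- f))).
      apply: L1_norm_le => //; first by case: (L1B (Lu N) Lf).
      by apply: h; apply: hN => /=.
    by case: (L1B (Lu N) Lf).
  have n0 : nL1 (fun x => (r x)%:C%C) = 0.
    apply/eqP; rewrite eq_le nL1_ge0 andbT.
    apply: (cvgr_to_ge uf); exists N => // n /= Nn; apply: nL1_le => //.
      exact: L1B.
    by apply: h; exact: hN.
  apply: filterS (nL1_eq0 Lr n0) => x -[rx].
  by have := lexx (r x); rewrite {2}rx ge_max subr_le0 => /andP[].
have : {ae mu, forall x, forall n, normc (f x) <= t + 1 * n.+1%:R^-1}.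
  by apply/ae_foralln => n; apply: key; rewrite mul1r invr_gt0.
by apply: filterS => x /ler_add_invn; apply; exact: ler01.
Qed.

End L1_theory.

(** * Continuous products on [L^1] determined on a dense subspace *)

Section L1_product.
Context {R : realType} {d} {T : measurableType d}.
Variable mu : {measure set T -> \bar R}.
Local Notation L1 := (L1_space mu).
Local Notation binop := ((T -> R[i]) -> (T -> R[i]) -> (T -> R[i])).
Implicit Types (f g : T -> R[i]) (c : R[i]) (u v : nat -> T -> R[i]).

Record contractive_L1_product (mul1 : binop) : Prop := {
  cp_closed : forall f g, L1 f -> L1 g -> L1 (mul1 f g) ;
  cp_ae : forall f f' g g', L1 f -> L1 f' -> L1 g -> L1 g' ->
    {ae mu, forall x, f x = f' x} -> {ae mu, forall x, g x = g' x} ->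
    {ae mu, forall x, mul1 f g x = mul1 f' g' x} ;
  cp_addl : forall f f' g, L1 f -> L1 f' -> L1 g ->
    {ae mu, forall x, mul1 (f \+ f') g x = mul1 f g x + mul1 f' g x} ;
  cp_addr : forall f g g', L1 f -> L1 g -> L1 g' ->
    {ae mu, forall x, mul1 f (g \+ g') x = mul1 f g x + mul1 f g' x} ;
  cp_scalel : forall c f g, L1 f -> L1 g ->
    {ae mu, forall x, mul1 (fun y => c * f y) g x = c * mul1 f g x} ;
  cp_scaler : forall c f g, L1 f -> L1 g ->
    {ae mu, forall x, mul1 f (fun y => c * g y) x = c * mul1 f g x} ;
  cp_assoc : forall f f' g, L1 f -> L1 f' -> L1 g ->
    {ae mu, forall x, mul1 (mul1 f f') g x = mul1 f (mul1 f' g) x} ;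
  cp_norm : forall f g, L1 f -> L1 g ->
    nL1 mu (mul1 f g) <= nL1 mu f * nL1 mu g ;
  cp_bound : forall f g (s : R), L1 f -> L1 g ->
    {ae mu, forall x, normc (g x) <= s} ->
    {ae mu, forall x, normc (mul1 f g x) <= nL1 mu f * s}
}.

(** The density clause comes in a bounded form as well, because the sup bound
    [core_bound] can only be transported along approximations which are bounded
    by the same constant. *)
Record dense_convolution_core (D : set (T -> R[i])) (conv : binop) : Prop := {
  core_L1 : forall f, D f -> L1 f ;
  core_dense : forall f, L1 f -> exists2 u, (forall n, D (u n)) & L1cvg mu u f ;
  core_dense_bound : forall f (s : R), L1 f -> 0 < s ->
    {ae mu, forall x, normc (f x) <= s} ->
    exists2 u, (forall n, D (u n) /\ forall x, normc (u n x) <= s) &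
      L1cvg mu u f ;
  core_add : forall f g, D f -> D g -> D (f \+ g) ;
  core_scale : forall c f, D f -> D (fun x => c * f x) ;
  core_conv : forall f g, D f -> D g -> D (conv f g) ;
  core_addl : forall f f' g, D f -> D f' -> D g ->
    conv (f \+ f') g =1 conv f g \+ conv f' g ;
  core_addr : forall f g g', D f -> D g -> D g' ->
    conv f (g \+ g') =1 conv f g \+ conv f g' ;
  core_scalel : forall c f g, D f -> D g ->
    conv (fun x => c * f x) g =1 (fun x => c * conv f g x) ;
  core_scaler : forall c f g, D f -> D g ->
    conv f (fun x => c * g x) =1 (fun x => c * conv f g x) ;
  core_assoc : forall f f' g, D f -> D f' -> D g ->
    conv (conv f f') g =1 conv f (conv f' g) ;
  core_norm : forall f g, D f -> D g ->
    nL1 mu (conv f g) <= nL1 mu f * nL1 mu g ;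
  core_bound : forall f g (s : R), D f -> D g -> (forall x, normc (g x) <= s) ->
    forall x, normc (conv f g x) <= nL1 mu f * s
}.

Variables (mul1 : binop) (D : set (T -> R[i])) (conv : binop).
Hypothesis mulC : continuous_L1_product mu mul1.
Hypothesis core : dense_convolution_core D conv.
Hypothesis mul_conv : forall f g, D f -> D g -> mul1 f g = conv f g %[ae mu].

Let mul_convP f g : D f -> D g -> {ae mu, forall x, mul1 f g x = conv f g x}.
Proof. by move=> Df Dg; apply: filterS (mul_conv Df Dg) => x; apply. Qed.

Let mulL1 f g : L1 f -> L1 g -> L1 (mul1 f g).
Proof. exact: L1_product_closed. Qed.

Let DL1 f : D f -> L1 f.
Proof. exact: (core_L1 core). Qed.

Lemma L1cvg_mul u v f g : (forall n, L1 (u n)) -> L1 f -> (forall n, L1 (v n)) ->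
  L1 g -> L1cvg mu u f -> L1cvg mu v g ->
  L1cvg mu (fun n => mul1 (u n) (v n)) (mul1 f g).
Proof.
move=> Lu Lf Lv Lg uf vg; apply/cvgrPdist_le => e e0.
have [dl dl0 h] := L1_product_continuous mulC Lf Lg e0.
move/cvgrPdist_lt : uf => /(_ dl dl0) uf; move/cvgrPdist_lt : vg => /(_ dl dl0) vg.
apply: filterS2 uf vg => n; rewrite !sub0r !normrN !ger0_norm ?nL1_ge0// => un vn.
have := h _ _ (Lu n) (Lv n).
rewrite (L1_normE (L1B (Lu n) Lf)) (L1_normE (L1B (Lv n) Lg)).
rewrite (L1_normE (L1B (mulL1 (Lu n) (Lv n)) (mulL1 Lf Lg))) !lte_fin.
by move=> /(_ un vn) /ltW.
Qed.

(** Joint continuity transports every identity and every bound from the dense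
    core. *)
Lemma contractive_of_core : contractive_L1_product mul1.
Proof.
split.
- exact: mulL1.
- move=> f f' g g' Lf Lf' Lg Lg' ff' gg'.
  apply: (@L1cvg_unique _ _ _ mu (fun=> mul1 f g) (fun=> mul1 f g) _ _
    (fun=> mulL1 Lf Lg) (mulL1 Lf Lg) (mulL1 Lf' Lg') (fun=> mulL1 Lf Lg)).
  + by move=> _; exact: aeW.
  + exact: L1cvg_cst.
  + apply: L1cvg_mul => //.
      rewrite /L1cvg (_ : (fun n => _) = (fun=> 0)); first exact: cvg_cst.
      apply/funext => _; rewrite /nL1 nL1_ae0//.
        by case: (L1B Lf Lf').
      by apply: filterS ff' => x /= ->; rewrite subrr.
    rewrite /L1cvg (_ : (fun n => _) = (fun=> 0)); first exact: cvg_cst.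
    apply/funext => _; rewrite /nL1 nL1_ae0//.
      by case: (L1B Lg Lg').
    by apply: filterS gg' => x /= ->; rewrite subrr.
- move=> f f' g Lf Lf' Lg.
  have [u Du uf] := core_dense core Lf.
  have [u' Du' uf'] := core_dense core Lf'.
  have [v Dv vg] := core_dense core Lg.
  have Lu n : L1 (u n) by exact: DL1.
  have Lu' n : L1 (u' n) by exact: DL1.
  have Lv n : L1 (v n) by exact: DL1.
  apply: (@L1cvg_unique _ _ _ mu (fun n => mul1 (u n \+ u' n) (v n))
    (fun n => mul1 (u n) (v n) \+ mul1 (u' n) (v n))) => [n||||n||].
  + by apply: mulL1 => //; exact: L1D.
  + by apply: mulL1 => //; exact: L1D.
  + by apply: L1D; exact: mulL1.
  + by move=> n; apply: L1D; exact: mulL1.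
  + have h1 := mul_convP (core_add core (Du n) (Du' n)) (Dv n).
    apply: filterS3 h1 (mul_convP (Du n) (Dv n)) (mul_convP (Du' n) (Dv n)).
    by move=> x /= -> -> ->; rewrite (core_addl core).
  + apply: L1cvg_mul => //; [by move=> n; exact: L1D|exact: L1D|exact: L1cvgD].
  + by apply: L1cvgD; do ?[by move=> n; exact: mulL1|exact: mulL1|exact: L1cvg_mul].
- move=> f g g' Lf Lg Lg'.
  have [u Du uf] := core_dense core Lf.
  have [v Dv vg] := core_dense core Lg.
  have [v' Dv' vg'] := core_dense core Lg'.
  have Lu n : L1 (u n) by exact: DL1.
  have Lv n : L1 (v n) by exact: DL1.
  have Lv' n : L1 (v' n) by exact: DL1.
  apply: (@L1cvg_unique _ _ _ mu (fun n => mul1 (u n) (v n \+ v' n))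
    (fun n => mul1 (u n) (v n) \+ mul1 (u n) (v' n))) => [n||||n||].
  + by apply: mulL1 => //; exact: L1D.
  + by apply: mulL1 => //; exact: L1D.
  + by apply: L1D; exact: mulL1.
  + by move=> n; apply: L1D; exact: mulL1.
  + have h1 := mul_convP (Du n) (core_add core (Dv n) (Dv' n)).
    apply: filterS3 h1 (mul_convP (Du n) (Dv n)) (mul_convP (Du n) (Dv' n)).
    by move=> x /= -> -> ->; rewrite (core_addr core).
  + apply: L1cvg_mul => //; [by move=> n; exact: L1D|exact: L1D|exact: L1cvgD].
  + by apply: L1cvgD; do ?[by move=> n; exact: mulL1|exact: mulL1|exact: L1cvg_mul].
- move=> c f g Lf Lg.
  have [u Du uf] := core_dense core Lf.
  have [v Dv vg] := core_dense core Lg.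
  have Lu n : L1 (u n) by exact: DL1.
  have Lv n : L1 (v n) by exact: DL1.
  apply: (@L1cvg_unique _ _ _ mu (fun n => mul1 (fun x => c * u n x) (v n))
    (fun n x => c * mul1 (u n) (v n) x)) => [n||||n||].
  + by apply: mulL1 => //; exact: L1Z.
  + by apply: mulL1 => //; exact: L1Z.
  + by apply: L1Z; exact: mulL1.
  + by move=> n; apply: L1Z; exact: mulL1.
  + have h1 := mul_convP (core_scale core c (Du n)) (Dv n).
    apply: filterS2 h1 (mul_convP (Du n) (Dv n)).
    by move=> x /= -> ->; rewrite (core_scalel core).
  + apply: L1cvg_mul => //; [by move=> n; exact: L1Z|exact: L1Z|exact: L1cvgZ].
  + by apply: L1cvgZ; do ?[by move=> n; exact: mulL1|exact: mulL1|exact: L1cvg_mul].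
- move=> c f g Lf Lg.
  have [u Du uf] := core_dense core Lf.
  have [v Dv vg] := core_dense core Lg.
  have Lu n : L1 (u n) by exact: DL1.
  have Lv n : L1 (v n) by exact: DL1.
  apply: (@L1cvg_unique _ _ _ mu (fun n => mul1 (u n) (fun x => c * v n x))
    (fun n x => c * mul1 (u n) (v n) x)) => [n||||n||].
  + by apply: mulL1 => //; exact: L1Z.
  + by apply: mulL1 => //; exact: L1Z.
  + by apply: L1Z; exact: mulL1.
  + by move=> n; apply: L1Z; exact: mulL1.
  + have h1 := mul_convP (Du n) (core_scale core c (Dv n)).
    apply: filterS2 h1 (mul_convP (Du n) (Dv n)).
    by move=> x /= -> ->; rewrite (core_scaler core).
  + apply: L1cvg_mul => //; [by move=> n; exact: L1Z|exact: L1Z|exact: L1cvgZ].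
  + by apply: L1cvgZ; do ?[by move=> n; exact: mulL1|exact: mulL1|exact: L1cvg_mul].
- move=> f f' g Lf Lf' Lg.
  have [u Du uf] := core_dense core Lf.
  have [u' Du' uf'] := core_dense core Lf'.
  have [v Dv vg] := core_dense core Lg.
  have Lu n : L1 (u n) by exact: DL1.
  have Lu' n : L1 (u' n) by exact: DL1.
  have Lv n : L1 (v n) by exact: DL1.
  (* along core sequences the inner products are replaced by [conv], which
     stays in the core *)
  have cv1 : L1cvg mu (fun n => conv (u n) (u' n)) (mul1 f f').
    rewrite /L1cvg (_ : (fun n => _) = fun n =>
      nL1 mu (mul1 (u n) (u' n) \- mul1 f f')); first exact: L1cvg_mul.
    apply/funext => n; apply/eqP; rewrite eq_le; apply/andP; split;
      apply: nL1_le; do ?[by apply: L1B; [exact: mulL1|exact: mulL1]|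
        by apply: L1B; [apply: DL1; exact: (core_conv core)|exact: mulL1]];
      by apply: filterS (mul_convP (Du n) (Du' n)) => x /= ->.
  have cv2 : L1cvg mu (fun n => conv (u' n) (v n)) (mul1 f' g).
    rewrite /L1cvg (_ : (fun n => _) = fun n =>
      nL1 mu (mul1 (u' n) (v n) \- mul1 f' g)); first exact: L1cvg_mul.
    apply/funext => n; apply/eqP; rewrite eq_le; apply/andP; split;
      apply: nL1_le; do ?[by apply: L1B; [exact: mulL1|exact: mulL1]|
        by apply: L1B; [apply: DL1; exact: (core_conv core)|exact: mulL1]];
      by apply: filterS (mul_convP (Du' n) (Dv n)) => x /= ->.
  have Lc1 n : L1 (conv (u n) (u' n)) by apply: DL1; exact: (core_conv core).
  have Lc2 n : L1 (conv (u' n) (v n)) by apply: DL1; exact: (core_conv core).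
  apply: (@L1cvg_unique _ _ _ mu (fun n => mul1 (conv (u n) (u' n)) (v n))
    (fun n => mul1 (u n) (conv (u' n) (v n)))) => [n||||n||].
  + exact: mulL1.
  + by apply: mulL1 => //; exact: mulL1.
  + by apply: mulL1 => //; exact: mulL1.
  + by move=> n; exact: mulL1.
  + have h1 := mul_convP (core_conv core (Du n) (Du' n)) (Dv n).
    have h2 := mul_convP (Du n) (core_conv core (Du' n) (Dv n)).
    by apply: filterS2 h1 h2 => x /= -> ->; rewrite (core_assoc core).
  + by apply: L1cvg_mul => //; exact: mulL1.
  + by apply: L1cvg_mul => //; exact: mulL1.
- move=> f g Lf Lg.
  have [u Du uf] := core_dense core Lf.
  have [v Dv vg] := core_dense core Lg.
  have Lu n : L1 (u n) by exact: DL1.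
  have Lv n : L1 (v n) by exact: DL1.
  have c1 := L1cvg_norm (fun n => mulL1 (Lu n) (Lv n)) (mulL1 Lf Lg)
    (L1cvg_mul Lu Lf Lv Lg uf vg).
  have c2 : (fun n => nL1 mu (u n) * nL1 mu (v n)) @ \oo -->
      nL1 mu f * nL1 mu g.
    by apply: cvgM; exact: L1cvg_norm.
  apply: (ler_cvg_to c1 c2); apply: nearW => n /=.
  apply: le_trans (core_norm core (Du n) (Dv n)).
  apply: nL1_le; [exact: mulL1|by apply: DL1; exact: (core_conv core)|].
  by apply: filterS (mul_convP (Du n) (Dv n)) => x ->.
- move=> f g s Lf Lg gs.
  have [u Du uf] := core_dense core Lf.
  have Lu n : L1 (u n) by exact: DL1.
  have key (t : R) : 0 < t -> s <= t ->
      {ae mu, forall x, normc (mul1 f g x) <= nL1 mu f * t}.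
    move=> t0 st.
    have gt : {ae mu, forall x, normc (g x) <= t}.
      by apply: filterS gs => x gx; exact: le_trans st.
    have [v Dv vg] := core_dense_bound core Lg t0 gt.
    have Lv n : L1 (v n) by apply: DL1; case: (Dv n).
    have c1 : (fun n => nL1 mu (u n) * t) @ \oo --> nL1 mu f * t.
      by apply: cvgMr_tmp; exact: L1cvg_norm.
    apply: (L1cvg_bound (fun n => mulL1 (Lu n) (Lv n)) (mulL1 Lf Lg) _ c1).
      move=> n; have [Dvn vt] := Dv n.
      apply: filterS (mul_convP (Du n) Dvn) => x -> /=.
      exact: (core_bound core).
    exact: L1cvg_mul.
  (* [s] may vanish, whence the detour through positive constants *)
  have : {ae mu, forall x, forall n,
      normc (mul1 f g x) <= nL1 mu f * (Num.max s 0 + n.+1%:R^-1)}.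
    apply/ae_foralln => n; apply: key.
      by rewrite ltr_wpDl ?invr_gt0// le_max lexx orbT.
    by rewrite ler_wpDr ?invr_ge0// le_max lexx.
  apply: filterS2 gs => x gx h.
  have s0 : 0 <= s by exact: le_trans (normc_nneg _) gx.
  move: h; rewrite (max_idPl s0) => h.
  apply: (ler_add_invn (nL1_ge0 mu f)) => n.
  by rewrite (le_trans (h n))// mulrDr.
Qed.

End L1_product.

(** * Young functions as limits of sums of hinges *)

Section young_hinges.
Context {R : realType}.
Variable phi : R -> \bar R.
Hypothesis phiY : young_function phi.
Implicit Types x y z h : R.

Let phi_ge0 x : (0 <= phi x)%E. Proof. exact: young_ge0. Qed.

Lemma young_mono x y : 0 <= x -> x <= y -> (phi x <= phi y)%E.
Proof.
move=> x0 xy; have [->//|xny] := eqVneq x y.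
have y0 : 0 < y by rewrite (le_lt_trans x0)// lt_neqAle xny.
have t01 : 0 <= x / y <= 1.
  by rewrite divr_ge0 ?(ltW y0)//= ler_pdivrMr// mul1r.
have := young_convex phiY y 0 t01.
rewrite mulr0 addr0 divfK ?gt_eqF// (young0 phiY) mule0 adde0 => /le_trans; apply.
by rewrite -[leRHS]mul1e lee_wpmul2r// lee_fin; case/andP: t01.
Qed.

Lemma young_fin_le x y : 0 <= x -> x <= y -> (phi y < +oo)%E -> (phi x < +oo)%E.
Proof. by move=> x0 xy; apply: le_lt_trans; exact: young_mono. Qed.

Let p x : R := fine (phi x).

Let pE x : (phi x < +oo)%E -> phi x = (p x)%:E.
Proof. by move=> h; rewrite fineK// ge0_fin_numE. Qed.

Let p_ge0 x : 0 <= p x. Proof. exact: fine_ge0. Qed.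

Lemma young_three_points x y z : 0 <= x -> x < y -> y < z -> (phi z < +oo)%E ->
  p y * (z - x) <= p x * (z - y) + p z * (y - x).
Proof.
move=> x0 xy yz zf; have xz := lt_trans xy yz.
have yf : (phi y < +oo)%E by apply: young_fin_le zf => //; lra.
have xf : (phi x < +oo)%E by apply: young_fin_le zf => //; lra.
have zx0 : 0 < z - x by lra.
have t01 : 0 <= (z - y) / (z - x) <= 1.
  by rewrite divr_ge0 ?ler_pdivrMr ?mul1r//=; lra.
have := young_convex phiY x z t01.
have -> : (z - y) / (z - x) * x + (1 - (z - y) / (z - x)) * z = y.
  by field; rewrite gt_eqF.
rewrite (pE xf) (pE yf) (pE zf) -!EFinM -EFinD lee_fin => h.
rewrite -ler_pdivlMr//; apply: le_trans h _; rewrite le_eqVlt; apply/orP; left.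
by apply/eqP; field; rewrite gt_eqF.
Qed.

(** Inequalities between integrals that hold for every single hinge [(x - t)_+]
    add up to inequalities for these functions. *)
Inductive hinge_sum : (R -> R) -> Prop :=
| hinge0 : hinge_sum (fun=> 0)
| hingeS : forall psi c t, 0 <= c -> 0 < t -> hinge_sum psi ->
    hinge_sum (fun x => psi x + c * Num.max (x - t) 0).

Lemma hinge_sum_mono psi x y : hinge_sum psi -> x <= y -> psi x <= psi y.
Proof.
move=> + xy; elim=> // {}psi c t c0 t0 _ ih.
rewrite lerD// ler_wpM2l// ge_max !le_max lexx orbT andbT lerD2r xy//.
Qed.

Lemma hinge_sum_ge0 psi x : hinge_sum psi -> 0 <= psi x.
Proof.
elim=> // {}psi c t c0 t0 _ ih.
by rewrite addr_ge0// mulr_ge0// le_max lexx orbT.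
Qed.

Lemma hinge_sum_scale psi (l : R) : 0 < l -> hinge_sum psi ->
  hinge_sum (fun x => psi (x / l)).
Proof.
move=> l0; elim=> {psi} [|psi c t c0 t0 _ ih]; first exact: hinge0.
rewrite (_ : (fun x => _) =
    fun x => psi (x / l) + (c / l) * Num.max (x - t * l) 0).
  by apply: hingeS; rewrite ?divr_ge0 ?mulr_gt0// ltW.
apply/funext => x; congr (_ + _); rewrite -[RHS]mulrA; congr (_ * _).
rewrite maxr_pMr ?invr_ge0 ?(ltW l0)// mulr0 mulrBr; congr (Num.max (_ - _) _).
  by rewrite mulrC.
by rewrite mulrC mulfK// gt_eqF.
Qed.

(** Interpolation of [phi] at the grid [h, 2h, ...], shifted to the right by one
    step to make it a minorant: between [n h] and [n h + h] its slope is that of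
    the chord of [phi] over the preceding cell. Cells where [phi] is infinite
    are skipped. *)
Let chord h n := if n is m.+1 then (p (n%:R * h) - p (m%:R * h)) / h else 0.

Fixpoint hinge_grid h n x : R :=
  if n is m.+1 then hinge_grid h m x +
    (if (phi (n%:R * h)%R < +oo)%E then chord h n - chord h m else 0) *
    Num.max (x - n%:R * h) 0
  else 0.

Let chord_mono h n : 0 < h -> (phi (n.+1%:R * h)%R < +oo)%E ->
  chord h n <= chord h n.+1.
Proof.
move=> h0 nf; case: n nf => [|n] nf /=.
  by rewrite mul0r {2}/p (young0 phiY) subr0 divr_ge0 ?p_ge0// ltW.
rewrite ler_pM2r ?invr_gt0//.
have n0 : 0 <= n%:R :> R by [].
have := @young_three_points (n%:R * h) (n.+1%:R * h) (n.+2%:R * h).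
rewrite mulr_ge0 ?(ltW h0)// !ltr_pM2r// !ltr_nat !ltnSn.
move=> /(_ isT isT isT nf); 
have -> : n.+2%:R * h = n%:R * h + 2 * h by rewrite -addn2 natrD; ring.
have -> : n.+1%:R * h = n%:R * h + h by rewrite -natr1; ring.
move: (n%:R * h) => y.
move: (p _) (p _) (p _) => a b c le3.
rewrite -(ler_pM2r h0); nra.
Qed.

Lemma hinge_gridP h n : 0 < h -> hinge_sum (hinge_grid h n).
Proof.
move=> h0; elim: n => [|n ih]; first exact: hinge0.
apply: hingeS => //; last by rewrite mulr_gt0.
by case: ifPn => // nf; rewrite subr_ge0 chord_mono.
Qed.

Lemma hinge_gridE h n x : 0 < h -> (phi (n.+1%:R * h)%R < +oo)%E ->
  n.+1%:R * h <= x ->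
  hinge_grid h n.+1 x = p (n%:R * h) + chord h n.+1 * (x - n.+1%:R * h).
Proof.
move=> h0; elim: n => [|n ih] nf nx.
  have p0 : p (0 * h) = 0 by rewrite mul0r /p (young0 phiY).
  by rewrite /hinge_grid nf p0 /chord /= p0 subr0 !add0r max_l// subr_ge0.
have hn : n.+1%:R * h <= n.+2%:R * h by rewrite ler_pM2r// ler_nat.
have nf' : (phi (n.+1%:R * h)%R < +oo)%E.
  by apply: young_fin_le nf => //; rewrite mulr_ge0// ltW.
have -> : hinge_grid h n.+2 x = hinge_grid h n.+1 x +
    (chord h n.+2 - chord h n.+1) * Num.max (x - n.+2%:R * h) 0.
  by rewrite [LHS]/= nf.
rewrite ih//; last exact: le_trans nx.
rewrite max_l ?subr_ge0//.
have -> : x - n.+1%:R * h = x - n.+2%:R * h + h.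
  by rewrite -[n.+2]addn1 natrD; ring.
have : chord h n.+1 * h = p (n.+1%:R * h) - p (n%:R * h).
  by rewrite /= divfK// gt_eqF.
move: (chord h n.+1) (chord h n.+2) => a b e.
rewrite mulrDr e => {e}; ring.
Qed.

Lemma hinge_grid_le h n x : 0 < h -> 0 <= x -> ((hinge_grid h n x)%:E <= phi x)%E.
Proof.
move=> h0 x0; elim: n => [|n ih]; first by rewrite phi_ge0.
have [nf|nf] := ltP (phi (n.+1%:R * h)%R) +oo%E; last first.
  by rewrite /= ltNge nf /= mul0r addr0.
have [xn|nx] := leP x (n.+1%:R * h).
  by rewrite /= (max_r (_ : _ <= 0)) ?subr_le0// mulr0 addr0.
rewrite hinge_gridE//; last exact: ltW.
have [xf|] := ltP (phi x) +oo%E; last by rewrite leye_eq => /eqP ->; rewrite leey.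
rewrite pE// lee_fin.
have := @young_three_points (n%:R * h) (n.+1%:R * h) x.
rewrite mulr_ge0 ?(ltW h0)// ltr_pM2r// ltr_nat ltnSn nx.
move=> /(_ isT isT isT xf).
have -> : n.+1%:R * h - n%:R * h = h by rewrite -natr1; ring.
have mon : p (n%:R * h) <= p (n.+1%:R * h).
  rewrite -lee_fin -!pE//.
    by apply: young_mono; rewrite ?mulr_ge0 ?ler_pM2r ?ler_nat// ltW.
  apply: young_fin_le nf; by rewrite ?mulr_ge0 ?ler_pM2r ?ler_nat// ltW.
have hE : n%:R * h = n.+1%:R * h - h by rewrite -natr1; ring.
move: mon; rewrite /= hE; move: (n.+1%:R * h) nx => y yx.
move: (p _) (p _) (p _) => a b c ba le3.
rewrite -(ler_pM2r h0) mulrDl mulrAC divfK ?gt_eqF//.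
nra.
Qed.

(** The two steps lost in [y - 2 * h] are one for the shift of the grid and one
    for rounding [y] down to a grid point; left continuity absorbs them as [h]
    tends to [0]. *)
Lemma hinge_grid_ge h n x y : 0 < h -> y <= x -> 2 * h <= y -> y <= n%:R * h ->
  (phi y < +oo)%E -> (phi (y - 2 * h)%R <= (hinge_grid h n x)%:E)%E.
Proof.
move=> h0 yx hy yn yf.
pose j := Num.truncn (y / h).
have y0 : 0 <= y by rewrite (le_trans _ hy)// mulr_ge0// ltW.
have jy : j%:R * h <= y.
  by rewrite -ler_pdivlMr// truncn_le// divr_ge0// ltW.
have yj : y < j.+1%:R * h by rewrite -ltr_pdivrMr// truncnS_gt.
have jn : (j <= n)%N.
  by have := le_trans jy yn; rewrite ler_pM2r// ler_nat.
have grow m k : (hinge_grid h m x <= hinge_grid h (k + m) x).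
  elim: k => // k ih; rewrite addSn /= (le_trans ih)// lerDl mulr_ge0//.
    by case: ifPn => // kf; rewrite subr_ge0 chord_mono.
  by rewrite le_max lexx orbT.
have [i ji] : exists i, j = i.+1.
  case: j {jy jn} yj => [|i _]; last by exists i.
  by rewrite mul1r => yh; exfalso; lra.
have jf : (phi (j%:R * h)%R < +oo)%E.
  by apply: young_fin_le yf => //; rewrite mulr_ge0// ltW.
apply: (@le_trans _ _ (hinge_grid h j (j%:R * h))%:E); last first.
  rewrite lee_fin -(subnK jn) (le_trans _ (grow _ _))//.
  by apply: hinge_sum_mono; [exact: hinge_gridP|exact: le_trans yx].
rewrite ji hinge_gridE//; last by rewrite -ji.
rewrite subrr mulr0 addr0 -pE; last first.
  apply: young_fin_le jf; first by rewrite mulr_ge0// ltW.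
  by rewrite ji ler_pM2r// ler_nat.
apply: young_mono; first by rewrite subr_ge0.
move: yj; rewrite ji -!natr1 => yj; rewrite lerBlDr; nra.
Qed.

(** If [phi] jumped to [+oo] to the right of a point [b], then by evenness it
    would jump to the left of [- b], against left continuity there. *)
Lemma young_finite_value (a : R) x : 0 <= x -> (a%:E < phi x)%E ->
  exists y, [/\ 0 <= y, y <= x, (a%:E < phi y)%E & (phi y < +oo)%E].
Proof.
move=> x0 ax; have [xf|xoo] := ltP (phi x) +oo%E; first by exists x.
move: xoo; rewrite leye_eq => /eqP xoo.
have [a0|a0] := ltP a 0.
  by exists 0; rewrite (young0 phiY) lexx x0 lte_fin a0 ltry.
apply: contrapT => no.
pose S := [set y | 0 <= y /\ (phi y <= a%:E)%E].
have S0 : S 0 by split=> //; rewrite (young0 phiY) lee_fin.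
have ubx : ubound S x.
  move=> y [y0 ya]; rewrite leNgt; apply/negP => /ltW /(young_mono x0).
  by rewrite xoo leye_eq => /eqP yoo; move: ya; rewrite yoo leye_eq.
have hS : has_sup S by split; [exists 0|exists x].
set b := sup S.
have b0 : 0 <= b by apply: ub_le_sup => //; exists x.
have Sb z : 0 <= z -> z < b -> (phi z <= a%:E)%E.
  move=> z0 zb; have [|y [y0 ya] zy] := @sup_adherent _ S (b - z) _ hS.
    by rewrite subr_gt0.
  apply: le_trans ya; apply: young_mono => //.
  by move: zy; rewrite subKr => /ltW.
have bx : b <= x by apply: ge_sup => //; exists 0.
have oo z : b < z -> z <= x -> phi z = +oo%E.
  move=> bz zx; apply/eqP; rewrite -leye_eq leNgt; apply/negP => zf.
  apply: no; exists z; split=> //; first by rewrite (le_trans b0)// ltW.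
  rewrite ltNge; apply/negP => za.
  have : z <= b by apply: ub_le_sup; [exists x|split=> //; rewrite (le_trans b0)// ltW].
  by rewrite leNgt bz.
have oo' z : b < z -> phi z = +oo%E.
  move=> bz; have [/oo->//|xz] := leP z x.
  by apply/eqP; rewrite -leye_eq -xoo young_mono// ltW.
have booN : phi (- b) = +oo%E.
  have h : phi z @[z --> (- b)^'-] --> +oo%E.
    apply: cvg_near_cst; near=> z.
    rewrite -(young_even phiY z) oo'// ltrNr.
    by near: z; exact: nbhs_left_lt.
  exact: (cvg_unique (@ereal_hausdorff R)
    (@young_left_continuous _ _ phiY (- b)) h).
have boo : phi b = +oo%E by rewrite -(young_even phiY).
have ba : (phi b <= a%:E)%E.
  have [bE|bn0] := eqVneq b 0; first by rewrite bE (young0 phiY) lee_fin.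
  have bp : 0 < b by rewrite lt_neqAle eq_sym bn0.
  apply: (@cvge_to_le _ _ _ _ (fun z => phi z) _ _ (@young_left_continuous _ _ phiY b)).
  near=> z; apply: Sb; last by near: z; exact: nbhs_left_lt.
  by near: z; exact: nbhs_left_ge.
by move: ba; rewrite boo leye_eq.
Unshelve. all: by end_near. Qed.

(** Mesh [1 / (n + 1)] on the interval from [0] to [n + 1]. *)
Definition hinge_approx n : R -> R := hinge_grid n.+1%:R^-1 (n.+1 * n.+1).

Lemma hinge_approxP n : hinge_sum (hinge_approx n).
Proof. by apply: hinge_gridP; rewrite invr_gt0. Qed.

Lemma hinge_approx_le n x : 0 <= x -> ((hinge_approx n x)%:E <= phi x)%E.
Proof. by move=> x0; apply: hinge_grid_le => //; rewrite invr_gt0. Qed.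

Lemma hinge_approx_cvg x : 0 <= x -> (hinge_approx n x)%:E @[n --> \oo] --> phi x.
Proof.
move=> x0.
have lb (a : R) : (a%:E < phi x)%E -> \forall n \near \oo, a <= hinge_approx n x.
  move=> /(young_finite_value x0)[y [y0 yx ay yf]].
  have [yE|yn0] := eqVneq y 0.
    apply: nearW => n; move: ay; rewrite yE (young0 phiY) lte_fin => /ltW a0.
    exact: le_trans (hinge_sum_ge0 x (hinge_approxP n)).
  have yp : 0 < y by rewrite lt_neqAle eq_sym yn0.
  have := @young_left_continuous _ _ phiY y _ (open_ereal_gt' ay).
  move=> [d /= d0 hd].
  exists (Num.truncn (2 / d + 2 / y + y)) => // n /= Nn.
  have big : 2 / d + 2 / y + y < n.+1%:R.
    by rewrite (lt_le_trans (truncnS_gt _))// ler_nat ltnS.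
  have d20 : 0 < 2 / d by rewrite divr_gt0.
  have y20 : 0 < 2 / y by rewrite divr_gt0.
  have n0 : 0 < n.+1%:R^-1 :> R by rewrite invr_gt0.
  have small (e : R) : 0 < e -> 2 / e < n.+1%:R -> 2 * n.+1%:R^-1 < e.
    by move=> e0 en; rewrite ltr_pdivrMr// mulrC -ltr_pdivrMr.
  have nd : 2 * n.+1%:R^-1 < d by apply: small => //; lra.
  have ny : 2 * n.+1%:R^-1 < y by apply: small => //; lra.
  have yn : y <= (n.+1 * n.+1)%:R * n.+1%:R^-1.
    by rewrite natrM mulfK ?pnatr_eq0//; lra.
  rewrite -lee_fin; apply: le_trans (hinge_grid_ge n0 yx (ltW ny) yn yf).
  apply/ltW/hd; last by rewrite ltrBlDr ltrDl mulr_gt0.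
  by rewrite /ball_/= subKr ger0_norm// mulr_ge0// ltW.
have [xf|] := ltP (phi x) +oo%E; last first.
  rewrite leye_eq => /eqP xoo; rewrite xoo; apply/cvgeyPge => a.
  have /lb : (a%:E < phi x)%E by rewrite xoo ltry.
  by apply: filterS => n; rewrite lee_fin.
rewrite (pE xf); apply: cvg_EFin; first exact: nearW.
apply/cvgrPdist_le => e e0.
have /lb : ((p x - e)%:E < phi x)%E by rewrite (pE xf) lte_fin ltrBlDr ltrDl.
apply: filterS => n /= h.
have := hinge_approx_le n x0; rewrite (pE xf) lee_fin => h2.
by rewrite ger0_norm ?subr_ge0// lerBlDr addrC -lerBlDr.
Qed.

Lemma measurable_hinge_sum {d} {T : measurableType d} psi (u : T -> R) : hinge_sum psi ->
  measurable_fun setT u ->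
  measurable_fun setT (fun x : T => (psi (u x))%:E : \bar R).
Proof.
move=> + mu; elim=> {psi} [|psi c t c0 t0 _ ih]; first exact: measurable_cst.
under eq_fun do rewrite EFinD; apply: emeasurable_funD => //.
apply/measurable_EFinP/measurable_funM => //.
by apply: measurable_maxr => //; exact: measurable_funB.
Qed.

End young_hinges.

(** * The action of [L^1] on functions that are integrable up to small errors *)

Section clip.
Context {R : realType}.
Implicit Types (t : R) (z : R[i]).

(** Radial retraction of the complex plane onto the disc of radius [t]. *)
Definition clip t z : R[i] := (t / Num.max (normc z) t)%:C%C * z.

Lemma normc_clip t z : 0 < t -> normc (clip t z) <= t.
Proof.
move=> t0; have m0 : 0 < Num.max (normc z) t by rewrite lt_max t0 orbT.
rewrite normcM normc_real ger0_norm ?divr_ge0 ?(ltW t0) ?(ltW m0)//.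
by rewrite mulrAC ler_pdivrMr// ler_pM2l// le_max lexx.
Qed.

Lemma normc_sub_clip t z : 0 < t -> normc (z - clip t z) = Num.max (normc z - t) 0.
Proof.
move=> t0; have m0 : 0 < Num.max (normc z) t by rewrite lt_max t0 orbT.
have -> : z - clip t z = (1 - t / Num.max (normc z) t)%:C%C * z.
  by rewrite /clip rmorphB /= mulrBl mul1r.
rewrite normcM normc_real ger0_norm; last first.
  by rewrite subr_ge0 ler_pdivrMr// mul1r le_max lexx orbT.
have [zt|tz] := leP (normc z) t.
  by rewrite divff ?gt_eqF// subrr mul0r max_r// subr_le0.
rewrite max_l ?subr_ge0 ?(ltW tz)// mulrBl mul1r divfK// gt_eqF//.
exact: lt_trans tz.
Qed.

Lemma continuous_clip_factor t : 0 < t ->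
  continuous (fun y : R => t / Num.max y t).
Proof.
move=> t0 y; apply: cvgMl_tmp; apply: cvgV.
  by rewrite gt_eqF// lt_max t0 orbT.
by apply: (@continuous_max R R id (cst t)) => //; exact: cvg_cst.
Qed.

Lemma cmeasurable_clip {d} {T : measurableType d} t (f : T -> R[i]) : 0 < t ->
  cmeasurable f -> cmeasurable (fun x => clip t (f x)).
Proof.
move=> t0 mf; apply: cmeasurableM => //; apply: cmeasurable_real.
apply: (measurableT_comp (f := fun y : R => t / Num.max y t)).
  by apply: continuous_measurable_fun; exact: continuous_clip_factor.
exact: measurable_normc.
Qed.

End clip.

Section action.
Context {R : realType} {d} {T : measurableType d}.
Variables (mu : {measure set T -> \bar R}).
Local Notation L1 := (L1_space mu).
Local Notation binop := ((T -> R[i]) -> (T -> R[i]) -> (T -> R[i])).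
Implicit Types (f g u v : T -> R[i]) (c : R[i]) (s : R).

(** The closure of [L^1] in [L^1 + L^oo] for the uniform distance. It contains
    the Orlicz space ([orlicz_small]) and the action maps it into itself
    ([is_action_small]), so that products can be iterated. *)
Definition L1_up_to_small : set (T -> R[i]) :=
  [set g | cmeasurable g /\ forall s, 0 < s -> exists2 g1, L1 g1 &
    {ae mu, forall x, normc (g x - g1 x) <= s}].

Local Notation M := L1_up_to_small.

Lemma L1_sub_small g : L1 g -> M g.
Proof.
move=> Lg; split; first by case: Lg.
move=> s s0; exists g => //; apply: aeW => x.
by rewrite subrr normc0 ltW.
Qed.

Lemma small_add g g' : M g -> M g' -> M (g \+ g').
Proof.
move=> [mg hg] [mg' hg']; split; first exact: cmeasurableD.
move=> s s0; have s20 : 0 < s / 2 by rewrite divr_gt0.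
have [g1 Lg1 gg1] := hg _ s20; have [g1' Lg1' gg1'] := hg' _ s20.
exists (g1 \+ g1'); first exact: L1D.
apply: filterS2 gg1 gg1' => x h h' /=.
by rewrite opprD addrACA (splitr s) (le_trans (ler_normcD _ _))// lerD.
Qed.

Lemma small_scale c g : M g -> M (fun x => c * g x).
Proof.
move=> [mg hg]; split; first exact: cmeasurableZ.
move=> s s0; have c0 : 0 < normc c + 1 by rewrite ltr_wpDl// normc_nneg.
have [|g1 Lg1 gg1] := hg (s / (normc c + 1)); first by rewrite divr_gt0.
exists (fun x => c * g1 x); first exact: L1Z.
apply: filterS gg1 => x h; rewrite -mulrBr normcM.
rewrite (le_trans (ler_wpM2l (normc_nneg c) h))// mulrA ler_pdivrMr//.
by rewrite mulrC ler_pM2l// lerDl.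
Qed.

Lemma ae_eq_small u v (b : R) : 0 <= b ->
  (forall s, 0 < s -> {ae mu, forall x, normc (u x - v x) <= b * s}) ->
  {ae mu, forall x, u x = v x}.
Proof.
move=> b0 h.
have : {ae mu, forall x, forall n, normc (u x - v x) <= 0 + b * n.+1%:R^-1}.
  by apply/ae_foralln => n; rewrite add0r; apply: h; rewrite invr_gt0.
apply: filterS => x /(ler_add_invn b0) h0; apply/eqP; rewrite -subr_eq0.
by apply/eqP/normc_eq0P/eqP; rewrite eq_le h0 normc_nneg.
Qed.

Variable mul1 : binop.
Hypothesis cp : contractive_L1_product mu mul1.

Let mulL1 f g : L1 f -> L1 g -> L1 (mul1 f g).
Proof. exact: (cp_closed cp). Qed.

Lemma mul1_dist f g g' s : L1 f -> L1 g -> L1 g' ->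
  {ae mu, forall x, normc (g x - g' x) <= s} ->
  {ae mu, forall x, normc (mul1 f g x - mul1 f g' x) <= nL1 mu f * s}.
Proof.
move=> Lf Lg Lg' gg'.
have Ln : L1 (fun x => -1 * g' x) by exact: L1Z.
have Ld : L1 (g \+ (fun x => -1 * g' x)) by exact: L1D.
have gs : {ae mu, forall x, normc ((g \+ (fun x => -1 * g' x)) x) <= s}.
  by apply: filterS gg' => x; rewrite /= mulN1r.
have h1 := cp_bound cp Lf Ld gs.
have h2 := cp_addr cp Lf Lg Ln.
have h3 := cp_scaler cp (-1) Lf Lg'.
by apply: filterS3 h1 h2 h3 => x h1x h2x h3x; move: h1x; rewrite h2x h3x mulN1r.
Qed.

(** [u] is the action of [f] on [g]: every way to write [g] as an integrable
    function plus an error of size at most [s] computes [u] up to [|f| s], as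
    it must if the sup bound is to persist. *)
Definition is_action f g u := cmeasurable u /\
  forall s g1, L1 g1 -> {ae mu, forall x, normc (g x - g1 x) <= s} ->
    {ae mu, forall x, normc (u x - mul1 f g1 x) <= nL1 mu f * s}.

Lemma is_action_mul1 f g u : L1 f -> L1 g -> is_action f g u ->
  {ae mu, forall x, u x = mul1 f g x}.
Proof.
move=> Lf Lg [_ h].
have /h : {ae mu, forall x, normc (g x - g x) <= 0}.
  by apply: aeW => x; rewrite subrr normc0.
move=> /(_ Lg); apply: filterS => x; rewrite mulr0 => h0.
apply/eqP; rewrite -subr_eq0.
by apply/eqP/normc_eq0P/eqP; rewrite eq_le h0 normc_nneg.
Qed.

Lemma is_action_small f g u : L1 f -> M g -> is_action f g u -> M u.
Proof.
move=> Lf [mg hg] [mu' hu]; split=> // s s0.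
have f0 : 0 < nL1 mu f + 1 by rewrite ltr_wpDl// nL1_ge0.
have [|g1 Lg1 gg1] := hg (s / (nL1 mu f + 1)); first by rewrite divr_gt0.
exists (mul1 f g1); first exact: mulL1.
apply: filterS (hu _ _ Lg1 gg1) => x /le_trans; apply.
by rewrite mulrA ler_pdivrMr// mulrC ler_pM2l// lerDl.
Qed.

Lemma cauchy_limit (a : nat -> R) (b : R) : 0 <= b ->
  (forall n k, `|a n - a k| <= b * n.+1%:R^-1 + b * k.+1%:R^-1) ->
  exists2 l : R, a @ \oo --> l & forall n, `|l - a n| <= b * n.+1%:R^-1.
Proof.
move=> b0 ab.
have cv : cvgn a.
  apply/cauchy_cvgP/cauchyP => e e0.
  pose N := Num.truncn (b / (e / 2)).
  exists (a N); exists N => // k /= Nk.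
  have small j : (N <= j)%N -> b * j.+1%:R^-1 < e / 2.
    move=> Nj; rewrite ltr_pdivrMr// mulrC -ltr_pdivrMr ?divr_gt0//.
    by rewrite (lt_le_trans (truncnS_gt _))// ler_nat.
  by rewrite /ball/= (le_lt_trans (ab _ _))// (splitr e) ltrD// small.
exists (lim (a @ \oo)) => // n.
have c1 : `|lim (a @ \oo) - a n| <= b * n.+1%:R^-1 + 0.
  have h1 : `|a k - a n| @[k --> \oo] --> `|lim (a @ \oo) - a n|.
    by apply: cvg_norm; apply: cvgB => //; exact: cvg_cst.
  have h2 : (b * n.+1%:R^-1 + b * k.+1%:R^-1) @[k --> \oo] -->
      b * n.+1%:R^-1 + 0.
    apply: cvgD; first exact: cvg_cst.
    rewrite -[X in _ --> X](mulr0 b); apply: cvgMl_tmp.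
    exact: cvg_harmonic.
  apply: (ler_cvg_to h1 h2); apply: nearW => k.
  by rewrite (le_trans (ab _ _))// addrC.
by rewrite addr0 in c1.
Qed.

(** The sup bound makes [n |-> mul1 f (g_ n)] uniformly Cauchy off a null set
    when [g_ n] is integrable and uniformly [1 / (n + 1)]-close to [g]. *)
Lemma is_action_exists f g : L1 f -> M g -> exists u, is_action f g u.
Proof.
move=> Lf [mg hg].
have /choice[g_ hg_] : forall n : nat, exists g1, L1 g1 /\
    {ae mu, forall x, normc (g x - g1 x) <= n.+1%:R^-1}.
  by move=> n; have [|g1 Lg1 gg1] := hg (n.+1%:R^-1); [rewrite invr_gt0|exists g1].
have Lg_ n : L1 (g_ n) by case: (hg_ n).
pose h n := mul1 f (g_ n); have Lh n : L1 (h n) by exact: mulL1.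
set b := nL1 mu f; have b0 : 0 <= b by exact: nL1_ge0.
have hae : {ae mu, forall x, forall n k,
    normc (h n x - h k x) <= b * n.+1%:R^-1 + b * k.+1%:R^-1}.
  apply/ae_foralln => n; apply/ae_foralln => k; rewrite -mulrDr.
  apply: mul1_dist => //.
  have [_ h1] := hg_ n; have [_ h2] := hg_ k; apply: filterS2 h1 h2 => x h1 h2.
  rewrite -(subrK (g x) (g_ n x)) -addrA (le_trans (ler_normcD _ _))//.
  by rewrite lerD// normc_distC.
have [N [mN N0 hN]] := hae.
pose h' n x := (\1_(~` N) x : R)%:C%C * h n x.
have mh' n : cmeasurable (h' n).
  apply: cmeasurableM; last by case: (Lh n).
  by apply: cmeasurable_real; apply: measurable_indic; exact: measurableC.
have h'E n x : ~ N x -> h' n x = h n x.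
  by move=> Nx; rewrite /h' indicE mem_set// mul1r.
have h'C x n k : normc (h' n x - h' k x) <= b * n.+1%:R^-1 + b * k.+1%:R^-1.
  have [Nx|Nx] := pselect (N x).
    rewrite /h' indicE memNset; last by move=> /(_ Nx).
    by rewrite !mul0r subrr normc0 addr_ge0// mulr_ge0.
  by rewrite !h'E//; have := contra_not (hN x) Nx => /contrapT; apply.
have /choice[r hr] : forall x, exists l : R,
    (fun n => complex.Re (h' n x)) @ \oo --> l /\
    forall n, `|l - complex.Re (h' n x)| <= b * n.+1%:R^-1.
  move=> x; have [|l l1 l2] :=
    @cauchy_limit (fun n => complex.Re (h' n x)) b b0; last by exists l.
  move=> n k; rewrite -cReN -cReD (le_trans (ler_Re_normc _))//.
have /choice[i hi] : forall x, exists l : R,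
    (fun n => complex.Im (h' n x)) @ \oo --> l /\
    forall n, `|l - complex.Im (h' n x)| <= b * n.+1%:R^-1.
  move=> x; have [|l l1 l2] :=
    @cauchy_limit (fun n => complex.Im (h' n x)) b b0; last by exists l.
  move=> n k; rewrite -cImN -cImD (le_trans (ler_Im_normc _))//.
exists (fun x => (r x +i* i x)%C); split.
  split.
    apply: (@measurable_fun_cvg _ _ _ setT (fun n x => complex.Re (h' n x))).
      by move=> n; case: (mh' n).
    by move=> x _; case: (hr x).
  apply: (@measurable_fun_cvg _ _ _ setT (fun n x => complex.Im (h' n x))).
    by move=> n; case: (mh' n).
  by move=> x _; case: (hi x).
move=> s g1 Lg1 gg1.
have aeN : {ae mu, forall x, ~ N x}.
  by exists N; split => // x /= /contrapT.
have : {ae mu, forall x, forall n,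
    normc (h n x - mul1 f g1 x) <= b * (n.+1%:R^-1 + s)}.
  apply/ae_foralln => n; apply: mul1_dist => //.
  have [_ h1] := hg_ n; apply: filterS2 h1 gg1 => x h1 h2.
  rewrite -(subrK (g x) (g_ n x)) -addrA (le_trans (ler_normcD _ _))//.
  by rewrite lerD// normc_distC.
apply: filterS2 aeN => x Nx hx.
have b30 : 0 <= 3 * b by rewrite mulr_ge0.
apply: (ler_add_invn b30) => n.
rewrite -[_ - _](subrKA (h n x)) (le_trans (ler_normcD _ _))//.
have := hx n; have [_ /(_ n)] := hr x; have [_ /(_ n)] := hi x; rewrite h'E//.
have := normc_le_ReIm ((r x +i* i x)%C - h n x).
rewrite cReD cImD cReN cImN /= -/b mulrDr -mulrA.
move: (normc _) (normc _) (b * s) (b * _) => *; lra.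
Qed.


Definition L1_action f g : T -> R[i] := xget (fun=> 0) [set u | is_action f g u].

Lemma L1_actionP f g : L1 f -> M g -> is_action f g (L1_action f g).
Proof.
move=> Lf Mg; have [u fgu] := is_action_exists Lf Mg.
by rewrite /L1_action; case: xgetP => // /(_ u).
Qed.

Local Notation act := L1_action.

Lemma L1_action_near f g g1 s : L1 f -> M g -> L1 g1 ->
  {ae mu, forall x, normc (g x - g1 x) <= s} ->
  {ae mu, forall x, normc (act f g x - mul1 f g1 x) <= nL1 mu f * s}.
Proof. by move=> Lf Mg; have [_ h] := L1_actionP Lf Mg; exact: h. Qed.

Lemma L1_actionE f g : L1 f -> L1 g -> {ae mu, forall x, act f g x = mul1 f g x}.
Proof.
by move=> Lf Lg; apply: is_action_mul1 => //; apply/L1_actionP/L1_sub_small.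
Qed.

Lemma L1_action_small f g : L1 f -> M g -> M (act f g).
Proof. by move=> Lf Mg; apply: (is_action_small Lf Mg); exact: L1_actionP. Qed.

Lemma L1_action_ae f f' g g' : L1 f -> L1 f' -> M g -> M g' ->
  {ae mu, forall x, f x = f' x} -> {ae mu, forall x, g x = g' x} ->
  {ae mu, forall x, act f g x = act f' g' x}.
Proof.
move=> Lf Lf' Mg Mg' ff' gg'.
apply: (@ae_eq_small _ _ (nL1 mu f + nL1 mu f')); first by rewrite addr_ge0 ?nL1_ge0.
move=> s s0; have [_ /(_ s s0)[g1 Lg1 gg1]] := Mg.
have g'g1 : {ae mu, forall x, normc (g' x - g1 x) <= s}.
  by apply: filterS2 gg' gg1 => x <-.
have g11 : {ae mu, forall x, g1 x = g1 x} by exact: aeW.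
apply: filterS3 (L1_action_near Lf Mg Lg1 gg1) (L1_action_near Lf' Mg' Lg1 g'g1)
  (cp_ae cp Lf Lf' Lg1 Lg1 ff' g11) => x h1 h2 h3.
rewrite -[_ - _](subrKA (mul1 f g1 x)) (le_trans (ler_normcD _ _))// mulrDl.
by rewrite lerD// normc_distC h3.
Qed.

Lemma L1_action_addl f f' g : L1 f -> L1 f' -> M g ->
  {ae mu, forall x, act (f \+ f') g x = act f g x + act f' g x}.
Proof.
move=> Lf Lf' Mg; have LD := L1D Lf Lf'.
apply: (@ae_eq_small _ _ (nL1 mu (f \+ f') + (nL1 mu f + nL1 mu f'))).
  by rewrite !addr_ge0 ?nL1_ge0.
move=> s s0; have [_ /(_ s s0)[g1 Lg1 gg1]] := Mg.
have h1 := L1_action_near LD Mg Lg1 gg1.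
have h2 := L1_action_near Lf Mg Lg1 gg1.
have h3 := L1_action_near Lf' Mg Lg1 gg1.
apply: filterS3 h1 (cp_addl cp Lf Lf' Lg1) (filterI h2 h3) => x h1x e [h2x h3x].
rewrite -[_ - _](subrKA (mul1 (f \+ f') g1 x)) (le_trans (ler_normcD _ _))// mulrDl.
rewrite lerD// normc_distC e opprD addrACA (le_trans (ler_normcD _ _))// mulrDl.
by rewrite lerD// normc_distC.
Qed.

Lemma L1_action_addr f g g' : L1 f -> M g -> M g' ->
  {ae mu, forall x, act f (g \+ g') x = act f g x + act f g' x}.
Proof.
move=> Lf Mg Mg'.
apply: (@ae_eq_small _ _ (4 * nL1 mu f)); first by rewrite mulr_ge0 ?nL1_ge0.
move=> s s0; have [_ /(_ s s0)[g1 Lg1 gg1]] := Mg.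
have [_ /(_ s s0)[g1' Lg1' gg1']] := Mg'.
have hh : {ae mu, forall x, normc ((g \+ g') x - (g1 \+ g1') x) <= 2 * s}.
  apply: filterS2 gg1 gg1' => x h h' /=.
  rewrite opprD addrACA (le_trans (ler_normcD _ _))//.
  by rewrite mulr_natl mulr2n lerD.
have h1 := L1_action_near Lf (small_add Mg Mg') (L1D Lg1 Lg1') hh.
have h2 := L1_action_near Lf Mg Lg1 gg1.
have h3 := L1_action_near Lf Mg' Lg1' gg1'.
apply: filterS3 h1 (cp_addr cp Lf Lg1 Lg1') (filterI h2 h3) => x h1x e [h2x h3x].
have -> : 4 * nL1 mu f * s = nL1 mu f * (2 * s) + (nL1 mu f * s + nL1 mu f * s).
  by ring.
rewrite -[_ - _](subrKA (mul1 f (g1 \+ g1') x)) (le_trans (ler_normcD _ _))//.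
rewrite lerD// normc_distC e opprD addrACA (le_trans (ler_normcD _ _))//.
by rewrite lerD// normc_distC.
Qed.

Lemma L1_action_scalel c f g : L1 f -> M g ->
  {ae mu, forall x, act (fun y => c * f y) g x = c * act f g x}.
Proof.
move=> Lf Mg; have Lcf := L1Z c Lf.
apply: (@ae_eq_small _ _ (nL1 mu (fun y => c * f y) + normc c * nL1 mu f)).
  by rewrite addr_ge0 ?mulr_ge0 ?normc_nneg ?nL1_ge0.
move=> s s0; have [_ /(_ s s0)[g1 Lg1 gg1]] := Mg.
apply: filterS3 (L1_action_near Lcf Mg Lg1 gg1) (L1_action_near Lf Mg Lg1 gg1)
  (cp_scalel cp c Lf Lg1) => x h1 h2 e.
rewrite -[_ - _](subrKA (mul1 (fun y => c * f y) g1 x)).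
rewrite (le_trans (ler_normcD _ _))// mulrDl lerD//.
by rewrite e -mulrBr normcM -mulrA ler_wpM2l ?normc_nneg// normc_distC.
Qed.

Lemma L1_action_scaler c f g : L1 f -> M g ->
  {ae mu, forall x, act f (fun y => c * g y) x = c * act f g x}.
Proof.
move=> Lf Mg.
apply: (@ae_eq_small _ _ (normc c * nL1 mu f + normc c * nL1 mu f)).
  by rewrite addr_ge0 ?mulr_ge0 ?normc_nneg ?nL1_ge0.
move=> s s0; have [_ /(_ s s0)[g1 Lg1 gg1]] := Mg.
have hh : {ae mu, forall x, normc (c * g x - c * g1 x) <= normc c * s}.
  by apply: filterS gg1 => x h; rewrite -mulrBr normcM ler_wpM2l ?normc_nneg.
apply: filterS3 (L1_action_near Lf (small_scale c Mg) (L1Z c Lg1) hh)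
  (L1_action_near Lf Mg Lg1 gg1) (cp_scaler cp c Lf Lg1) => x h1 h2 e.
rewrite -[_ - _](subrKA (mul1 f (fun y => c * g1 y) x)).
rewrite (le_trans (ler_normcD _ _))// mulrDl lerD//.
  by rewrite (le_trans h1)// mulrCA mulrA.
by rewrite e -mulrBr normcM -mulrA ler_wpM2l ?normc_nneg// normc_distC.
Qed.

Lemma L1_action_assoc f f' g : L1 f -> L1 f' -> M g ->
  {ae mu, forall x, act (mul1 f f') g x = act f (act f' g) x}.
Proof.
move=> Lf Lf' Mg; have Lff' := mulL1 Lf Lf'.
apply: (@ae_eq_small _ _ (nL1 mu (mul1 f f') + nL1 mu f * nL1 mu f')).
  by rewrite addr_ge0 ?mulr_ge0 ?nL1_ge0.
move=> s s0; have [_ /(_ s s0)[g1 Lg1 gg1]] := Mg.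
have h := L1_action_near Lf' Mg Lg1 gg1.
apply: filterS3 (L1_action_near Lff' Mg Lg1 gg1)
  (L1_action_near Lf (L1_action_small Lf' Mg) (mulL1 Lf' Lg1) h)
  (cp_assoc cp Lf Lf' Lg1) => x h1 h2 e.
rewrite -[_ - _](subrKA (mul1 (mul1 f f') g1 x)).
rewrite (le_trans (ler_normcD _ _))// mulrDl lerD//.
by rewrite e normc_distC -mulrA.
Qed.

(** Calderon's interpolation: the action contracts [L^1] and is bounded on
    [L^oo]. Splitting [g] as [g - clip t g] plus [clip t g], the second part
    contributes at most [k t] pointwise. *)
Lemma L1_action_hinge f g (k t : R) : L1 f -> M g -> 0 < k -> nL1 mu f <= k ->
  0 < t ->
  (\int[mu]_x (Num.max (normc (act f g x) - k * t) 0)%:E <=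
   k%:E * \int[mu]_x (Num.max (normc (g x) - t) 0)%:E)%E.
Proof.
move=> Lf Mg k0 fk t0; have mg : cmeasurable g by case: Mg.
pose g1 x := g x - clip t (g x).
have mg1 : cmeasurable g1 by apply: cmeasurableB => //; exact: cmeasurable_clip.
have g1E : L1_norm mu g1 = (\int[mu]_x (Num.max (normc (g x) - t) 0)%:E)%E.
  by apply: eq_integral => x _; rewrite normc_sub_clip.
have [fin|] := ltP (L1_norm mu g1) +oo%E; last first.
  by rewrite g1E leye_eq => /eqP ->; rewrite mulry gtr0_sg// mul1e leey.
have Lg1 : L1 g1 by [].
have gg1 : {ae mu, forall x, normc (g x - g1 x) <= t}.
  by apply: aeW => x; rewrite subKr normc_clip.
have [mu' _] := L1_actionP Lf Mg.
apply: (@le_trans _ _ (L1_norm mu (mul1 f g1))).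
  apply: ae_ge0_le_integral => //.
  - by move=> x _; rewrite lee_fin le_max lexx orbT.
  - apply/measurable_EFinP/measurable_maxr => //.
    by apply: measurable_funB => //; exact: measurable_normc.
  - by move=> x _; rewrite lee_fin normc_nneg.
  - by apply: measurable_normcE; case: (mulL1 Lf Lg1).
  apply: filterS (L1_action_near Lf Mg Lg1 gg1) => x h _.
  rewrite lee_fin ge_max normc_nneg andbT lerBlDr.
  rewrite -(subrK (mul1 f g1 x) (act f g x)) addrC (le_trans (ler_normcD _ _))//.
  by rewrite lerD2l (le_trans h)// ler_wpM2r// ltW.
rewrite -g1E (L1_normE Lg1) L1_normE; last exact: mulL1.
by rewrite -EFinM lee_fin (le_trans (cp_norm cp Lf Lg1))// ler_wpM2r// nL1_ge0.
Qed.

Lemma L1_action_hinge_sum f g (k : R) psi : L1 f -> M g -> 0 < k ->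
  nL1 mu f <= k -> hinge_sum psi ->
  (\int[mu]_x (psi (normc (act f g x) / k))%:E <=
   \int[mu]_x (psi (normc (g x)))%:E)%E.
Proof.
move=> Lf Mg k0 fk; have mg : cmeasurable g by case: Mg.
have ma : cmeasurable (act f g) by case: (L1_action_small Lf Mg).
have mhinge (t b : R) (u : T -> R) : measurable_fun setT u ->
    measurable_fun setT (fun x : T => (b * Num.max (u x - t) 0 : R)%:E : \bar R).
  move=> mu'; apply/measurable_EFinP/measurable_funM => //.
  by apply: measurable_maxr => //; exact: measurable_funB.
have mak : measurable_fun setT (fun x => normc (act f g x) / k).
  by apply: measurable_funM => //; exact: measurable_normc.
have mg' := measurable_normc mg.
elim=> {psi} [|psi c t c0 t0 hpsi ih]; first by rewrite !integral0.
under eq_integral do rewrite EFinD.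
under [leRHS]eq_integral do rewrite EFinD.
have hge (b y : R) : 0 <= b -> 0 <= b * Num.max y 0.
  by move=> b0; rewrite mulr_ge0// le_max lexx orbT.
rewrite !ge0_integralD//; do ?[by move=> x _; rewrite lee_fin hge
  |by move=> x _; rewrite lee_fin hinge_sum_ge0|exact: measurable_hinge_sum|exact: mhinge].
apply: leeD => //.
under eq_integral do rewrite EFinM.
under [leRHS]eq_integral do rewrite EFinM.
rewrite !ge0_integralZl//; do ?[by move=> x _; rewrite lee_fin le_max lexx orbT
  |by apply/measurable_EFinP/measurable_maxr => //; exact: measurable_funB].
apply: lee_wpmul2l; first by rewrite lee_fin.
have := L1_action_hinge Lf Mg k0 fk t0.
rewrite -lee_pdivrMl//; apply: le_trans.
rewrite -ge0_integralZl//; last 3 first.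
- apply/measurable_EFinP/measurable_maxr => //.
  by apply: measurable_funB => //; exact: measurable_normc.
- by move=> x _; rewrite lee_fin le_max lexx orbT.
- by rewrite lee_fin invr_ge0 ltW.
rewrite le_eqVlt; apply/orP; left; apply/eqP; apply: eq_integral => x _.
rewrite -EFinM maxr_pMr ?invr_ge0 ?(ltW k0)// mulr0 mulrBr mulKf ?gt_eqF//.
by rewrite mulrC.
Qed.

End action.

(** * The action on Orlicz spaces *)

Section young_measurability.
Context {R : realType} {d} {T : measurableType d}.
Variable phi : R -> \bar R.
Hypothesis phiY : young_function phi.

Lemma measurable_young (u : T -> R) : measurable_fun setT u ->
  (forall x, 0 <= u x) -> measurable_fun setT (fun x => phi (u x)).
Proof.
move=> mu u0.
apply: (@emeasurable_fun_cvg _ _ _ setT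
  (fun n x => (hinge_approx phi n (u x))%:E)).
  by move=> n; apply: measurable_hinge_sum => //; exact: hinge_approxP.
by move=> x _; exact: hinge_approx_cvg.
Qed.

End young_measurability.

Section orlicz_module.
Context {R : realType} {d} {T : measurableType d}.
Variables (mu : {measure set T -> \bar R}) (phi : R -> \bar R).
Local Notation L1 := (L1_space mu).
Local Notation Lphi := (orlicz_space mu phi).
Local Notation M := (L1_up_to_small mu).
Local Notation binop := ((T -> R[i]) -> (T -> R[i]) -> (T -> R[i])).
Implicit Types (f g u v : T -> R[i]) (c : R[i]) (s : R).
Hypothesis phiY : young_function phi.

Lemma measurable_young_normc g (k : R) : 0 < k -> cmeasurable g ->
  measurable_fun setT (fun x => phi (normc (g x) / k)).
Proof.
move=> k0 mg; apply: measurable_young => //.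
  by apply: measurable_funM => //; exact: measurable_normc.
by move=> x; rewrite divr_ge0 ?normc_nneg// ltW.
Qed.

Lemma modularE g (a : R) : 0 < a ->
  modular mu phi (fun x => a%:C%C * g x) = (\int[mu]_x phi (normc (g x) / a^-1))%E.
Proof.
move=> a0; apply: eq_integral => x _.
by rewrite normcM normc_real gtr0_norm// invrK mulrC.
Qed.

Lemma young_linear_growth (x1 : R) : 0 < x1 -> (0 < phi x1)%E ->
  exists2 b : R, 0 < b & forall x, x1 <= x -> ((b * x)%:E <= phi x)%E.
Proof.
move=> x10 px1.
have [r r0 rx1] : exists2 r : R, 0 < r & (r%:E <= phi x1)%E.
  case: (phi x1) px1 => [r| |]//.
    by rewrite lte_fin => r0; exists r.
  by exists 1 => //; rewrite leey.
exists (r / x1); first by rewrite divr_gt0.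
move=> x x1x; have x0 : 0 < x := lt_le_trans x10 x1x.
have t01 : 0 <= x1 / x <= 1.
  by rewrite divr_ge0 ?(ltW x10) ?(ltW x0)//= ler_pdivrMr// mul1r.
have := young_convex phiY x 0 t01.
rewrite mulr0 addr0 divfK ?gt_eqF// (young0 phiY) mule0 adde0 => /(le_trans rx1).
rewrite -lee_pdivrMl ?divr_gt0// invf_div => h; apply: le_trans h.
by rewrite -EFinM lee_fin [leLHS]mulrC mulrA mulrAC.
Qed.

Lemma young_pos_exists : exists2 x1 : R, 0 < x1 & (0 < phi x1)%E.
Proof.
have [x x0] := young_neq0 phiY.
have pos y : phi y != 0%E -> (0 < phi y)%E.
  by move=> y0; rewrite lt_neqAle eq_sym y0 young_ge0.
have [x1|x1|x1] := ltgtP x 0; last by rewrite x1 (young0 phiY) eqxx in x0.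
  by exists (- x); rewrite ?oppr_gt0// (young_even phiY) pos.
by exists x => //; exact: pos.
Qed.

Lemma delta2_pos : delta2 mu phi -> mu setT = +oo%E ->
  forall x, 0 < x -> (0 < phi x)%E.
Proof.
move=> [C C0 h] muoo x x0; move: h; rewrite muoo ltxx => h.
rewrite lt_neqAle young_ge0// andbT eq_sym; apply/eqP => px0.
have p2 n : phi (2 ^+ n * x) = 0%E.
  elim: n => [|n ih]; first by rewrite expr0 mul1r.
  apply/eqP; rewrite eq_le young_ge0// andbT exprS -mulrA.
  have := h (2 ^+ n * x); rewrite ih mule0; apply.
  by rewrite mulr_ge0 ?exprn_ge0// ltW.
have /cvgeyPge/(_ 1) := young_infty phiY.
move=> [A [_ hA]]; pose n := Num.truncn (A / x).
have : (1%:E <= phi (2 ^+ n.+1 * x))%E.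
  apply: hA; rewrite -ltr_pdivrMr//.
  apply: lt_trans (truncnS_gt _) _.
  by rewrite -natrX ltr_nat ltn_expl.
by rewrite p2 lee_fin ler10.
Qed.

(** When [mu] is infinite, the growth condition forces [phi] to vanish at [0]
    only, so that the part of [g] above any positive level is dominated by a
    multiple of [phi (a |g|)]. When [mu] is finite, such a bound holds up to an
    additive constant, which is integrable. *)
Lemma orlicz_small g : delta2 mu phi -> Lphi g -> M g.
Proof.
move=> d2 [mg [a a0 fin]]; rewrite modularE// in fin; split=> // s s0.
have asp : 0 < a * s by rewrite mulr_gt0.
have [C0 [b [b0 C00 hC hb]]] : exists (C0 b : R), [/\ 0 < b, 0 <= C0,
    (C0%:E * mu setT < +oo)%E & forall x : R, 0 <= x ->
      ((Num.max (x - s) 0)%:E <= C0%:E + b%:E * phi (x / a^-1)%R)%E].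
  have [muoo|mufin] := eqVneq (mu setT) +oo%E.
    have [b b0 hb] := young_linear_growth asp (delta2_pos d2 muoo asp).
    exists 0, (b * a)^-1; split=> //.
    - by rewrite invr_gt0 mulr_gt0.
    - by rewrite mul0e ltry.
    move=> x x0; rewrite add0e invrK lee_pdivlMl ?mulr_gt0// -EFinM.
    have [xs|sx] := leP x s.
      by rewrite max_r ?subr_le0// mulr0 young_ge0.
    apply: le_trans (hb _ _); last by rewrite mulrC ler_pM2r// ltW.
    rewrite lee_fin max_l ?subr_ge0 ?(ltW sx)// -mulrA ler_pM2l// mulrC ler_pM2r//.
    by rewrite lerBlDr lerDl ltW.
  have [x1 x10 px1] := young_pos_exists.
  have [b b0 hb] := young_linear_growth x10 px1.
  exists (x1 / a), (b * a)^-1; split=> //.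
  - by rewrite invr_gt0 mulr_gt0.
  - by rewrite divr_ge0// ltW.
  - by rewrite lte_mul_pinfty ?lee_fin ?divr_ge0 ?(ltW x10) ?(ltW a0)// ltey.
  move=> x x0; rewrite invrK.
  have p0 : (0 <= ((b * a)^-1)%:E * phi (x * a)%R)%E.
    apply: mule_ge0; last exact: young_ge0.
    by rewrite lee_fin invr_ge0 mulr_ge0// ltW.
  have mx : Num.max (x - s) 0 <= x by rewrite ge_max x0 lerBlDr lerDl ltW.
  have [xx|xx] := leP (x * a) x1.
    rewrite -[leLHS]adde0 leeD// lee_fin (le_trans mx)//.
    by rewrite ler_pdivlMr.
  apply: (@le_trans _ _ (((b * a)^-1)%:E * phi (x * a)%R)%E); last first.
    by rewrite leeDr// lee_fin divr_ge0// ltW.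
  rewrite lee_pdivlMl ?mulr_gt0// -EFinM.
  apply: le_trans (hb _ (ltW xx)).
  by rewrite lee_fin -mulrA ler_pM2l// mulrC ler_pM2r.
pose g1 x := g x - clip s (g x).
have mg1 : cmeasurable g1 by apply: cmeasurableB => //; exact: cmeasurable_clip.
exists g1; last by apply: aeW => x; rewrite subKr normc_clip.
split=> //; have mp := @measurable_young_normc g a^-1 _ mg.
apply: (@le_lt_trans _ _ (\int[mu]_x (C0%:E + b%:E * phi (normc (g x) / a^-1)))%E).
  apply: ge0_le_integral => //.
  - by move=> x _; rewrite lee_fin normc_nneg.
  - exact: measurable_normcE.
  - apply: emeasurable_funD => //; apply: emeasurable_funM => //.
    by apply: mp; rewrite invr_gt0.
  - by move=> x _; rewrite normc_sub_clip// hb// normc_nneg.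
have mp' : measurable_fun setT (fun x => phi (normc (g x) / a^-1)).
  by apply: mp; rewrite invr_gt0.
have b0' : (0 <= b%:E)%E by rewrite lee_fin ltW.
rewrite ge0_integralD//; last 2 first.
- by move=> x _; rewrite mule_ge0// young_ge0.
- exact: emeasurable_funM.
rewrite integral_cst// ge0_integralZl//; last by move=> x _; rewrite young_ge0.
by rewrite lte_add_pinfty// lte_mul_pinfty.
Qed.

(** Convexity: shrinking the argument by [B + 1], where [B] is a finite value of
    the modular, shrinks the modular at least as much. *)
Lemma luxemburg_admissible g : Lphi g -> exists2 k : R, 0 < k &
  (\int[mu]_x phi (normc (g x) / k)%R <= 1)%E.
Proof.
move=> [mg [a a0]]; rewrite modularE//; set B := integral _ _ _ => fin.
have B0 : (0 <= B)%E by apply: integral_ge0 => x _; rewrite young_ge0.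
have BE : B = (fine B)%:E by rewrite fineK// ge0_fin_numE.
have c0 : 0 < fine B + 1 by rewrite ltr_wpDl// fine_ge0.
exists ((fine B + 1) / a); first by rewrite divr_gt0.
have ai0 : 0 < a^-1 by rewrite invr_gt0.
apply: (@le_trans _ _ (((fine B + 1)^-1)%:E * B)%E); last first.
  by rewrite BE -EFinM lee_fin mulrC ler_pdivrMr// mul1r lerDl.
rewrite /B -ge0_integralZl//; last 3 first.
- exact: measurable_young_normc.
- by move=> x _; rewrite young_ge0.
- by rewrite lee_fin invr_ge0 ltW.
apply: ge0_le_integral => //.
- by move=> x _; rewrite young_ge0.
- by apply: measurable_young_normc => //; rewrite divr_gt0.
- by apply: emeasurable_funM => //; exact: measurable_young_normc.
move=> x _; have t01 : 0 <= (fine B + 1)^-1 <= 1.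
  by rewrite invr_ge0 (ltW c0) invf_le1// lerDr fine_ge0.
have := young_convex phiY (normc (g x) / a^-1) 0 t01.
rewrite mulr0 addr0 (young0 phiY) mule0 adde0.
by rewrite -/B invfM mulrCA.
Qed.

Variable mul1 : binop.
Hypothesis cp : contractive_L1_product mu mul1.
Local Notation act := (L1_action mu mul1).

(** Fatou's lemma along the hinge approximations of [phi]; each of them
    satisfies the inequality with its own integral on the right, which is at
    most that of [phi]. *)
Lemma L1_action_modular f g (k l : R) : L1 f -> M g -> 0 < k -> nL1 mu f <= k ->
  0 < l ->
  (\int[mu]_x phi (normc (act f g x) / (k * l))%R <=
   \int[mu]_x phi (normc (g x) / l)%R)%E.
Proof.
move=> Lf Mg k0 fk l0.
have mg : cmeasurable g by case: Mg.
have ma : cmeasurable (act f g) by case: (L1_action_small cp Lf Mg).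
pose y x := normc (act f g x) / (k * l).
have y0 x : 0 <= y x by rewrite divr_ge0 ?normc_nneg// ltW// mulr_gt0.
have my : measurable_fun setT y.
  by apply: measurable_funM => //; exact: measurable_normc.
pose F n x := (hinge_approx phi n (y x))%:E.
have mF n : measurable_fun setT (F n).
  by apply: measurable_hinge_sum => //; exact: hinge_approxP.
have F0 n x : setT x -> (0 <= F n x)%E.
  by move=> _; rewrite lee_fin hinge_sum_ge0//; exact: hinge_approxP.
have -> : (\int[mu]_x phi (y x) = \int[mu]_x limn_einf (F ^~ x))%E.
  apply: eq_integral => x _; have cv := hinge_approx_cvg phiY (y0 x).
  by rewrite is_cvg_limn_einfE; [apply/esym/cvg_lim|apply/cvg_ex; exists (phi (y x))].
apply: le_trans (fatou mu measurableT mF F0) _.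
rewrite limn_einf_lim; apply: lime_le; first exact: is_cvg_einfs.
apply: nearW => n; apply: (@le_trans _ _ (\int[mu]_x F n x)%E).
  by apply: ereal_inf_lbound; exists n => /=.
have hs := hinge_sum_scale l0 (hinge_approxP phiY n).
have := L1_action_hinge_sum cp Lf Mg k0 fk hs.
under eq_integral do rewrite -mulrA -invfM -/(y _).
move=> /le_trans; apply; apply: ge0_le_integral => //.
- by move=> x _; rewrite lee_fin hinge_sum_ge0//; exact: hinge_approxP.
- apply: measurable_hinge_sum; first exact: hinge_approxP.
  by apply: measurable_funM => //; exact: measurable_normc.
- exact: measurable_young_normc.
- by move=> x _; apply: hinge_approx_le => //; rewrite divr_ge0 ?normc_nneg// ltW.
Qed.

Lemma L1_action_orlicz f g : delta2 mu phi -> L1 f -> Lphi g -> Lphi (act f g).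
Proof.
move=> d2 Lf Lg; have Mg := orlicz_small d2 Lg.
split; first by case: (L1_action_small cp Lf Mg).
have [_ [a a0 fin]] := Lg.
have k0 : 0 < nL1 mu f + 1 by rewrite ltr_wpDl// nL1_ge0.
exists (a / (nL1 mu f + 1)); first by rewrite divr_gt0.
rewrite modularE ?divr_gt0// invf_div.
apply: le_lt_trans (L1_action_modular Lf Mg k0 _ _) _; first by rewrite lerDl.
  by rewrite invr_gt0.
by rewrite -modularE.
Qed.

(** When [|f|_1] vanishes, the modular inequality is applied with arbitrarily
    small positive constants in its place. *)
Lemma L1_action_luxemburg f g : delta2 mu phi -> L1 f -> Lphi g ->
  (luxemburg_norm mu phi (act f g) <= L1_norm mu f * luxemburg_norm mu phi g)%E.
Proof.
move=> d2 Lf Lg; have Mg := orlicz_small d2 Lg; rewrite (L1_normE Lf).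
have key (k l : R) : 0 < k -> nL1 mu f <= k -> 0 < l ->
    (\int[mu]_x phi (normc (g x) / l)%R <= 1)%E ->
    (luxemburg_norm mu phi (act f g) <= (k * l)%:E)%E.
  move=> k0 fk l0 gl; apply: ereal_inf_lbound; exists (k * l) => //.
  split; first by rewrite mulr_gt0.
  exact: le_trans (L1_action_modular Lf Mg k0 fk l0) gl.
have [f0|fn0] := eqVneq (nL1 mu f) 0.
  rewrite f0 mul0e; have [l l0 gl] := luxemburg_admissible Lg.
  apply/lee_addgt0Pr => e e0; rewrite add0e.
  have := key (e / l) l; rewrite f0 divfK ?gt_eqF//; apply => //.
  - by rewrite divr_gt0.
  - by rewrite divr_ge0// ltW.
have fp : 0 < nL1 mu f by rewrite lt_neqAle eq_sym fn0 nL1_ge0.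
rewrite -lee_pdivrMl//; apply: le_ereal_inf_tmp => _ [l [l0 gl] <-].
by rewrite lee_pdivrMl// -EFinM; exact: key.
Qed.

Theorem orlicz_banach_module : delta2 mu phi ->
  banach_left_L1_module mu phi mul1 act.
Proof.
move=> d2; have sm := orlicz_small d2.
split.
- by move=> f g; exact: L1_action_orlicz.
- move=> f f' g g' Lf Lf' /sm Mg /sm Mg' ff' gg'.
  have ff1 : {ae mu, forall x, f x = f' x} by apply: filterS ff' => x; exact.
  have gg1 : {ae mu, forall x, g x = g' x} by apply: filterS gg' => x; exact.
  by apply: filterS (L1_action_ae cp Lf Lf' Mg Mg' ff1 gg1) => x.
- move=> f f' g Lf Lf' /sm Mg.
  by apply: filterS (L1_action_addl cp Lf Lf' Mg) => x.
- move=> f g g' Lf /sm Mg /sm Mg'.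
  by apply: filterS (L1_action_addr cp Lf Mg Mg') => x.
- move=> c f g Lf /sm Mg.
  by apply: filterS (L1_action_scalel cp c Lf Mg) => x.
- move=> c f g Lf /sm Mg.
  by apply: filterS (L1_action_scaler cp c Lf Mg) => x.
- move=> f f' g Lf Lf' /sm Mg.
  by apply: filterS (L1_action_assoc cp Lf Lf' Mg) => x.
- by move=> f g; exact: L1_action_luxemburg.
Qed.

End orlicz_module.

(** * Iterated integrals of compactly supported continuous functions *)

Section compact_topology.

(** The sets whose complement in [K] satisfies [P] form a filter; a cluster point
    of it would contradict the local hypothesis. *)
Lemma compact_induction (X : topologicalType) (K : set X) (P : set (set X)) :
  compact K -> P set0 -> (forall A B, P A -> P B -> P (A `|` B)) ->
  (forall A B, A `<=` B -> P B -> P A) ->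
  (forall x, K x -> exists2 U, nbhs x U & P U) -> P K.
Proof.
move=> cK P0 PU PS Ploc; apply: contrapT => nPK.
pose G : set_system X := [set U | P (K `\` U)].
have GF : Filter G.
  split.
  - by rewrite /G /= setDT.
  - by move=> U V GU GV; rewrite /G /= setDIr; exact: PU.
  - by move=> U V UV GU; apply: PS GU; exact: setDS.
have GP : ProperFilter G.
  by split=> //; rewrite /G /= setD0.
have GK : G K by rewrite /G /= setDv.
have [x [Kx clx]] := cK _ GP GK.
have [U xU PUU] := Ploc _ Kx.
have GU : G (~` U) by apply: PS PUU => y [_ /= /contrapT].
by have [y []] := clx _ _ GU xU.
Qed.

Context {X Y : topologicalType} {R : realType}.

Lemma tube_continuous (F : X -> Y -> R) (K : set X) (y0 : Y) (e : R) :
  continuous (fun p : X * Y => F p.1 p.2) -> compact K -> 0 < e ->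
  \forall y \near y0, forall x, K x -> `|F x y - F x y0| < e.
Proof.
move=> cF cK e0.
have := (near_covering_withinP K).2 ((compact_near_coveringP K).1 cK) Y (nbhs y0)
  (fun y x => `|F x y - F x y0| < e).
apply => x Kx.
have e20 : 0 < e / 2 by rewrite divr_gt0.
have /cvgrPdist_lt/(_ _ e20)[[U V] /= [xU yV] UV] := cF (x, y0).
exists (U, V) => //= -[x' y'] [/= Ux' Vy'] Kx'.
have h1 := UV (x', y') (conj Ux' Vy').
have h2 := UV (x', y0) (conj Ux' (nbhs_singleton yV)).
rewrite /= in h1 h2.
rewrite -[_ - _](subrKA (F x y0)) (le_lt_trans (ler_normD _ _))// (splitr e).
by rewrite ltrD// distrC.
Qed.

End compact_topology.

Section borel_integration.
Context {R : realType} {X : ptopologicalType}.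
Hypothesis hX : hausdorff_space X.
Variable mu : {measure set (borel X) -> \bar R}.
Hypothesis muK : forall K : set X, compact K -> (mu K < +oo)%E.
Implicit Types (f g : X -> R) (K S : set X).

Lemma open_borel (U : set X) : open U -> measurable (U : set (borel X)).
Proof. by move=> oU; exact: sub_sigma_algebra. Qed.

Lemma compact_borel K : compact K -> measurable (K : set (borel X)).
Proof.
move=> cK; rewrite -(setCK K); apply: measurableC; apply: open_borel.
by rewrite openC; exact: compact_closed.
Qed.

Lemma continuous_borel f : continuous f ->
  measurable_fun [set: borel X] (f : borel X -> R).
Proof.
move=> cf; apply: (measurability _ (RGenOInfty.measurableE R)) => //=.
move=> _ [_ [a ->] <-]; rewrite setTI; apply: open_borel.
have -> : `]a, +oo[%classic = [set r : R | a < r].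
  by apply/seteqP; split => r /=; rewrite in_itv /= andbT.
by apply: open_comp => [x _|]; [exact: cf|exact: open_gt].
Qed.

Lemma continuous_borel_map (Y : ptopologicalType) (h : X -> Y) : continuous h ->
  measurable_fun [set: borel X] (h : borel X -> borel Y).
Proof.
move=> ch; apply: (@measurability _ _ (borel X) (borel Y) _ _ open) => //.
move=> _ [U oU <-]; rewrite setTI; apply: open_borel.
by apply: open_comp => // x _; exact: ch.
Qed.

Lemma Rintegral_bound S f (e : R) : measurable (S : set (borel X)) ->
  (mu S < +oo)%E -> mu.-integrable S (EFin \o (f : borel X -> R)) ->
  (forall x, S x -> `|f x| <= e) -> `|\int[mu]_(x in S) f x| <= e * fine (mu S).
Proof.
move=> mS fS fi fe.
rewrite (le_trans (le_normr_Rintegral mS fi))// -Rintegral_cst//.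
apply: le_Rintegral => //.
  exact: (integrable_norm fi).
apply: measurable_bounded_integrable => //; exists `|e|; split=> [|b eb x _ /=].
  exact: num_real.
exact: ltW.
Qed.

Lemma Cc_integrableS f K S : continuous f -> compact K ->
  measurable (S : set (borel X)) -> S `<=` K ->
  mu.-integrable S (EFin \o (f : borel X -> R)).
Proof.
move=> cf cK mS SK; have mK := compact_borel cK.
have : mu.-integrable K (EFin \o (f : borel X -> R)).
  apply: measurable_bounded_integrable => //; first exact: muK.
    by apply: (measurable_funS measurableT) => //; exact: continuous_borel.
  have [|M [_ hM]] := @compact_bounded _ _ (f @` K).
    by apply: continuous_compact => //; exact: continuous_subspaceT.
  by exists M; split=> [|b Mb x Kx]; [exact: num_real|apply: hM => //; exists x].
by move=> h; apply: integrableS h.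
Qed.

Lemma Cc_integrable f K : continuous f -> compact K ->
  (forall x, ~ K x -> f x = 0) ->
  mu.-integrable setT (EFin \o (f : borel X -> R)).
Proof.
move=> cf cK f0; have mK := compact_borel cK.
have := Cc_integrableS cf cK mK (@subset_refl _ K).
move/(integrable_mkcond _ mK); apply: eq_integrable => // x _.
by rewrite patchE; case: ifPn => // /negP xK; rewrite /= f0// => /mem_set.
Qed.

Lemma Rintegral_supp f K : (forall x, ~ K x -> f x = 0) ->
  \int[mu]_x f x = \int[mu]_(x in K) f x.
Proof.
move=> f0; rewrite [RHS]Rintegral_mkcond; apply: eq_Rintegral => x _.
by rewrite patchE; case: ifPn => // /negP xK; rewrite f0// => /mem_set.
Qed.

Lemma parametric_continuous (Y : topologicalType) (F : X -> Y -> R) K S :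
  continuous (fun p : X * Y => F p.1 p.2) -> compact K ->
  measurable (S : set (borel X)) -> S `<=` K ->
  continuous (fun y => \int[mu]_(x in S) F x y).
Proof.
move=> cF cK mS SK y0; have fK := muK cK.
have fS : (mu S < +oo)%E.
  by apply: le_lt_trans fK; apply: le_measure; rewrite ?inE//; exact: compact_borel.
have cFy y : continuous (F ^~ y).
  move=> x; apply: (@continuous_comp X (X * Y)%type R (fun x => (x, y))
    (fun p => F p.1 p.2)); last exact: cF.
  by apply: cvg_pair => //; exact: cvg_cst.
have iF y : mu.-integrable S (EFin \o (F ^~ y : borel X -> R)).
  exact: Cc_integrableS (cFy y) cK mS SK.
apply/cvgrPdist_le => e e0.
have c0 : 0 < fine (mu S) + 1 by rewrite ltr_wpDl// fine_ge0.
have d0 : 0 < e / (fine (mu S) + 1) by rewrite divr_gt0.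
apply: filterS (tube_continuous y0 cF cK d0) => y hy.
rewrite -RintegralB//.
apply: (@le_trans _ _ (e / (fine (mu S) + 1) * fine (mu S))).
  apply: Rintegral_bound => //.
    have := integrableB mS (iF y0) (iF y); apply: eq_integrable => //.
  by move=> x Sx; rewrite distrC ltW// hy//; exact: SK.
by rewrite mulrAC ler_pdivrMr// ler_pM2l// lerDl.
Qed.

End borel_integration.

Section fubini_Cc.
Context {R : realType} {X Y : ptopologicalType}.
Hypotheses (hX : hausdorff_space X) (hY : hausdorff_space Y).
Variable mu : {measure set (borel X) -> \bar R}.
Variable nu : {measure set (borel Y) -> \bar R}.
Hypothesis muK : forall K : set X, compact K -> (mu K < +oo)%E.
Hypothesis nuK : forall K : set Y, compact K -> (nu K < +oo)%E.
Variables (F : X -> Y -> R) (K : set X) (L : set Y).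
Hypothesis cF : continuous (fun p : X * Y => F p.1 p.2).
Hypotheses (cK : compact K) (cL : compact L).

Let F' y x := F x y.

Let cF' : continuous (fun p : Y * X => F' p.1 p.2).
Proof.
move=> p; apply: (@continuous_comp (Y * X)%type (X * Y)%type R
  (fun p => (p.2, p.1)) (fun p => F p.1 p.2)); last exact: cF.
by apply: cvg_pair; [exact: cvg_snd|exact: cvg_fst].
Qed.

Let cFx x : continuous (F x).
Proof.
move=> y; apply: (@continuous_comp Y (X * Y)%type R (fun y => (x, y))
    (fun p => F p.1 p.2)); last exact: cF.
by apply: cvg_pair => //; exact: cvg_cst.
Qed.

Let cFy y : continuous (F' y).
Proof.
move=> x; apply: (@continuous_comp X (X * Y)%type R (fun x => (x, y))
    (fun p => F p.1 p.2)); last exact: cF.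
by apply: cvg_pair => //; exact: cvg_cst.
Qed.

Let A S := \int[mu]_(x in S) \int[nu]_(y in L) F x y.
Let B S := \int[nu]_(y in L) \int[mu]_(x in S) F x y.

Let mK : measurable (K : set (borel X)). Proof. exact: compact_borel. Qed.
Let mL : measurable (L : set (borel Y)). Proof. exact: compact_borel. Qed.

Let mS_fin (S : set X) : measurable (S : set (borel X)) -> S `<=` K ->
  (mu S < +oo)%E.
Proof.
by move=> mS SK; apply: le_lt_trans (muK cK); apply: le_measure; rewrite ?inE.
Qed.

Let inF x : nu.-integrable L (EFin \o (F x : borel Y -> R)).
Proof. by apply: (Cc_integrableS hY nuK (@cFx x) cL mL). Qed.

Let imF (S : set X) y : measurable (S : set (borel X)) -> S `<=` K ->
  mu.-integrable S (EFin \o (F' y : borel X -> R)).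
Proof. by move=> mS SK; exact: (Cc_integrableS hX muK (@cFy y) cK mS SK). Qed.

Let iA (S : set X) : measurable (S : set (borel X)) -> S `<=` K ->
  mu.-integrable S (EFin \o (fun x : borel X => \int[nu]_(y in L) F x y)).
Proof.
move=> mS SK; apply: (Cc_integrableS hX muK _ cK mS SK) => //.
exact: (parametric_continuous hY nuK cF' cL mL).
Qed.

Let iB (S : set X) : measurable (S : set (borel X)) -> S `<=` K ->
  nu.-integrable L (EFin \o (fun y : borel Y => \int[mu]_(x in S) F x y)).
Proof.
move=> mS SK; apply: (Cc_integrableS hY nuK _ cL mL) => //.
exact: (parametric_continuous hX muK cF cK mS SK).
Qed.

Let AU (S S' : set X) : measurable (S : set (borel X)) ->
  measurable (S' : set (borel X)) -> S `<=` K -> S' `<=` K ->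
  [disjoint S & S'] -> A (S `|` S') = A S + A S'.
Proof.
move=> mS mS' SK SK' SS'; apply: Rintegral_setU => //.
by apply: iA; [exact: measurableU|move=> x []; [exact: SK|exact: SK']].
Qed.

Let BU (S S' : set X) : measurable (S : set (borel X)) ->
  measurable (S' : set (borel X)) -> S `<=` K -> S' `<=` K ->
  [disjoint S & S'] -> B (S `|` S') = B S + B S'.
Proof.
move=> mS mS' SK SK' SS'; rewrite /B -RintegralD//; [|exact: iB|exact: iB].
apply: eq_Rintegral => y _; apply: Rintegral_setU => //.
by apply: imF; [exact: measurableU|move=> x []; [exact: SK|exact: SK']].
Qed.

(** Both iterated integrals over a small piece [S] are close to the mass of [S]
    times the integral of one section. *)
Let fubini_local (x0 : X) (S : set X) (e : R) :
  measurable (S : set (borel X)) -> S `<=` K ->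
  (forall x, S x -> forall y, L y -> `|F x y - F x0 y| <= e) ->
  `|A S - B S| <= 2 * e * fine (nu L) * fine (mu S).
Proof.
move=> mS SK h; have Sf := mS_fin mS SK; have Lf := nuK cL.
pose c := \int[nu]_(y in L) F x0 y.
have icst : mu.-integrable S (EFin \o (fun=> c)).
  apply: measurable_bounded_integrable => //.
  by exists `|c|; split=> [|b cb x _ /=]; [exact: num_real|exact: ltW].
have hA : `|A S - c * fine (mu S)| <= e * fine (nu L) * fine (mu S).
  rewrite -Rintegral_cst// -RintegralB//; last exact: iA.
  apply: Rintegral_bound => //.
    by apply: eq_integrable (integrableB mS (iA mS SK) icst).
  move=> x Sx; rewrite -RintegralB//; apply: Rintegral_bound => //.
    by apply: eq_integrable (integrableB mL (inF x) (inF x0)).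
  by move=> y Ly; exact: h.
have iFS : nu.-integrable L (EFin \o (fun y : borel Y => F x0 y * fine (mu S))).
  by apply: eq_integrable (integrableZr mL (fine (mu S)) (inF x0)).
have icy y : mu.-integrable S (EFin \o (fun=> F x0 y)).
  apply: measurable_bounded_integrable => //.
  by exists `|F x0 y|; split=> [|b cb x _ /=]; [exact: num_real|exact: ltW].
have hB : `|B S - c * fine (mu S)| <= e * fine (mu S) * fine (nu L).
  rewrite -RintegralZr// -RintegralB//; last exact: iB.
  apply: Rintegral_bound => //.
    by apply: eq_integrable (integrableB mL (iB mS SK) iFS).
  move=> y Ly; rewrite -Rintegral_cst// -RintegralB//; last exact: imF.
  apply: Rintegral_bound => //.
    by apply: eq_integrable (integrableB mS (imF y mS SK) (icy y)).
  by move=> x Sx; exact: h.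
rewrite -[_ - _](subrKA (c * fine (mu S))) (le_trans (ler_normD _ _))//.
move: hA hB; rewrite [`|c * _ - _|]distrC; move: (`| _ |) (`| _ |) => a b.
move: (fine _) (fine _) => s t; nra.
Qed.

(** The local estimates are additive in [S], hence hold on all of [K]. *)
Lemma fubini_compact : A K = B K.
Proof.
have key (e : R) : 0 < e -> `|A K - B K| <= 2 * e * fine (nu L) * fine (mu K).
  move=> e0.
  pose P (U : set X) := exists2 V : set X, measurable (V : set (borel X)) &
    U `<=` V /\ forall S : set X, measurable (S : set (borel X)) -> S `<=` K ->
      S `<=` V -> `|A S - B S| <= 2 * e * fine (nu L) * fine (mu S).
  suff [V _ [KV hV]] : P K by exact: hV.
  apply: (compact_induction cK).
  - exists set0 => //; split=> // S _ _; rewrite subset0 => ->.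
    rewrite measure0 mulr0 /A /B Rintegral_set0 sub0r normrN.
    under eq_Rintegral do rewrite Rintegral_set0.
    by rewrite Rintegral_cst// mul0r normr0.
  - move=> U1 U2 [V1 m1 [UV1 h1]] [V2 m2 [UV2 h2]].
    exists (V1 `|` V2); first exact: measurableU.
    split; first exact: setUSS.
    move=> S mS SK SV.
    have mSi : measurable (S `&` V1 : set (borel X)) by exact: measurableI.
    have mSd : measurable (S `\` V1 : set (borel X)) by exact: measurableD.
    have Ki : S `&` V1 `<=` K by move=> x [/SK].
    have Kd : S `\` V1 `<=` K by move=> x [/SK].
    have dis : [disjoint S `&` V1 & S `\` V1].
      by apply/disj_setPS => x [[_ ?] [_]].
    have SE : S = (S `&` V1) `|` (S `\` V1) by rewrite setUIDK.
    have b1 := h1 _ mSi Ki (@subIsetr _ _ _).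
    have b2 : `|A (S `\` V1) - B (S `\` V1)| <=
        2 * e * fine (nu L) * fine (mu (S `\` V1)).
      by apply: h2 => // x [/SV[]].
    have -> : fine (mu S) = fine (mu (S `&` V1)) + fine (mu (S `\` V1)).
      rewrite -fineD ?ge0_fin_numE//; [|exact: mS_fin|exact: mS_fin].
      rewrite {1}SE measureU//.
      by apply/seteqP; split => // x [[_ ?] [_]].
    rewrite {1 2}SE AU// BU// opprD addrACA (le_trans (ler_normD _ _))// mulrDr.
    by rewrite lerD.
  - by move=> U1 U2 U12 [V mV [UV hV]]; exists V => //; split=> //; exact: subset_trans UV.
  move=> x Kx.
  pose Q := [set x' | forall y, L y -> `|F x' y - F x y| < e].
  have xQ : nbhs x Q by exact: (tube_continuous x cF' cL e0).
  exists Q°; first exact: nbhs_interior.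
  exists Q°; first by apply: open_borel; exact: open_interior.
  split=> // S mS SK SQ; apply: (@fubini_local x) => // x' /SQ/interior_subset Qx' y Ly.
  exact/ltW/Qx'.
have c0 : 0 <= 2 * fine (nu L) * fine (mu K) by rewrite !mulr_ge0 ?fine_ge0.
apply/eqP; rewrite -subr_eq0 -normr_le0.
apply: (ler_add_invn c0) => n; rewrite add0r.
have n0 : 0 < n.+1%:R^-1 :> R by rewrite invr_gt0.
rewrite (le_trans (key _ n0))// le_eqVlt; apply/orP; left; apply/eqP; ring.
Qed.

Lemma fubini_Cc : (forall x y, ~ K x -> F x y = 0) ->
  (forall x y, ~ L y -> F x y = 0) ->
  \int[mu]_x \int[nu]_y F x y = \int[nu]_y \int[mu]_x F x y.
Proof.
move=> FK FL.
transitivity (A K).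
  rewrite (Rintegral_supp _ (K := K)).
    by apply: eq_Rintegral => x _; apply: Rintegral_supp => y; exact: FL.
  move=> x Kx; under eq_Rintegral do rewrite FK//.
  by rewrite Rintegral_cst// mul0r.
rewrite fubini_compact; symmetry.
rewrite (Rintegral_supp _ (K := L)).
  by apply: eq_Rintegral => y _; apply: Rintegral_supp => x; exact: FK.
move=> y Ly; under eq_Rintegral do rewrite FL//.
by rewrite Rintegral_cst// mul0r.
Qed.

End fubini_Cc.

(** * Complex functions with compact support *)

Section complex_continuity.
Context {R : realType} {T : topologicalType}.
Implicit Types f g : T -> R[i].

Lemma ccontinuousP f : continuous (f : T -> R[i]^o) <->
  continuous (fun x => complex.Re (f x)) /\ continuous (fun x => complex.Im (f x)).
Proof.
split=> [cf|[cr ci] x].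
  suff h x (e : R) : 0 < e -> \forall y \near x, normc (f x - f y) < e.
    split=> x; apply/cvgrPdist_lt => e e0; apply: filterS (h x e e0) => y.
      by apply: le_lt_trans; rewrite -cReN -cReD ler_Re_normc.
    by apply: le_lt_trans; rewrite -cImN -cImD ler_Im_normc.
  move=> e0; have e0' : 0 < e%:C%C by rewrite ltcR.
  have /cvgrPdist_lt/(_ _ e0') := cf x.
  by apply: filterS => y; rewrite ltcR.
apply/cvgrPdist_lt => -[e e'] /=; rewrite ltcE /= => /andP[/eqP -> e0].
have e20 : 0 < e / 2 by rewrite divr_gt0.
have /cvgrPdist_lt/(_ _ e20) h1 := cr x.
have /cvgrPdist_lt/(_ _ e20) h2 := ci x.
apply: filterS2 h1 h2 => y h1 h2; rewrite ltcR.
rewrite (le_lt_trans (normc_le_ReIm _))// cReD cReN cImD cImN.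
by rewrite (splitr e) ltrD.
Qed.

Lemma normc_continuous f : continuous (fun x => complex.Re (f x)) ->
  continuous (fun x => complex.Im (f x)) -> continuous (fun x => normc (f x)).
Proof.
move=> cr ci x.
rewrite (_ : (fun x => normc (f x)) = fun x =>
  Num.sqrt (complex.Re (f x) * complex.Re (f x) +
            complex.Im (f x) * complex.Im (f x))).
  apply: (@continuous_comp T R R (fun x => complex.Re (f x) * complex.Re (f x) +
    complex.Im (f x) * complex.Im (f x)) (@Num.sqrt R)); last exact: sqrt_continuous.
  by apply: cvgD; apply: cvgM; [exact: cr|exact: cr|exact: ci|exact: ci].
by apply/funext => y; rewrite normcRI !expr2.
Qed.

Lemma CcP f : hausdorff_space T -> Cc f <->
  [/\ continuous (fun x => complex.Re (f x)),
      continuous (fun x => complex.Im (f x)) &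
      exists2 K, compact K & forall x, ~ K x -> f x = 0].
Proof.
move=> hT; split=> [[/ccontinuousP[cr ci] cK]|[cr ci [K cK f0]]].
  split=> //; exists (closure [set x | f x != 0]) => // x nx.
  by apply: contrapT => /eqP fx; apply: nx; exact: subset_closure.
split; first exact/ccontinuousP.
apply: (subclosed_compact _ cK); first exact: closed_closure.
rewrite closureE => x; apply; split; first exact: compact_closed.
by move=> y /= /eqP fy; apply: contrapT => /f0.
Qed.

End complex_continuity.

Section complex_integral.
Context {R : realType} {d} {T : measurableType d}.
Variable mu : {measure set T -> \bar R}.
Implicit Types (f g : T -> R[i]) (c : R[i]).

Definition cintegrable f :=
  mu.-integrable setT (fun x => (complex.Re (f x))%:E) /\
  mu.-integrable setT (fun x => (complex.Im (f x))%:E).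

Lemma integrable_scale (k : R) (u : T -> R) :
  mu.-integrable setT (EFin \o u) ->
  mu.-integrable setT (EFin \o (fun x => k * u x)).
Proof. by move=> ui; exact: (integrableZl measurableT k ui). Qed.

Lemma cintegralD f g : cintegrable f -> cintegrable g ->
  cintegral mu (fun x => f x + g x) = cintegral mu f + cintegral mu g.
Proof.
move=> [f1 f2] [g1 g2]; rewrite /cintegral; congr (_ +i* _)%C.
  by rewrite -RintegralD//; apply: eq_Rintegral => x _; rewrite cReD.
by rewrite -RintegralD//; apply: eq_Rintegral => x _; rewrite cImD.
Qed.

Lemma cintegralZ c f : cintegrable f ->
  cintegral mu (fun x => c * f x) = c * cintegral mu f.
Proof.
move=> [f1 f2]; apply/eqP; rewrite eq_complex cReM cImM /=; apply/andP; split; apply/eqP.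
  under eq_Rintegral do rewrite cReM.
  by rewrite RintegralB ?RintegralZl//; exact: integrable_scale.
under eq_Rintegral do rewrite cImM.
by rewrite RintegralD ?RintegralZl//; exact: integrable_scale.
Qed.

Lemma cintegrable_normc f : cintegrable f ->
  mu.-integrable setT (fun x => (normc (f x))%:E).
Proof.
move=> [f1 f2].
have mf : cmeasurable f.
  by split; apply/measurable_EFinP; [case/integrableP: f1|case/integrableP: f2].
have i12 : mu.-integrable setT
    (fun x => (`|complex.Re (f x)|)%:E + (`|complex.Im (f x)|)%:E)%E.
  by apply: integrableD => //; [exact: (integrable_abse f1)|exact: (integrable_abse f2)].
apply: le_integrable i12 => //; first exact: measurable_normcE.
move=> x _ /=; rewrite lee_fin (ger0_norm (normc_nneg _)).
by rewrite (le_trans (normc_le_ReIm _))// ler_norm.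
Qed.

(** Multiply by [normc I]: then [I] is paired with each value of [f], and the
    Cauchy-Schwarz inequality in the plane applies. *)
Lemma normc_cintegral f : cintegrable f ->
  normc (cintegral mu f) <= \int[mu]_x normc (f x).
Proof.
move=> fi; have [f1 f2] := fi; set I := cintegral mu f.
have I0 : 0 <= normc I := normc_nneg I.
have [->|In0] := eqVneq (normc I) 0.
  by apply: Rintegral_ge0 => x _; exact: normc_nneg.
have Ip : 0 < normc I by rewrite lt_neqAle eq_sym In0.
rewrite -(ler_pM2l Ip) -RintegralZl//; last exact: cintegrable_normc.
have -> : normc I * normc I =
    \int[mu]_x (complex.Re I * complex.Re (f x) + complex.Im I * complex.Im (f x)).
  rewrite RintegralD ?RintegralZl//; [|exact: integrable_scale|exact: integrable_scale].
  by rewrite -!expr2 normcRI sqr_sqrtr// addr_ge0// sqr_ge0.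
apply: le_Rintegral => //.
- by apply: eq_integrable (integrableD measurableT
    (integrable_scale (complex.Re I) f1) (integrable_scale (complex.Im I) f2)).
- exact: (integrable_scale (normc I) (cintegrable_normc fi)).
by move=> x _; case: (I) (f x) => a b [c d']; exact: ler_cauchy_schwarz.
Qed.

End complex_integral.

Section Cc_borel.
Context {R : realType} {X : ptopologicalType}.
Hypothesis hX : hausdorff_space X.
Variable mu : {measure set (borel X) -> \bar R}.
Hypothesis muK : forall K : set X, compact K -> (mu K < +oo)%E.
Implicit Types (f g : X -> R[i]) (c : R[i]).

Lemma Cc_cintegrable f : Cc f -> cintegrable mu f.
Proof.
move=> /(CcP f hX)[cr ci [K cK f0]].
by split; apply: (Cc_integrable hX muK _ cK) => // x /f0 ->.
Qed.

Lemma Cc_cmeasurable f : Cc f -> cmeasurable (f : borel X -> R[i]).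
Proof. by move=> /(CcP f hX)[cr ci _]; split; exact: continuous_borel. Qed.

Lemma Cc_L1 f : Cc f -> L1_space mu f.
Proof.
move=> Cf; split; first exact: Cc_cmeasurable.
have /integrableP[_] := cintegrable_normc (Cc_cintegrable Cf).
by under eq_integral do rewrite /= ger0_norm ?normc_nneg//.
Qed.

Lemma Cc_add f g : Cc f -> Cc g -> Cc (f \+ g).
Proof.
move=> /(CcP f hX)[f1 f2 [K cK f0]] /(CcP g hX)[g1 g2 [L cL g0]].
apply/CcP => //; split.
- under eq_fun do rewrite /= cReD.
  by move=> x; apply: cvgD; [exact: f1|exact: g1].
- under eq_fun do rewrite /= cImD.
  by move=> x; apply: cvgD; [exact: f2|exact: g2].
exists (K `|` L); first exact: compactU.
by move=> x /not_orP[/f0 + /g0] /= => -> ->; rewrite addr0.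
Qed.

Lemma Cc_mul f g : continuous (fun x => complex.Re (g x)) ->
  continuous (fun x => complex.Im (g x)) -> Cc f -> Cc (fun x => g x * f x).
Proof.
move=> g1 g2 /(CcP f hX)[f1 f2 [K cK f0]]; apply/CcP => //; split.
- under eq_fun do rewrite /= cReM.
  by move=> x; apply: cvgB; apply: cvgM; [exact: g1|exact: f1|exact: g2|exact: f2].
- under eq_fun do rewrite /= cImM.
  by move=> x; apply: cvgD; apply: cvgM; [exact: g1|exact: f2|exact: g2|exact: f1].
by exists K => // x /f0 ->; rewrite mulr0.
Qed.

Lemma Cc_scale c f : Cc f -> Cc (fun x => c * f x).
Proof. by apply: Cc_mul => x; exact: cvg_cst. Qed.

End Cc_borel.

Section cfubini.
Context {R : realType} {X Y : ptopologicalType}.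
Hypotheses (hX : hausdorff_space X) (hY : hausdorff_space Y).
Variable mu : {measure set (borel X) -> \bar R}.
Variable nu : {measure set (borel Y) -> \bar R}.
Hypothesis muK : forall K : set X, compact K -> (mu K < +oo)%E.
Hypothesis nuK : forall K : set Y, compact K -> (nu K < +oo)%E.

Lemma cfubini_Cc (F : X -> Y -> R[i]) (K : set X) (L : set Y) :
  continuous (fun p : X * Y => complex.Re (F p.1 p.2)) ->
  continuous (fun p : X * Y => complex.Im (F p.1 p.2)) ->
  compact K -> compact L ->
  (forall x y, ~ K x -> F x y = 0) -> (forall x y, ~ L y -> F x y = 0) ->
  cintegral mu (fun x => cintegral nu (F x)) =
  cintegral nu (fun y => cintegral mu (F ^~ y)).
Proof.
move=> cr ci cK cL FK FL; rewrite /cintegral /=; congr (_ +i* _)%C.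
  by apply: (fubini_Cc hX hY muK nuK cr cK cL) => x y xy; [rewrite FK|rewrite FL].
by apply: (fubini_Cc hX hY muK nuK ci cK cL) => x y xy; [rewrite FK|rewrite FL].
Qed.

End cfubini.

(** * Topology of the coset space *)

Lemma pair_continuous (S T U : topologicalType) (f : S -> T) (g : S -> U) (s : S) :
  f @ s --> f s -> g @ s --> g s -> {for s, continuous (fun t => (f t, g t))}.
Proof. by move=> fs gs; exact: cvg_pair. Qed.

Section coset_topology.
Context {G : topologicalGroupType} (H : groupClosed G).
Local Notation X := (coset_space H).
Local Notation HT := (subgroup_type H).

Lemma mulg_cvg (I : Type) (F : set_system I) (f g : I -> G) (a b : G) :
  Filter F -> f @ F --> a -> g @ F --> b -> (fun i => (f i * g i)%g) @ F --> (a * b)%g.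
Proof.
move=> FF fa gb.
by apply: (@cvg_comp _ _ _ (fun i => (f i, g i)) (fun p => (p.1 * p.2)%g) F (nbhs (a, b)));
  [exact: cvg_pair|exact: (@mulg_continuous G (a, b))].
Qed.

Lemma invg_cvg (I : Type) (F : set_system I) (f : I -> G) (a : G) :
  Filter F -> f @ F --> a -> (fun i => (f i)^-1%g) @ F --> (a^-1)%g.
Proof.
by move=> FF fa; apply: cvg_comp fa _; exact: (@invg_continuous G a).
Qed.

Lemma coset_continuous : continuous (coset H).
Proof. exact: pi_continuous. Qed.

Lemma cosetK (p : X) : coset H (repr p) = p.
Proof. exact: reprK. Qed.

Lemma coset_open (U : set G) : open U -> open (coset H @` U).
Proof.
move=> oU.
suff : open (coset H @^-1` (coset H @` U)) by [].
rewrite openE => x [u Uu /coset_eqP ux].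
have : nbhs x ((fun y => (y * (u^-1 * x)^-1)%g) @^-1` U).
  have : (fun y => (y * (u^-1 * x)^-1)%g) @ x --> (x * (u^-1 * x)^-1)%g.
    by apply: mulg_cvg; [exact: cvg_id|exact: cvg_cst].
  rewrite invgM invgK mulVKg; apply.
  exact: open_nbhs_nbhs.
apply: filterS => y /= Uy; exists (y * (u^-1 * x)^-1)%g => //.
by apply/coset_eqP; rewrite invgM invgK -mulgA mulVg mulg1.
Qed.

Lemma coset_nbhs (x : G) (U : set G) : nbhs x U -> nbhs (coset H x) (coset H @` U).
Proof.
rewrite nbhsE => -[V [oV Vx] VU].
apply: (@filterS _ _ _ (coset H @` V)); first exact: image_subset.
by apply: open_nbhs_nbhs; split; [exact: coset_open|exists x].
Qed.

Hypothesis hG : hausdorff_space G.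
Hypothesis cH : compact [set x : G | x \in H].

Lemma subgroup_hausdorff : hausdorff_space HT.
Proof.
move=> h k clhk; apply: val_inj; apply: hG => A B hA kB.
have vA : nbhs h (val @^-1` A) by apply: subgroup_val_continuous.
have vB : nbhs k (val @^-1` B) by apply: subgroup_val_continuous.
by have [l [lA lB]] := clhk _ _ vA vB; exists (val l).
Qed.

Lemma subgroup_compact : compact [set: HT].
Proof.
move=> F PF _.
have FH : nbhs (val @ F) [set x : G | x \in H].
  by apply: (@filterS _ F _ setT) => [h _|]; [exact: (valP h)|exact: filterT].
have [x [xH clx]] := cH (fmap_proper_filter _ PF) FH.
exists (Sub x xH : HT); split=> // A B FA.
rewrite nbhsE => -[V [[B' oB' <-] B'x] VB].
have FA' : (val @ F) (val @` A) by apply: (@filterS _ F _ A) => [h Ah|//]; exists h.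
have xB' : nbhs x B' by apply: open_nbhs_nbhs; split=> //; rewrite -(SubK HT xH).
have [_ [[h Ah <-] hB']] := clx _ _ FA' xB'.
by exists h; split=> //; exact: VB.
Qed.

(** The subgroup is closed and [(x, y) |-> x^-1 y] is continuous, so distinct
    cosets have representatives with neighbourhoods [U] and [V] such that
    [U^-1 V] avoids [H]; their images are disjoint since [coset] is open. *)
Lemma coset_hausdorff : hausdorff_space X.
Proof.
move=> p q; rewrite -(cosetK p) -(cosetK q); move: (repr p) (repr q) => x y clxy.
apply/coset_eqP; apply: contrapT => xy.
have cl : open (~` [set x : G | x \in H]).
  by rewrite openC; exact: compact_closed.
have : (fun p : G * G => (p.1^-1 * p.2)%g) @ (x, y) --> (x^-1 * y)%g.
  by apply: mulg_cvg; [apply: invg_cvg; exact: cvg_fst|exact: cvg_snd].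
have nxy : nbhs (x^-1 * y)%g (~` [set x : G | x \in H]) by exact: open_nbhs_nbhs.
move=> /(_ _ nxy)[[U V]/= [xU yV] UV].
have [_ [[u Uu <-] [v Vv vu]]] := clxy _ _ (coset_nbhs xU) (coset_nbhs yV).
by apply: (UV (u, v) (conj Uu Vv)) => /=; apply/coset_eqP.
Qed.

Lemma coset_locally_compact :
  locally_compact [set: G] -> locally_compact [set: X].
Proof.
move=> lG p _; rewrite -(cosetK p).
have [U xU [cU _]] := lG (repr p) I.
have cU' : compact (coset H @` U).
  apply: continuous_compact => //; apply: continuous_subspaceT.
  exact: coset_continuous.
exists (coset H @` U); last by split=> //; exact: compact_closed coset_hausdorff cU'.
rewrite /within/= in xU *.
have : nbhs (repr p) U by apply: filterS xU => y; apply.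
by move=> /coset_nbhs; exact: filterS.
Qed.

Lemma coset_act1 (p : X) : coset_act 1%g p = p.
Proof. by rewrite /coset_act mul1g cosetK. Qed.

Lemma coset_actM (x y : G) (p : X) :
  coset_act (x * y)%g p = coset_act x (coset_act y p).
Proof. by rewrite -(cosetK p) !coset_actE mulgA. Qed.

Lemma coset_actK (x : G) (p : X) : coset_act x (coset_act x^-1%g p) = p.
Proof. by rewrite -coset_actM mulgV coset_act1. Qed.

Lemma coset_actVK (x : G) (p : X) : coset_act x^-1%g (coset_act x p) = p.
Proof. by rewrite -coset_actM mulVg coset_act1. Qed.

Lemma repr_coset (x : G) : exists h : HT, repr (coset H x) = (x * val h)%g.
Proof.
have /coset_eqP xH : coset H x = coset H (repr (coset H x)) by rewrite cosetK.
by exists (Sub (x^-1 * repr (coset H x))%g xH : HT); rewrite [val _]SubK mulVKg.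
Qed.

(** Since [coset] is open, neighbourhoods of a representative map to
    neighbourhoods of the coset. *)
Lemma coset_act_continuous : continuous (fun xp : G * X => coset_act xp.1 xp.2).
Proof.
move=> [x p] A; rewrite /= -(cosetK p) coset_actE => xpA.
have : (fun p : G * G => (p.1 * p.2)%g) @ (x, repr p) --> (x * repr p)%g.
  by apply: mulg_cvg; [exact: cvg_fst|exact: cvg_snd].
move=> /(_ _ (@coset_continuous _ _ xpA))[[U V]/= [xU yV] UV].
exists (U, coset H @` V); first by split=> //=; exact: coset_nbhs.
move=> [u _] /= [Uu [v Vv <-]]; rewrite coset_actE.
exact: (UV (u, v)).
Qed.

Lemma coset_actl_continuous (x : G) : continuous (coset_act (H := H) x).
Proof.
move=> p; apply: (@continuous_comp X (G * X)%type X (fun p => (x, p))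
  (fun xp => coset_act xp.1 xp.2)); last exact: coset_act_continuous.
apply: (@pair_continuous X G X (fun=> x) id); last exact: cvg_id.
exact: (@cst_continuous X G x p).
Qed.

(** Locally, the lift is a compact neighbourhood of a representative. *)
Lemma compact_lift (K : set X) : locally_compact [set: G] -> compact K ->
  exists2 C : set G, compact C & K `<=` coset H @` C.
Proof.
move=> lG cK.
apply: (@compact_induction X K
  (fun K => exists2 C : set G, compact C & K `<=` coset H @` C) cK).
- by exists set0; [exact: compact0|].
- move=> A B [C cC AC] [D cD BD]; exists (C `|` D); first exact: compactU.
  by rewrite image_setU; exact: setUSS.
- by move=> A B AB [C cC BC]; exists C => //; exact: subset_trans BC.
move=> p _; have [U xU [cU _]] := lG (repr p) I.
exists (coset H @` U); last by exists U.
rewrite -(cosetK p); apply: coset_nbhs.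
by rewrite /within/= in xU; apply: filterS xU => y; apply.
Qed.

Lemma compact_translate (C : set G) (K : set X) : compact C -> compact K ->
  compact [set coset_act xp.1 xp.2 | xp in C `*` K].
Proof.
move=> cC cK; apply: continuous_compact; last exact: compact_setX.
by apply: continuous_subspaceT; exact: coset_act_continuous.
Qed.

Lemma subgroup_act_continuous :
  continuous (fun hp : HT * X => coset_act (val hp.1) hp.2).
Proof.
move=> hp; apply: (@continuous_comp (HT * X)%type (G * X)%type X
  (fun hp => (val hp.1, hp.2)) (fun xp => coset_act xp.1 xp.2)).
  apply: pair_continuous; last exact: cvg_snd.
  by apply: cvg_comp; [exact: cvg_fst|exact: subgroup_val_continuous].
exact: coset_act_continuous.
Qed.

Lemma compact_saturate (K : set X) : compact K ->
  compact [set coset_act (val hp.1) hp.2 | hp in [set: HT] `*` K].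
Proof.
move=> cK; apply: continuous_compact; last first.
  exact: compact_setX subgroup_compact cK.
apply: continuous_subspaceT; exact: subgroup_act_continuous.
Qed.

End coset_topology.

(** * Averaging over the compact subgroup *)

Lemma Rintegral_invariant {R : realType} {d} {T : measurableType d}
    (mu : {measure set T -> \bar R}) (h : T -> T) (g : T -> R) :
  measurable_fun setT h -> (forall A, measurable A -> mu (h @^-1` A) = mu A) ->
  measurable_fun setT g -> mu.-integrable setT (EFin \o (g \o h)) ->
  \int[mu]_x g (h x) = \int[mu]_x g x.
Proof.
move=> mh hinv mg ig; congr fine.
have mg' : measurable_fun setT (EFin \o g) by exact/measurable_EFinP.
have := integral_pushforward mh mg' ig measurableT.
rewrite preimage_setT => <-; apply: eq_measure_integral => A mA _.
exact: hinv.
Qed.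

Section haar_compact.
Context {R : realType} {K : topologicalGroupType}.
Variable mu : {measure set (borel K) -> \bar R}.
Hypotheses (hK : hausdorff_space K) (cK : compact [set: K]).
Hypotheses (haar : haar_measure mu) (mu1 : mu setT = 1%E).
Implicit Types u : K -> R.

Let muK : forall A : set K, compact A -> (mu A < +oo)%E.
Proof. exact: (radon_compact (haar_radon haar)). Qed.

Let mulgl_continuous (k : K) : continuous (fun h => (k * h)%g).
Proof. by move=> h; apply: mulg_cvg; [exact: cvg_cst|exact: cvg_id]. Qed.

Let mulgr_continuous (k : K) : continuous (fun h => (h * k)%g).
Proof. by move=> h; apply: mulg_cvg; [exact: cvg_id|exact: cvg_cst]. Qed.

Lemma compact_integrable u : continuous u ->
  mu.-integrable setT (EFin \o (u : borel K -> R)).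
Proof. by move=> cu; apply: (Cc_integrable hK muK cu cK) => x /(_ I). Qed.

Lemma haar_left u (k : K) : continuous u ->
  \int[mu]_h u (k * h)%g = \int[mu]_h u h.
Proof.
move=> cu; apply: (@Rintegral_invariant _ _ (borel K) mu (fun h => (k * h)%g) u).
- exact: continuous_borel_map.
- move=> A mA; rewrite -[RHS](haar_invariant haar k^-1%g mA); congr (mu _).
  apply/seteqP; split=> [x Ax|_ [y Ay <-]]; last by rewrite /= mulVKg.
  by exists (k * x)%g => //; rewrite mulKg.
- exact: continuous_borel.
- apply: compact_integrable => h.
  by apply: continuous_comp; [exact: mulgl_continuous|exact: cu].
Qed.

Let int_cst (c : R) : \int[mu]_h c = c.
Proof. by rewrite Rintegral_cst// mu1 mulr1. Qed.

(** Integrate [u (h^-1 k)] over both variables: left invariance in [k] gives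
    the integral of [u], left invariance in [h] that of [u \o inv]. *)
Lemma haar_inv u : continuous u -> \int[mu]_h u (h^-1)%g = \int[mu]_h u h.
Proof.
move=> cu; have cF : continuous (fun p : K * K => u (p.1^-1 * p.2)%g).
  move=> p; apply: (@continuous_comp (K * K)%type K R
    (fun p => (p.1^-1 * p.2)%g) u); last exact: cu.
  by apply: mulg_cvg; [apply: invg_cvg; exact: cvg_fst|exact: cvg_snd].
have := @fubini_Cc R K K hK hK mu mu muK muK (fun h k => u (h^-1 * k)%g) setT setT
  cF cK cK (fun _ _ f => False_ind _ (f I)) (fun _ _ f => False_ind _ (f I)).
have -> : \int[mu]_h \int[mu]_k u (h^-1 * k)%g = \int[mu]_h u h.
  under eq_Rintegral do rewrite haar_left//.
  exact: int_cst.
move=> ->; rewrite -[LHS]int_cst; apply: eq_Rintegral => k _.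
have cuV : continuous (fun h => u (h^-1 * k)%g).
  move=> h; apply: (@continuous_comp K K R (fun h => (h^-1 * k)%g) u); last exact: cu.
  by apply: mulg_cvg; [apply: invg_cvg; exact: cvg_id|exact: cvg_cst].
rewrite -(haar_left k cuV); apply: eq_Rintegral => h _.
by rewrite invgM -mulgA mulVg mulg1.
Qed.

(** Right translation is left translation conjugated by inversion. *)
Lemma haar_right u (k : K) : continuous u ->
  \int[mu]_h u (h * k)%g = \int[mu]_h u h.
Proof.
move=> cu.
have cuk : continuous (fun h => u (h * k)%g).
  by move=> h; apply: continuous_comp; [exact: mulgr_continuous|exact: cu].
have cuV : continuous (fun h => u (h^-1)%g).
  by move=> h; apply: continuous_comp; [exact: invg_continuous|exact: cu].
rewrite -(haar_inv cuk) -(haar_inv cu) -(haar_left (k^-1)%g cuV).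
by apply: eq_Rintegral => h _; rewrite invgM invgK.
Qed.

End haar_compact.

Section H_average.
Context {R : realType} {G : topologicalGroupType} {H : groupClosed G}.
Local Notation X := (coset_space H).
Local Notation HT := (subgroup_type H).
Variables (dh : {measure set (borel HT) -> \bar R})
          (m : {measure set (borel X) -> \bar R}).
Hypotheses (hG : hausdorff_space G) (lG : locally_compact [set: G]).
Hypothesis cH : compact [set x : G | x \in H].
Hypotheses (haar : haar_measure dh) (dh1 : dh setT = 1%E).
Hypothesis mK : forall K : set X, compact K -> (m K < +oo)%E.
Hypothesis mI : forall (x : G) (A : set (borel X)), measurable A ->
  m [set coset_act x p | p in A] = m A.
Implicit Types u : X -> R.

Let hX : hausdorff_space X. Proof. exact: coset_hausdorff. Qed.
Let hH : hausdorff_space HT. Proof. exact: subgroup_hausdorff. Qed.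
Let cHT : compact [set: HT]. Proof. exact: subgroup_compact. Qed.
Let dhK : forall A : set HT, compact A -> (dh A < +oo)%E.
Proof. exact: (radon_compact (haar_radon haar)). Qed.

Lemma coset_measure_invariant u (x : G) : continuous u ->
  (exists2 K, compact K & forall p, ~ K p -> u p = 0) ->
  \int[m]_p u (coset_act x p) = \int[m]_p u p.
Proof.
move=> cu [K cK uK].
apply: (@Rintegral_invariant _ _ (borel X) m (coset_act x) u).
- apply: continuous_borel_map; exact: coset_actl_continuous.
- move=> A mA; rewrite -[RHS](mI x^-1%g mA); congr (m _).
  apply/seteqP; split=> [p Ap|_ [p Ap <-]]; last by rewrite /= coset_actK.
  by exists (coset_act x p) => //; rewrite coset_actVK.
- exact: continuous_borel.
- apply: (@Cc_integrable _ _ hX _ mK _ (coset_act x^-1%g @` K)).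
  + move=> p; apply: continuous_comp; last exact: cu.
    exact: coset_actl_continuous.
  + apply: continuous_compact => //; apply: continuous_subspaceT.
    exact: coset_actl_continuous.
  move=> p np; apply: uK => Kp; apply: np.
  by exists (coset_act x p) => //; rewrite coset_actVK.
Qed.

Lemma subgroup_orbit_continuous (p : X) :
  continuous (fun h : HT => coset_act (val h) p).
Proof.
move=> h; apply: (@continuous_comp HT (HT * X)%type X (fun h => (h, p))
  (fun hp => coset_act (val hp.1) hp.2)); last exact: subgroup_act_continuous.
by apply: (@pair_continuous HT HT X id (fun=> p));
  [exact: cvg_id|exact: (@cst_continuous HT X p h)].
Qed.

Definition H_average u (p : X) : R := \int[dh]_h u (coset_act (val h) p).

Let cuorb u p : continuous u -> continuous (fun h : HT => u (coset_act (val h) p)).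
Proof.
by move=> cu h; apply: continuous_comp; [exact: subgroup_orbit_continuous|exact: cu].
Qed.

Lemma H_average_integrable u p : continuous u ->
  dh.-integrable setT (EFin \o (fun h : borel HT => u (coset_act (val h) p))).
Proof. by move=> cu; apply: compact_integrable => //; exact: cuorb. Qed.

Let cact u : continuous u ->
  continuous (fun hp : HT * X => u (coset_act (val hp.1) hp.2)).
Proof.
by move=> cu hp; apply: continuous_comp; [exact: subgroup_act_continuous|exact: cu].
Qed.

Lemma H_average_continuous u : continuous u -> continuous (H_average u).
Proof.
move=> cu.
exact: (@parametric_continuous R HT hH dh dhK X
  (fun h p => u (coset_act (val h) p)) setT setT (cact cu) cHT measurableT).
Qed.

Lemma H_average_act u (k : HT) p : continuous u ->
  H_average u (coset_act (val k) p) = H_average u p.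
Proof.
move=> cu; rewrite /H_average -(haar_right hH cHT haar dh1 k (@cuorb u p cu)).
by apply: eq_Rintegral => h _; rewrite -coset_actM.
Qed.

Lemma H_average_supp u (K : set X) : (forall p, ~ K p -> u p = 0) -> forall p,
  ~ [set coset_act (val hp.1) hp.2 | hp in [set: HT] `*` K] p -> H_average u p = 0.
Proof.
move=> uK p np; transitivity (\int[dh]_h (0 : R)).
  2: by rewrite Rintegral_cst// mul0r.
apply: eq_Rintegral => h _; apply: uK => Kp; apply: np.
exists ((h^-1)%g, coset_act (val h) p) => //=.
exact: coset_actVK.
Qed.

Lemma H_average_le u (s : R) p : continuous u -> (forall q, u q <= s) ->
  H_average u p <= s.
Proof.
move=> cu us; rewrite /H_average.
have -> : s = \int[dh]_h s by rewrite Rintegral_cst// dh1 mulr1.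
apply: le_Rintegral => //; first exact: H_average_integrable.
by apply: (@compact_integrable R HT dh hH cHT haar (fun=> s)) => h;
  exact: (@cst_continuous HT R s h).
Qed.

(** Exchange the integrals; each translate of [u] has the same integral. *)
Lemma Rintegral_H_average u : continuous u ->
  (exists2 K, compact K & forall p, ~ K p -> u p = 0) ->
  \int[m]_p H_average u p = \int[m]_p u p.
Proof.
move=> cu Ku; have [K cK uK] := Ku.
have cK' := compact_saturate cH cK.
rewrite /H_average -(@fubini_Cc R HT X hH hX dh m dhK mK
  (fun h p => u (coset_act (val h) p)) _ _ (cact cu) cHT cK').
- under eq_Rintegral do rewrite coset_measure_invariant//.
  by rewrite Rintegral_cst// dh1 mulr1.
- by move=> h p [].
- move=> h p np; apply: uK => Kp; apply: np.
  exists ((h^-1)%g, coset_act (val h) p) => //=.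
  exact: coset_actVK.
Qed.

(** The condition under which [u (x^-1 q)] descends to a function of the coset
    of [x], see [kernelE]. *)
Definition H_invariant {V : Type} (u : X -> V) :=
  forall (h : HT) p, u (coset_act (val h) p) = u p.

Lemma kernelE {V : Type} (u : X -> V) (x : G) (q : X) : H_invariant u ->
  u (coset_act (repr (coset H x))^-1%g q) = u (coset_act x^-1%g q).
Proof.
move=> uH; have [h ->] := repr_coset H x.
by rewrite invgM coset_actM; exact: (uH (h^-1)%g).
Qed.

Lemma kernel_act {V : Type} (u : X -> V) (x : G) (p q : X) : H_invariant u ->
  u (coset_act (repr (coset_act x p))^-1%g (coset_act x q)) =
  u (coset_act (repr p)^-1%g q).
Proof.
move=> uH; rewrite {1}/coset_act kernelE// invgM coset_actM coset_actVK//.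
Qed.

Lemma kernel_continuous u : H_invariant u -> continuous u ->
  continuous (fun pq : X * X => u (coset_act (repr pq.1)^-1%g pq.2)).
Proof.
move=> uH cu [p q] A /=; rewrite -(cosetK p); move: (repr p) => x.
rewrite kernelE// => uA.
have : {for (x, q), continuous (fun xq : G * X => u (coset_act xq.1^-1%g xq.2))}.
  apply: continuous_comp; last exact: cu.
  apply: (@continuous_comp (G * X)%type (G * X)%type X
    (fun xq => (xq.1^-1%g, xq.2)) (fun xp => coset_act xp.1 xp.2));
    last exact: coset_act_continuous.
  by apply: pair_continuous; [apply: invg_cvg; exact: cvg_fst|exact: cvg_snd].
move=> /(_ _ uA)[[U V]/= [xU qV] UV].
exists (coset H @` U, V); first by split=> //=; exact: coset_nbhs.
by move=> [_ q'] /= [[y Uy <-] Vq']; rewrite kernelE//; exact: (UV (y, q')).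
Qed.

(** Lift [K] to a compact subset [C] of the group; then [u (x^-1 q)] vanishes for
    [x] in [C] unless [q] lies in [C L]. *)
Lemma kernel_supp {V : Type} (u : X -> V) (z : V) (K L : set X) : H_invariant u ->
  compact K -> compact L -> (forall p, ~ L p -> u p = z) ->
  exists2 Q, compact Q & forall p q, K p -> ~ Q q ->
    u (coset_act (repr p)^-1%g q) = z.
Proof.
move=> uH cK cL uL; have [C cC KC] := compact_lift lG cK.
exists [set coset_act xp.1 xp.2 | xp in C `*` L].
  exact: compact_translate.
move=> p q /KC[x Cx <-] nq; rewrite kernelE//; apply: uL => Lq; apply: nq.
by exists (x, coset_act x^-1%g q) => //=; rewrite coset_actK.
Qed.

End H_average.

(** * Convolution of compactly supported functions on the coset space *)

Section continuous_components.
Context {R : realType}.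

(** Equivalent to continuity for the norm, by [ccontinuousP]; stated by
    components because integrals are taken by components. *)
Definition ccont {T : topologicalType} (f : T -> R[i]) :=
  continuous (fun x => complex.Re (f x)) /\ continuous (fun x => complex.Im (f x)).

Lemma ccontM {T : topologicalType} (f g : T -> R[i]) : ccont f -> ccont g ->
  ccont (fun x => f x * g x).
Proof.
move=> [f1 f2] [g1 g2]; split.
  under eq_fun do rewrite cReM.
  by move=> x; apply: cvgB; apply: cvgM; [exact: f1|exact: g1|exact: f2|exact: g2].
under eq_fun do rewrite cImM.
by move=> x; apply: cvgD; apply: cvgM; [exact: f1|exact: g2|exact: f2|exact: g1].
Qed.

Lemma ccont_comp {S T : topologicalType} (h : S -> T) (f : T -> R[i]) :
  continuous h -> ccont f -> ccont (f \o h).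
Proof.
move=> ch [f1 f2]; split=> x.
  apply: (@continuous_comp S T R h (fun y => complex.Re (f y))); first exact: ch.
  exact: f1.
apply: (@continuous_comp S T R h (fun y => complex.Im (f y))); first exact: ch.
exact: f2.
Qed.

Lemma ccont_normc {T : topologicalType} (f : T -> R[i]) : ccont f ->
  continuous (fun x => normc (f x)).
Proof. by move=> [f1 f2]; exact: normc_continuous. Qed.

End continuous_components.

Section convolution.
Context {R : realType} {G : topologicalGroupType} {H : groupClosed G}.
Local Notation X := (coset_space H).
Local Notation HT := (subgroup_type H).
Variables (dh : {measure set (borel HT) -> \bar R})
          (m : {measure set (borel X) -> \bar R}).
Hypotheses (hG : hausdorff_space G) (lG : locally_compact [set: G]).
Hypothesis cH : compact [set x : G | x \in H].
Hypotheses (haar : haar_measure dh) (dh1 : dh setT = 1%E).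
Hypothesis mK : forall K : set X, compact K -> (m K < +oo)%E.
Hypothesis mI : forall (x : G) (A : set (borel X)), measurable A ->
  m [set coset_act x p | p in A] = m A.
Implicit Types (f g : X -> R[i]) (c : R[i]).

Let hX : hausdorff_space X. Proof. exact: coset_hausdorff. Qed.
Let hH : hausdorff_space HT. Proof. exact: subgroup_hausdorff. Qed.
Let cHT : compact [set: HT]. Proof. exact: subgroup_compact. Qed.
Let dhK : forall A : set HT, compact A -> (dh A < +oo)%E.
Proof. exact: (radon_compact (haar_radon haar)). Qed.

Local Notation J := (J_operator dh).
Local Notation conv := (coset_convolution dh m).
Let vanish_off (K : set X) f := forall p, ~ K p -> f p = 0.

Let CcE f : Cc f -> ccont f /\ exists2 K, compact K & vanish_off K f.
Proof. by move=> /(CcP f hX)[f1 f2 fK]. Qed.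

Let CcI f : ccont f -> (exists2 K, compact K & vanish_off K f) -> Cc f.
Proof. by move=> [f1 f2] fK; apply/CcP. Qed.

Lemma J_ccont g : ccont g -> ccont (J g).
Proof.
move=> [g1 g2]; split.
  exact: (H_average_continuous hG cH haar g1).
exact: (H_average_continuous hG cH haar g2).
Qed.

Lemma J_invariant g : ccont g -> H_invariant (J g).
Proof.
move=> [g1 g2] h p; apply/eqP; rewrite eq_complex /=; apply/andP; split; apply/eqP.
  exact: (H_average_act hG cH haar dh1 h p g1).
exact: (H_average_act hG cH haar dh1 h p g2).
Qed.

Let sat (K : set X) := [set coset_act (val hp.1) hp.2 | hp in [set: HT] `*` K].

Let mem_sat (K : set X) (h : HT) s : K (coset_act (val h) s) -> sat K s.
Proof.
move=> Ks; exists ((h^-1)%g, coset_act (val h) s); first by split.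
exact: coset_actVK.
Qed.

Let csat K : compact K -> compact (sat K).
Proof. exact: compact_saturate. Qed.

Lemma J_vanish g (K : set X) : vanish_off K g -> vanish_off (sat K) (J g).
Proof.
move=> gK p np; have g1 q : ~ K q -> complex.Re (g q) = 0 by move=> /gK ->.
have g2 q : ~ K q -> complex.Im (g q) = 0 by move=> /gK ->.
apply/eqP; rewrite eq_complex /=; apply/andP; split; apply/eqP.
  exact: (H_average_supp dh g1 np).
exact: (H_average_supp dh g2 np).
Qed.

Let J_cintegrable g p : ccont g -> cintegrable dh (fun h => g (coset_act (val h) p)).
Proof.
by move=> [g1 g2]; split; [exact: (H_average_integrable hG cH haar p g1)
  |exact: (H_average_integrable hG cH haar p g2)].
Qed.

Lemma J_add f g : ccont f -> ccont g -> J (f \+ g) =1 J f \+ J g.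
Proof. by move=> cf cg p; apply: cintegralD; exact: J_cintegrable. Qed.

Lemma J_scale c g : ccont g -> J (fun p => c * g p) =1 (fun p => c * J g p).
Proof. by move=> cg p; apply: cintegralZ; exact: J_cintegrable. Qed.

Lemma normc_J g p : ccont g -> normc (J g p) <= H_average dh (fun q => normc (g q)) p.
Proof. by move=> cg; apply: normc_cintegral; exact: J_cintegrable. Qed.

Let ker g (p q : X) : R[i] := J g (coset_act (repr p)^-1%g q).

Let Re_invariant f : H_invariant f -> H_invariant (fun p => complex.Re (f p)).
Proof. by move=> fH h p; rewrite fH. Qed.

Let Im_invariant f : H_invariant f -> H_invariant (fun p => complex.Im (f p)).
Proof. by move=> fH h p; rewrite fH. Qed.

Let ker_ccont g : ccont g -> ccont (fun pq : X * X => ker g pq.1 pq.2).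
Proof.
move=> cg; have [j1 j2] := J_ccont cg; have jH := J_invariant cg; split.
  exact: (kernel_continuous (Re_invariant jH) j1).
exact: (kernel_continuous (Im_invariant jH) j2).
Qed.

Let ker_act g (x : G) (p q : X) : ccont g ->
  ker g (coset_act x p) (coset_act x q) = ker g p q.
Proof. by move=> cg; apply: kernel_act; exact: J_invariant. Qed.

(** Confines the integrand of a convolution to a compact set of pairs. *)
Let conv_supp g (K L : set X) : ccont g -> compact K -> compact L ->
  vanish_off L g ->
  exists2 Q, compact Q & forall p q, K p -> ~ Q q -> ker g p q = 0.
Proof.
move=> cg cK cL gL.
have [Q cQ hQ] := kernel_supp lG (J_invariant cg) cK (csat cL) (J_vanish gL).
by exists Q => // p q Kp nq; exact: hQ.
Qed.

Let fst_ccont f : ccont f -> ccont (fun pq : X * X => f pq.1).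
Proof. by move=> cf; apply: (ccont_comp (h := fst)) => // p; exact: cvg_fst. Qed.

Let section_continuous (q : X) : continuous (fun p : X => (p, q)).
Proof.
move=> p; apply: (@pair_continuous X X X id (fun=> q)); first exact: cvg_id.
exact: (@cst_continuous X X q p).
Qed.

Let integrand_ccont f g : ccont f -> ccont g ->
  ccont (fun pq : X * X => f pq.1 * ker g pq.1 pq.2).
Proof. by move=> cf cg; apply: ccontM; [exact: fst_ccont|exact: ker_ccont]. Qed.

Let integrand_Cc f g q : Cc f -> ccont g -> Cc (fun p => f p * ker g p q).
Proof.
move=> /CcE[cf [K cK fK]] cg; apply: CcI.
  by apply: (ccont_comp (h := fun p => (p, q)) _ (integrand_ccont cf cg));
    exact: section_continuous.
by exists K => // p /fK ->; rewrite mul0r.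
Qed.

Let integrand_cintegrable f g q : Cc f -> ccont g ->
  cintegrable m (fun p => f p * ker g p q).
Proof. by move=> Cf cg; apply: Cc_cintegrable => //; exact: integrand_Cc. Qed.

Lemma conv_Cc f g : Cc f -> Cc g -> Cc (conv f g).
Proof.
move=> Cf /CcE[cg [L cL gL]]; have [cf [K cK fK]] := CcE Cf.
have [Q cQ hQ] := conv_supp cg cK cL gL.
have mKb : measurable (K : set (borel X)) by exact: compact_borel.
have [i1 i2] := integrand_ccont cf cg.
apply: CcI.
  split.
    rewrite (_ : (fun q => _) = fun q => \int[m]_(p in K) complex.Re (f p * ker g p q)).
      exact: (@parametric_continuous R X hX m mK X
        (fun p q => complex.Re (f p * ker g p q)) K K i1 cK mKb).
    by apply/funext => q; apply: Rintegral_supp => p /fK ->; rewrite mul0r.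
  rewrite (_ : (fun q => _) = fun q => \int[m]_(p in K) complex.Im (f p * ker g p q)).
    exact: (@parametric_continuous R X hX m mK X
      (fun p q => complex.Im (f p * ker g p q)) K K i2 cK mKb).
  by apply/funext => q; apply: Rintegral_supp => p /fK ->; rewrite mul0r.
exists Q => // q nq; rewrite /coset_convolution.
have z p : f p * ker g p q = 0.
  by have [/hQ->//|/fK->] := pselect (K p); rewrite ?mulr0 ?mul0r.
rewrite /cintegral; apply/eqP; rewrite eq_complex /=; apply/andP; split; apply/eqP.
  under eq_Rintegral do rewrite -/(ker g _ q) z.
  by rewrite Rintegral_cst// mul0r.
under eq_Rintegral do rewrite -/(ker g _ q) z.
by rewrite Rintegral_cst// mul0r.
Qed.

Let cintegral_eq (f g : X -> R[i]) : f =1 g -> cintegral m f = cintegral m g.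
Proof. by move=> /funext ->. Qed.

Lemma conv_addl f f' g : Cc f -> Cc f' -> Cc g ->
  conv (f \+ f') g =1 conv f g \+ conv f' g.
Proof.
move=> Cf Cf' /CcE[cg _] q.
rewrite /= -cintegralD; [|exact: integrand_cintegrable|exact: integrand_cintegrable].
by apply: cintegral_eq => p; rewrite mulrDl.
Qed.

Lemma conv_addr f g g' : Cc f -> Cc g -> Cc g' ->
  conv f (g \+ g') =1 conv f g \+ conv f g'.
Proof.
move=> Cf /CcE[cg _] /CcE[cg' _] q.
rewrite /= -cintegralD; [|exact: integrand_cintegrable|exact: integrand_cintegrable].
by apply: cintegral_eq => p; rewrite /ker J_add// mulrDr.
Qed.

Lemma conv_scalel c f g : Cc f -> Cc g ->
  conv (fun x => c * f x) g =1 (fun x => c * conv f g x).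
Proof.
move=> Cf /CcE[cg _] q.
rewrite /= -cintegralZ; last exact: integrand_cintegrable.
by apply: cintegral_eq => p; rewrite mulrA.
Qed.

Lemma conv_scaler c f g : Cc f -> Cc g ->
  conv f (fun x => c * g x) =1 (fun x => c * conv f g x).
Proof.
move=> Cf /CcE[cg _] q.
rewrite /= -cintegralZ; last exact: integrand_cintegrable.
by apply: cintegral_eq => p; rewrite /ker J_scale// mulrCA.
Qed.

Lemma normc_conv f g q : Cc f -> Cc g ->
  normc (conv f g q) <= \int[m]_p (normc (f p) * normc (ker g p q)).
Proof.
move=> Cf /CcE[cg _]; rewrite (le_trans (normc_cintegral _))//.
  exact: integrand_cintegrable.
by under eq_Rintegral do rewrite normcM.
Qed.

Lemma normc_Cc_integrable f : Cc f ->
  m.-integrable setT (EFin \o (fun p : borel X => normc (f p))).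
Proof. by move=> Cf; apply: cintegrable_normc; exact: Cc_cintegrable. Qed.

Lemma conv_bound f g (s : R) : Cc f -> Cc g -> (forall x, normc (g x) <= s) ->
  forall x, normc (conv f g x) <= nL1 m f * s.
Proof.
move=> Cf Cg gs q; rewrite (le_trans (normc_conv q Cf Cg))//.
have [cg _] := CcE Cg.
rewrite -[nL1 m f]/(\int[m]_p normc (f p)) -RintegralZr//;
  last exact: normc_Cc_integrable.
apply: le_Rintegral => //.
- have := normc_Cc_integrable (integrand_Cc q Cf cg).
  by apply: eq_integrable => // p _; rewrite /= normcM.
- exact: (integrableZr measurableT s (normc_Cc_integrable Cf)).
move=> p _; rewrite ler_wpM2l ?normc_nneg// (le_trans (normc_J _ cg))//.
by apply: (H_average_le hG cH haar dh1) => //; exact: ccont_normc.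
Qed.

Let normc_vanish f (K : set X) : vanish_off K f -> forall p, ~ K p -> normc (f p) = 0.
Proof. by move=> fK p /fK ->; rewrite normc0. Qed.

(** Tonelli, the invariance of [m], and the fact that averaging over [H]
    preserves the integral. *)
Lemma conv_norm f g : Cc f -> Cc g -> nL1 m (conv f g) <= nL1 m f * nL1 m g.
Proof.
move=> Cf Cg; have [cf [K cK fK]] := CcE Cf; have [cg [L cL gL]] := CcE Cg.
pose ng p := normc (g p); pose A := H_average dh ng.
have cng : continuous ng by exact: ccont_normc.
have ngL : forall p, ~ L p -> ng p = 0 by exact: normc_vanish.
have cA : continuous A by exact: (H_average_continuous hG cH haar cng).
have AH : H_invariant A by move=> h p; exact: (H_average_act hG cH haar dh1 h p cng).
have AL : forall p, ~ sat L p -> A p = 0 by exact: (H_average_supp dh ngL).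
have [Q cQ hQ] := kernel_supp lG AH cK (csat cL) AL.
pose F p q := normc (f p) * A (coset_act (repr p)^-1%g q).
have cF : continuous (fun pq : X * X => F pq.1 pq.2).
  move=> pq; apply: cvgM; last exact: (kernel_continuous AH cA).
  by have := ccont_normc (fst_ccont cf); exact.
have FK p q : ~ K p -> F p q = 0 by move=> /fK fp; rewrite /F fp normc0 mul0r.
have FQ p q : ~ Q q -> F p q = 0.
  by have [Kp nq|/FK//] := pselect (K p); rewrite /F hQ// mulr0.
have cFp q : continuous (F ^~ q).
  move=> p; apply: (@continuous_comp X (X * X)%type R (fun p => (p, q))
    (fun pq => F pq.1 pq.2)); last exact: cF.
  exact: section_continuous.
have mQ : measurable (Q : set (borel X)) by exact: compact_borel.
have mKb : measurable (K : set (borel X)) by exact: compact_borel.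
have cFint : continuous (fun q => \int[m]_p F p q).
  rewrite (_ : (fun q => _) = fun q => \int[m]_(p in K) F p q).
    exact: (@parametric_continuous R X hX m mK X F K K cF cK mKb).
  by apply/funext => q; apply: Rintegral_supp => p /FK.
have iF q : m.-integrable setT (EFin \o (F ^~ q : borel X -> R)).
  exact: (Cc_integrable hX mK (@cFp q) cK (fun p => @FK p q)).
apply: (@le_trans _ _ (\int[m]_q \int[m]_p F p q)).
  apply: le_Rintegral => //.
  - by apply: normc_Cc_integrable; exact: conv_Cc.
  - apply: (Cc_integrable hX mK cFint cQ) => q nq.
    by under eq_Rintegral do rewrite FQ//; rewrite Rintegral_cst// mul0r.
  move=> q _; rewrite (le_trans (normc_conv q Cf Cg))//; apply: le_Rintegral => //.
    have := normc_Cc_integrable (integrand_Cc q Cf cg).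
    by apply: eq_integrable => // p _; rewrite /= normcM.
  by move=> p _; rewrite ler_wpM2l ?normc_nneg//; exact: normc_J.
rewrite -(fubini_Cc hX hX mK mK cF cK cQ FK FQ).
rewrite -[nL1 m f]/(\int[m]_p normc (f p)) -RintegralZr//;
  last exact: normc_Cc_integrable.
rewrite le_eqVlt; apply/orP; left; apply/eqP; apply: eq_Rintegral => p _.
have iA : m.-integrable setT
    (EFin \o (fun q : borel X => A (coset_act (repr p)^-1%g q))).
  apply: (Cc_integrable hX mK _ (compact_translate (@compact_set1 _ (repr p)) (csat cL))).
    by move=> q; apply: continuous_comp; [exact: coset_actl_continuous|exact: cA].
  move=> q nq; apply: AL => Aq; apply: nq.
  by exists (repr p, coset_act (repr p)^-1%g q) => //=; rewrite coset_actK.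
rewrite /F RintegralZl; [|exact: measurableT|exact: iA].
congr (_ * _); rewrite (coset_measure_invariant hG cH mK mI)//; last first.
  by exists (sat L) => //; exact: csat.
by apply: (Rintegral_H_average hG cH haar dh1 mK mI) => //; exists L.
Qed.

Let cintegral_invariant f (x : G) : Cc f ->
  cintegral m (fun p => f (coset_act x p)) = cintegral m f.
Proof.
move=> /CcE[[f1 f2] [K cK fK]]; rewrite /cintegral; congr (_ +i* _)%C.
  apply: (coset_measure_invariant hG cH mK mI _ f1).
  by exists K => // p /fK ->.
apply: (coset_measure_invariant hG cH mK mI _ f2).
by exists K => // p /fK ->.
Qed.

(** [J] commutes with right convolution: translate by [h] inside the average. *)
Lemma J_conv f g r : Cc f -> Cc g -> J (conv f g) r = conv (J f) g r.
Proof.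
move=> Cf Cg; have [cf [K cK fK]] := CcE Cf; have [cg [L cL gL]] := CcE Cg.
pose F (h : HT) s := f (coset_act (val h) s) * ker g s r.
have convF : (fun h : HT => conv f g (coset_act (val h) r)) =
    fun h => cintegral m (F h).
  apply/funext => h; rewrite /coset_convolution.
  rewrite -(cintegral_invariant (val h) (integrand_Cc _ Cf cg)).
  by apply: cintegral_eq => s; rewrite /F ker_act.
rewrite /J_operator convF.
have [c1 c2] : ccont (fun hs : HT * X => F hs.1 hs.2).
  apply: ccontM.
    exact: (ccont_comp (@subgroup_act_continuous G H) cf).
  apply: (ccont_comp (h := fun hs : HT * X => (hs.2, r)) _ (ker_ccont cg)) => hs.
  apply: (@pair_continuous _ X X snd (fun=> r)); first exact: cvg_snd.
  exact: (@cst_continuous (HT * X)%type X r hs).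
have FT h s : ~ [set: HT] h -> F h s = 0 by move=> n; exact: (False_ind _ (n I)).
have FK h s : ~ sat K s -> F h s = 0.
  by move=> ns; rewrite /F (fK _ (fun Ks => ns (mem_sat Ks))) mul0r.
rewrite (@cfubini_Cc R HT X hH hX dh m dhK mK F setT (sat K) c1 c2 cHT (csat cK) FT FK).
apply: cintegral_eq => s; rewrite mulrC -cintegralZ; last exact: J_cintegrable.
by congr cintegral; apply/funext => h; rewrite /F mulrC.
Qed.

Let ker_Cc f p : Cc f -> Cc (ker f p).
Proof.
move=> /CcE[cf [K cK fK]]; apply: CcI.
  by apply: (ccont_comp (f := J f)); [exact: coset_actl_continuous|exact: J_ccont].
have [Q cQ hQ] := conv_supp cf (@compact_set1 _ p) cK fK.
by exists Q => // q nq; exact: hQ.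
Qed.

(** The right-hand side is the double integral of [f p * k_f' p s * k_g s q]
    over [s] and [p], by [J_conv] and the substitution [s |-> p^-1 s]; so is
    the left-hand side, with the integrals in the other order. *)
Lemma conv_assoc f f' g : Cc f -> Cc f' -> Cc g ->
  conv (conv f f') g =1 conv f (conv f' g).
Proof.
move=> Cf Cf' Cg q; symmetry.
have [cf [K cK fK]] := CcE Cf; have [cf' [K' cK' fK']] := CcE Cf'.
have [cg [L cL gL]] := CcE Cg.
have CJ : Cc (J f').
  apply: CcI; first exact: J_ccont.
  by exists (sat K'); [exact: csat|exact: J_vanish].
pose F p s := f p * ker f' p s * ker g s q.
transitivity (cintegral m (fun p => cintegral m (F p))).
  apply: cintegral_eq => p; rewrite J_conv//.
  rewrite /coset_convolution.
  rewrite -(cintegral_invariant (repr p)^-1%g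
    (integrand_Cc (coset_act (repr p)^-1%g q) CJ cg)).
  have -> : cintegral m (fun s => J f' (coset_act (repr p)^-1%g s) *
      ker g (coset_act (repr p)^-1%g s) (coset_act (repr p)^-1%g q)) =
      cintegral m (fun s => ker f' p s * ker g s q).
    by apply: cintegral_eq => s; rewrite ker_act.
  rewrite -cintegralZ; last exact: integrand_cintegrable (ker_Cc p Cf') cg.
  by apply: cintegral_eq => s; rewrite mulrA.
have [Q cQ hQ] := conv_supp cf' cK cK' fK'.
have [c1 c2] : ccont (fun ps : X * X => F ps.1 ps.2).
  apply: ccontM; first exact: integrand_ccont.
  apply: (ccont_comp (h := fun ps : X * X => (ps.2, q)) _ (ker_ccont cg)) => ps.
  apply: (@pair_continuous _ X X snd (fun=> q)); first exact: cvg_snd.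
  exact: (@cst_continuous (X * X)%type X q ps).
rewrite (@cfubini_Cc R X X hX hX m m mK mK F K Q c1 c2 cK cQ).
- apply: cintegral_eq => s; rewrite mulrC -cintegralZ; last exact: integrand_cintegrable.
  by apply: cintegral_eq => p; rewrite /F mulrC.
- by move=> p s /fK fp; rewrite /F fp !mul0r.
- move=> p s ns; rewrite /F.
  by have [Kp|/fK->] := pselect (K p); rewrite ?mul0r// hQ// mulr0 mul0r.
Qed.

End convolution.

(** * Density of compactly supported functions in [L^1] *)

Import HBSimple.

Section Cc_density.
Context {R : realType} {X : ptopologicalType}.
Hypotheses (hX : hausdorff_space X) (lX : locally_compact [set: X]).
Variable m : {measure set (borel X) -> \bar R}.
Hypothesis mR : radon_measure m.
Implicit Types (f g d : X -> R[i]) (u : X -> R) (c : R[i]).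
Local Notation L1 := (L1_space m).

Let mK : forall K : set X, compact K -> (m K < +oo)%E.
Proof. exact: radon_compact. Qed.

(** Compactness of [K] reduces this to a point [x] of [U]; there, a function
    separating [x] from the complement of a compact neighbourhood inside [U] is
    truncated so as to be constant near [x]. *)
Lemma urysohn_Cc (K U : set X) : compact K -> open U -> K `<=` U ->
  exists u, [/\ continuous u, forall x, 0 <= u x <= 1, forall x, K x -> u x = 1,
    forall x, ~ U x -> u x = 0 & exists2 L, compact L & forall x, ~ L x -> u x = 0].
Proof.
move=> cK oU KU.
pose P (A : set X) := exists u, [/\ continuous u, forall x, 0 <= u x <= 1,
  forall x, A x -> u x = 1, forall x, ~ U x -> u x = 0 &
  exists2 L, compact L & forall x, ~ L x -> u x = 0].
apply: (@compact_induction X K P cK).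
- exists (fun=> 0); split=> //.
  + by move=> x; exact: cvg_cst.
  + by move=> x; rewrite lexx ler01.
  + by exists set0 => //; exact: compact0.
- move=> A B [u [cu u01 uA uU [L cL uL]]] [v [cv v01 vB vU [L' cL' vL']]].
  exists (fun x => Num.max (u x) (v x)); split.
  + by move=> x; apply: continuous_max; [exact: cu|exact: cv].
  + move=> x; have /andP[u0 u1] := u01 x; have /andP[v0 v1] := v01 x.
    by rewrite le_max u0 ge_max u1 v1.
  + move=> x; have /andP[u0 u1] := u01 x; have /andP[v0 v1] := v01 x.
    by move=> [/uA ->|/vB ->]; [rewrite max_l|rewrite max_r].
  + by move=> x nU; rewrite uU// vU// maxxx.
  + exists (L `|` L'); first exact: compactU.
    by move=> x /not_orP[/uL -> /vL' ->]; rewrite maxxx.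
- move=> A B AB [u [cu u01 uB uU uL]]; exists u; split=> //.
  by move=> x /AB; exact: uB.
move=> x /KU Ux.
have [V xV [cV clV]] := lX (I : [set: X] x).
have xV' : nbhs x V by rewrite /within/= in xV; apply: filterS xV => y; apply.
pose B := ~` (U `&` V°).
have clB : closed B by apply: open_closedC; apply: openI => //; exact: open_interior.
have nBx : ~ B x by apply; split => //; exact: nbhs_singleton (nbhs_interior xV').
have /(@uniform_separatorP _ R)[u [cu u01 u0 u1]] :=
  @locally_compact_completely_regular X R lX hX x B clB nBx.
have ux : u x = 0 by apply: u0; exists x.
have uB y : B y -> u y = 1 by move=> By; apply: u1; exists y.
have u01' y : 0 <= u y <= 1.
  by have /u01 : range u (u y) by []; rewrite /= in_itv.
pose v y := Num.min 1 (2 * (1 - u y)).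
exists [set y | u y < 1 / 2].
  by apply: (cvgr_lt _ (cu x)); rewrite ux divr_gt0.
have v0 y : B y -> v y = 0 by move=> /uB uy; rewrite /v uy subrr mulr0 min_r.
exists v; split.
- move=> y; apply: (@continuous_min R X (fun=> 1) (fun y => 2 * (1 - u y))).
    exact: cvg_cst.
  by apply: cvgMl_tmp; apply: cvgB; [exact: cvg_cst|exact: cu].
- move=> y; have /andP[uy0 uy1] := u01' y.
  by rewrite le_min ler01 mulr_ge0 ?subr_ge0// ge_min lexx.
- by move=> y /= uy; rewrite /v min_l//; lra.
- by move=> y nU; apply: v0 => -[].
- by exists V => // y nV; apply: v0 => -[_ /interior_subset].
Qed.

Definition Cc_approximable f :=
  forall e : R, 0 < e -> exists2 d, Cc d & nL1 m (f \- d) <= e.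

Let CcL1 d : Cc d -> L1 d. Proof. exact: Cc_L1. Qed.

Lemma approximable_lim f : L1 f ->
  (forall e : R, 0 < e -> exists g, [/\ L1 g, Cc_approximable g & nL1 m (f \- g) <= e]) ->
  Cc_approximable f.
Proof.
move=> Lf h e e0; have e20 : 0 < e / 2 by rewrite divr_gt0.
have [g [Lg ag fg]] := h _ e20; have [d Cd gd] := ag _ e20.
exists d => //; have Ld := CcL1 Cd.
have LB := nL1D (L1B Lf Lg) (L1B Lg Ld).
rewrite (splitr e) (le_trans _ (le_trans LB (lerD fg gd)))//.
apply: nL1_le; [exact: L1B|by apply: L1D; exact: L1B|].
by apply: aeW => x /=; rewrite addrA subrK.
Qed.

Lemma approximableD f g : L1 f -> L1 g -> Cc_approximable f ->
  Cc_approximable g -> Cc_approximable (f \+ g).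
Proof.
move=> Lf Lg af ag e e0; have e20 : 0 < e / 2 by rewrite divr_gt0.
have [d Cd fd] := af _ e20; have [d' Cd' gd'] := ag _ e20.
exists (d \+ d'); first exact: Cc_add.
have Ld := CcL1 Cd; have Ld' := CcL1 Cd'.
rewrite (splitr e) (le_trans _ (le_trans (nL1D (L1B Lf Ld) (L1B Lg Ld')) (lerD fd gd')))//.
apply: nL1_le; [by apply: L1B; exact: L1D|by apply: L1D; exact: L1B|].
by apply: aeW => x /=; rewrite opprD addrACA.
Qed.

Lemma approximableZ c f : L1 f -> Cc_approximable f ->
  Cc_approximable (fun x => c * f x).
Proof.
move=> Lf af e e0; have c0 : 0 < normc c + 1 by rewrite ltr_wpDl// normc_nneg.
have [|d Cd fd] := af (e / (normc c + 1)); first by rewrite divr_gt0.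
exists (fun x => c * d x); first exact: Cc_scale.
rewrite (_ : _ \- _ = fun x => c * (f \- d) x); last first.
  by apply/funext => x /=; rewrite mulrBr.
rewrite nL1Z; last by apply: L1B => //; exact: CcL1.
rewrite (le_trans (ler_wpM2l (normc_nneg c) fd))// mulrA ler_pdivrMr//.
by rewrite mulrC ler_pM2l// lerDl.
Qed.

Lemma Cc0 : Cc (fun _ : X => 0 : R[i]).
Proof.
apply/CcP => //; split; [by move=> x; exact: cvg_cst|by move=> x; exact: cvg_cst|].
by exists set0 => //; exact: compact0.
Qed.

Lemma approximable_cst0 : Cc_approximable (fun=> 0).
Proof.
move=> e e0; exists (fun=> 0); first exact: Cc0.
rewrite /nL1 nL1_ae0 ?ltW//; last by apply: aeW => x /=; rewrite subrr.
Qed.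

Lemma approximable_sum (I : Type) (s : seq I) (F : I -> X -> R[i]) :
  (forall i, L1 (F i) /\ Cc_approximable (F i)) ->
  L1 (fun x => \sum_(i <- s) F i x) /\
  Cc_approximable (fun x => \sum_(i <- s) F i x).
Proof.
move=> hF; elim: s => [|i s [Ls as_]].
  under eq_fun do rewrite big_nil.
  by split; [apply: CcL1; exact: Cc0|exact: approximable_cst0].
under eq_fun do rewrite big_cons.
by have [Li ai] := hF i; split; [exact: L1D|exact: approximableD].
Qed.

Lemma L1_indic (A : set (borel X)) : measurable A -> (m A < +oo)%E ->
  L1 (fun x => (\1_A x : R)%:C%C).
Proof.
move=> mA fA; split.
  by apply: cmeasurable_real; exact: measurable_indic.
rewrite /L1_norm; under eq_integral do rewrite normc_real ger0_norm//.
by rewrite integral_indic// setIT.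
Qed.

(** Squeeze [A] by outer regularity and the open set so obtained by inner
    regularity; an intermediate function differs from the indicator of [A] only
    on the two thin layers. *)
Lemma approximable_indic (A : set (borel X)) : measurable A -> (m A < +oo)%E ->
  Cc_approximable (fun x => (\1_A x : R)%:C%C).
Proof.
move=> mA fA e e0; have e20 : 0 < e / 2 by rewrite divr_gt0.
have Afin : m A \is a fin_num by rewrite ge0_fin_numE.
have [U [oU AU] mU] : exists2 U : set X, open U /\ A `<=` U &
    (m U < m A + (e / 2)%:E)%E.
  have := radon_outer mR mA; set S := [set _ | _ in _] => mAE.
  have Sfin : ereal_inf S \is a fin_num by rewrite -mAE.
  have [_ [U [oU AU] <-] mU] := lb_ereal_inf_adherent e20 Sfin.
  by exists U => //; rewrite mAE.
have mUb : measurable (U : set (borel X)) by exact: open_borel.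
have Ufin : (m U < +oo)%E.
  by apply: lt_trans mU _; rewrite lte_add_pinfty ?ltry.
have Ufin' : m U \is a fin_num by rewrite ge0_fin_numE.
have [K [cK KU] mKU] : exists2 K : set X, compact K /\ K `<=` U &
    (m U - (e / 2)%:E < m K)%E.
  have := radon_inner mR oU; set S := [set _ | _ in _] => mUE.
  have Sfin : ereal_sup S \is a fin_num by rewrite -mUE.
  have [_ [K [cK KU] <-] mKU] := ub_ereal_sup_adherent e20 Sfin.
  by exists K => //; rewrite mUE.
have mKb : measurable (K : set (borel X)) by exact: compact_borel.
have [u [cu u01 uK uU [L cL uL]]] := urysohn_Cc cK oU KU.
have Cu : Cc (fun x => (u x)%:C%C).
  apply/CcP => //; split=> //=; first by move=> x; exact: cvg_cst.
  by exists L => // x /uL ->.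
exists (fun x => (u x)%:C%C) => //.
have LA := L1_indic mA fA.
rewrite -lee_fin -L1_normE; last by apply: L1B => //; exact: CcL1.
have mUA : measurable (U `\` A : set (borel X)) by exact: measurableD.
have mUK : measurable (U `\` K : set (borel X)) by exact: measurableD.
apply: (@le_trans _ _ (\int[m]_x ((\1_(U `\` A) x)%:E + (\1_(U `\` K) x)%:E))%E).
  apply: ge0_le_integral => //.
  - by move=> x _; rewrite lee_fin normc_nneg.
  - by apply: measurable_normcE; case: (L1B LA (CcL1 Cu)).
  - by apply: emeasurable_funD; apply/measurable_EFinP; exact: measurable_indic.
  move=> x _; rewrite -EFinD lee_fin.
  rewrite [X in normc X](_ : _ = (\1_A x - u x)%:C%C); last by rewrite rmorphB.
  rewrite normc_real !indicE.
  have /andP[u0 u1] := u01 x.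
  have [Ax|Ax] := pselect (A x).
    have Ux := AU _ Ax.
    rewrite (mem_set Ax) (memNset (A := U `\` A)); last by move=> [].
    have [Kx|Kx] := pselect (K x).
      by rewrite (uK _ Kx) subrr normr0 addr_ge0.
    rewrite (mem_set (A := U `\` K)); last by [].
    by rewrite add0r ger0_norm ?subr_ge0// gerBl.
  rewrite (memNset Ax) sub0r normrN ger0_norm//.
  have [Ux|Ux] := pselect (U x); last by rewrite uU// addr_ge0.
  rewrite (mem_set (A := U `\` A)); last by [].
  by rewrite (le_trans u1)// lerDl.
rewrite ge0_integralD//; last 2 first.
- by apply/measurable_EFinP; exact: measurable_indic.
- by apply/measurable_EFinP; exact: measurable_indic.
rewrite !integral_indic// !setIT.
have KfinE : m K \is a fin_num by rewrite ge0_fin_numE// mK.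
rewrite !measureD// (setIidr AU) (setIidr KU).
apply: (@le_trans _ _ ((fine (m U))%:E - (fine (m A))%:E +
    ((fine (m U))%:E - (fine (m K))%:E))%E); first by rewrite !fineK.
have h1 : fine (m U) < fine (m A) + e / 2 by rewrite -lte_fin EFinD !fineK.
have h2 : fine (m U) - e / 2 < fine (m K) by rewrite -lte_fin EFinB !fineK.
by rewrite -!EFinD lee_fin; lra.
Qed.

Lemma L1_real (r : borel X -> R) : m.-integrable setT (EFin \o r) ->
  L1 (fun x => (r x)%:C%C).
Proof.
move=> /integrableP[mr fr]; split.
  by apply: cmeasurable_real; exact/measurable_EFinP.
by rewrite /L1_norm; under eq_integral do rewrite normc_real.
Qed.

Lemma approximable_real (r : borel X -> R) : m.-integrable setT (EFin \o r) ->
  Cc_approximable (fun x => (r x)%:C%C).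
Proof.
move=> ir.
apply: approximable_lim; first exact: L1_real.
move=> e e0.
have [s_ [is_ _ s0]] := approximation_sfun_integrable measurableT ir.
have [N _ hN] : \forall n \near \oo,
    (\int[m]_x `|(r x)%:E - (s_ n x)%:E| < e%:E)%E.
  have oe : open [set y : \bar R | (y < e%:E)%E] by exact: open_ereal_lt_ereal.
  have ne : nbhs (0%E : \bar R) [set y : \bar R | (y < e%:E)%E].
    by apply: open_nbhs_nbhs; split=> //=; rewrite lte_fin.
  exact: (s0 _ ne).
pose s := s_ N; have ints : m.-integrable setT (EFin \o s) by exact: is_.
have Ls := L1_real ints.
exists (fun x => (s x)%:C%C); split=> //; last first.
  rewrite -lee_fin -L1_normE; last by apply: L1B => //; exact: L1_real.
  apply: ltW; apply: le_lt_trans (hN N (leqnn N)).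
  rewrite le_eqVlt; apply/orP; left; apply/eqP; apply: eq_integral => x _.
  rewrite [X in normc X](_ : _ = (r x - s x)%:C%C); last by rewrite rmorphB.
  by rewrite normc_real.
have fin (y : R) : y != 0 -> (m (s @^-1` [set y]) < +oo)%E.
  move=> y0; have my : measurable (s @^-1` [set y]) by exact: measurable_sfunP.
  have y0' : 0 < `|y| by rewrite normr_gt0.
  have /integrableP[_ sfin] := integrableS measurableT my (@subsetT _ _) ints.
  rewrite ltey; apply/eqP => moo; move: sfin.
  have -> : (\int[m]_(x in s @^-1` [set y]) `|(EFin \o s) x| =
      \int[m]_(x in s @^-1` [set y]) (cst `|y|%:E) x)%E.
    by apply: eq_integral => x; rewrite inE /= => ->.
  by rewrite integral_cst// moo mulry gtr0_sg// mul1e ltxx.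
have LAi (y : R) : L1 (fun x => y%:C%C * (\1_(s @^-1` [set y]) x : R)%:C%C) /\
    Cc_approximable (fun x => y%:C%C * (\1_(s @^-1` [set y]) x : R)%:C%C).
  have [->|y0] := eqVneq y 0.
    rewrite (_ : (fun x => _) = fun=> 0); last first.
      by apply/funext => x; rewrite mul0r.
    split; last exact: approximable_cst0.
    by apply: CcL1; exact: Cc0.
  have my : measurable (s @^-1` [set y]) by exact: measurable_sfunP.
  split; first by apply: L1Z; apply: L1_indic => //; exact: fin.
  apply: approximableZ; first by apply: L1_indic => //; exact: fin.
  by apply: approximable_indic => //; exact: fin.
pose F (y : R) x : R[i] := y%:C%C * (\1_(s @^-1` [set y]) x : R)%:C%C.
have [_] := @approximable_sum _ (finmap.enum_fset (fset_set (range s))) F LAi.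
congr Cc_approximable; apply/funext => x.
rewrite [in RHS]fimfunE fsbig_finite//= rmorph_sum /=.
by apply: eq_bigr => y _; rewrite rmorphM.
Qed.

Lemma approximable_L1 f : L1 f -> Cc_approximable f.
Proof.
move=> Lf; have [[f1 f2] fin] := Lf.
have iN : m.-integrable setT (fun x => (normc (f x))%:E).
  apply/integrableP; split; first by apply: measurable_normcE; case: Lf.
  by under eq_integral do rewrite /= ger0_norm ?normc_nneg//.
have i1 : m.-integrable setT (EFin \o (fun x => complex.Re (f x))).
  apply: le_integrable iN => //; first exact/measurable_EFinP.
  by move=> x _; rewrite /= lee_fin (ger0_norm (normc_nneg _)) ler_Re_normc.
have i2 : m.-integrable setT (EFin \o (fun x => complex.Im (f x))).
  apply: le_integrable iN => //; first exact/measurable_EFinP.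
  by move=> x _; rewrite /= lee_fin (ger0_norm (normc_nneg _)) ler_Im_normc.
rewrite (_ : f = (fun x => (complex.Re (f x))%:C%C) \+
  (fun x => 'i%C * (complex.Im (f x))%:C%C)); last first.
  by apply/funext => x /=; rewrite -complexE.
apply: approximableD; [exact: L1_real|by apply: L1Z; exact: L1_real|exact: approximable_real|].
by apply: approximableZ; [exact: L1_real|exact: approximable_real].
Qed.

Lemma Cc_dense f : L1 f -> exists2 u : nat -> X -> R[i], (forall n, Cc (u n)) &
  L1cvg m u f.
Proof.
move=> Lf; have af := approximable_L1 Lf.
have /choice[u hu] : forall n : nat, exists d, Cc d /\ nL1 m (f \- d) <= n.+1%:R^-1.
  by move=> n; have [|d Cd fd] := af (n.+1%:R^-1); [rewrite invr_gt0|exists d].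
exists u; first by move=> n; case: (hu n).
apply: (@L1cvg_le _ _ _ _ _ _ (fun n => n.+1%:R^-1)).
  by move=> n; rewrite nL1_distC; case: (hu n).
exact: cvg_harmonic.
Qed.

Lemma Cc_clip (s : R) d : 0 < s -> Cc d -> Cc (fun x => clip s (d x)).
Proof.
move=> s0 Cd; have [d1 d2 _] := (CcP d hX).1 Cd.
apply: Cc_mul => //=; last by move=> x; exact: cvg_cst.
move=> x; apply: (@continuous_comp X R R (fun x => normc (d x))
  (fun y => s / Num.max y s)); first exact: normc_continuous.
exact: continuous_clip_factor.
Qed.

(** Clipping an approximant to the disc of radius [s] at most doubles its
    distance to a function with values in that disc. *)
Lemma Cc_dense_bound f (s : R) : L1 f -> 0 < s ->
  {ae m, forall x : borel X, normc (f x) <= s} ->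
  exists2 u : nat -> X -> R[i],
    (forall n, Cc (u n) /\ forall x, normc (u n x) <= s) & L1cvg m u f.
Proof.
move=> Lf s0 fs; have [d Cd df] := Cc_dense Lf.
exists (fun n x => clip s (d n x)).
  by move=> n; split; [exact: Cc_clip|move=> x; exact: normc_clip].
apply: (@L1cvg_le _ _ _ _ _ _ (fun n => 2 * nL1 m (d n \- f))); last first.
  by rewrite -[X in _ --> X](mulr0 2); apply: cvgMl_tmp.
move=> n; have Ld := CcL1 (Cd n); have Lc := CcL1 (Cc_clip s0 (Cd n)).
have h1 : nL1 m (d n \- (fun x => clip s (d n x))) <= nL1 m (d n \- f).
  apply: nL1_le; [exact: L1B|exact: L1B|].
  apply: filterS fs => x fx /=; rewrite normc_sub_clip// ge_max normc_nneg andbT.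
  rewrite (le_trans _ (le_trans (ler_norm _) (ler_dist_normc _ _)))//.
  by rewrite lerB.
rewrite mulr_natl mulr2n (le_trans _ (lerD h1 (lexx _)))//.
rewrite [X in _ <= X + _]nL1_distC.
apply: le_trans (nL1D (L1B Lc Ld) (L1B Ld Lf)).
apply: nL1_le; [exact: L1B|by apply: L1D; exact: L1B|].
by apply: aeW => x /=; rewrite addrA subrK.
Qed.

End Cc_density.

(** * The module structure *)

Lemma Cc_convolution_core {R : realType} {G : topologicalGroupType}
    {H : groupClosed G} (dh : {measure set (borel (subgroup_type H)) -> \bar R})
    (m : {measure set (borel (coset_space H)) -> \bar R}) :
  hausdorff_space G -> locally_compact [set: G] ->
  compact [set x : G | x \in H] -> haar_measure dh -> dh setT = 1%E ->
  radon_measure m ->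
  (forall (x : G) (A : set (borel (coset_space H))), measurable A ->
    m [set coset_act x p | p in A] = m A) ->
  dense_convolution_core m (fun f : borel (coset_space H) -> R[i] => Cc f)
    (coset_convolution dh m).
Proof.
move=> hG lG cH haar dh1 mR mI.
have hX : hausdorff_space (coset_space H) by exact: coset_hausdorff.
have lX : locally_compact [set: coset_space H] by exact: coset_locally_compact.
have mK : forall K : set (coset_space H), compact K -> (m K < +oo)%E.
  exact: radon_compact.
split.
- by move=> f; exact: Cc_L1.
- by move=> f; exact: Cc_dense.
- by move=> f s; exact: Cc_dense_bound.
- by move=> f g; exact: Cc_add.
- by move=> c f; exact: Cc_scale.
- by move=> f g; exact: conv_Cc.
- by move=> f f' g; exact: conv_addl.
- by move=> f g g'; exact: conv_addr.
- by move=> c f g; exact: conv_scalel.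
- by move=> c f g; exact: conv_scaler.
- by move=> f f' g; exact: conv_assoc.
- by move=> f g; exact: conv_norm.
- by move=> f g s; exact: conv_bound.
Qed.

Theorem theorem3p7 (R : realType) (G : topologicalGroupType)
  (H : groupClosed G)
  (dx : {measure set (borel G) -> \bar R})
  (dh : {measure set (borel (subgroup_type H)) -> \bar R})
  (m : {measure set (borel (coset_space H)) -> \bar R})
  (phi : R -> \bar R)
  (mul1 : (coset_space H -> R[i]) -> (coset_space H -> R[i]) ->
          (coset_space H -> R[i])) :
  hausdorff_space G -> locally_compact [set: G] ->
  compact [set x : G | x \in H] ->
  haar_measure dx ->
  haar_measure dh -> dh setT = 1%E ->
  normalized_invariant_measure dx dh m ->
  young_function phi -> delta2 m phi ->
  continuous_L1_product m mul1 ->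
  (forall f g, Cc f -> Cc g -> mul1 f g = coset_convolution dh m f g %[ae m]) ->
  exists act : (coset_space H -> R[i]) -> (coset_space H -> R[i]) ->
               (coset_space H -> R[i]),
    (forall f g, Cc f -> Cc g ->
       act f g = coset_convolution dh m f g %[ae m]) /\
    banach_left_L1_module m phi mul1 act.
Proof.
move=> hG lG cH _ haar dh1 [mR mI _] phiY d2 mulC mul_conv.
have core := Cc_convolution_core hG lG cH haar dh1 mR mI.
have cp := contractive_of_core mulC core mul_conv.
exists (L1_action m mul1); split; last exact: orlicz_banach_module.
move=> f g Cf Cg.
have Lf := core_L1 core Cf; have Lg := core_L1 core Cg.
by apply: filterS2 (L1_actionE cp Lf Lg) (mul_conv f g Cf Cg) => x -> + _; exact.
Qed.
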